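(* Let $f\in C^\infty(\mathbb T^2)$ be real-valued, with Fourier coefficients $\hat f(n)$, $n\in\mathbb Z^2$. For each odd prime $N$ let $\{\psi_j\}_{j=1}^N$ be a Hecke basis of $\mathcal H_N$ and put $$F_j^{(N)}=\sqrt N\Big(\langle \operatorname{Op}_N(f)\psi_j,\psi_j\rangle-\int_{\mathbb T^2}f(x)\,dx\Big).$$ For $\nu\in\mathbb Z$ let $f^\#(\nu)=\sum_{n=(n_1,n_2)\in\mathbb Z^2,\ Q(n)=\nu}(-1)^{n_1n_2}\hat f(n)$. Then, as $N\to\infty$ through primes, $$\frac1N\sum_{j=1}^N|F_j^{(N)}|^2\longrightarrow \sum_{\nu\neq0}|f^\#(\nu)|^2 ,$$ and this limit equals $\mathbf E(X_f^2)$, where $X_f=\sum_{\nu\ne0}f^\#(\nu)\operatorname{tr}(U_\nu)$ with $U_\nu$ independent Haar-random matrices in $SU(2)$.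
   Context: Let $A=\begin{pmatrix}a&b\\c&d\end{pmatrix}\in SL(2,\mathbb Z)$ be hyperbolic ($|a+d|>2$) with $A\equiv I\bmod 2$, and let $Q(x,y)=cx^2+(d-a)xy-by^2$. Vectors in $\mathbb Z^2$ are row vectors and matrices act on the right ($n\mapsto nB$). For $N$ an odd prime, $\mathcal H_N=L^2(\mathbb Z/N\mathbb Z)$ with inner product $\langle\phi,\psi\rangle=\frac1N\sum_{x\bmod N}\phi(x)\overline{\psi(x)}$. For $n=(n_1,n_2)\in\mathbb Z^2$ the operator $T_N(n)$ acts by $(T_N(n)\psi)(x)=e^{i\pi n_1n_2/N}e(n_2x/N)\psi(x+n_1)$, where $e(t)=e^{2\pi i t}$; for $f$ with Fourier expansion $f(x)=\sum_n\hat f(n)e(n\cdot x)$, $\operatorname{Op}_N(f)=\sum_n\hat f(n)T_N(n)$. There are unitary operators $U_N(B)$ on $\mathcal H_N$, for $B\in SL_2(\mathbb Z/2N\mathbb Z)$ with $B\equiv I\bmod 2$, satisfying $U_N(B)^{-1}\operatorname{Op}_N(f)U_N(B)=\operatorname{Op}_N(f\circ B)$ (where $(f\circ B)(x)=f(Bx)$) and $U_N(BB')=U_N(B)U_N(B')$. Hecke operators: let $\alpha$ be an eigenvalue of $A$, $\mathcal O=\mathbb Z[\alpha]$; the ideal $\mathbb Zc+\mathbb Z(\alpha-a)$ with this basis is identified with $\mathbb Z^2$, and multiplication gives a ring homomorphism $\iota:\mathcal O\to M_2(\mathbb Z)$ with $\iota(\alpha)=A$, $\det\iota(\beta)$ =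 norm of $\beta$. Let $C(2N)$ be the group of elements of $\mathcal O/2N\mathcal O$ of norm $\equiv1\bmod 2N$ that are $\equiv1\bmod 2\mathcal O$; via reduction of $\iota$ mod $2N$ it is identified with $\{B\in SO(Q,\mathbb Z/2N\mathbb Z):B\equiv I\bmod 2\}$. The Hecke operators are $U_N(B)$, $B\in C(2N)$; they commute with each other and with $U_N(A)$. A Hecke eigenfunction is a simultaneous eigenfunction of all Hecke operators; a Hecke basis is an orthonormal basis of $\mathcal H_N$ consisting of Hecke eigenfunctions.
   Formalization: With row vectors and n↦nB, ι(α)=A does not preserve Q and the claim fails (e.g. A=(5 2;12 5)); the formal version takes ι(α)=Aᵀ, the matrix of α in row coordinates, so that C(2N) lies in SO(Q); equivalently, A with the form bx²+(d−a)xy−cy². *)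

(* Defs.v *)
From HB Require Import structures.
From mathcomp Require Import all_boot all_order all_algebra.
From mathcomp Require Import complex.
From mathcomp Require Import all_classical all_reals all_analysis.

Set Implicit Arguments.
Unset Strict Implicit.
Unset Printing Implicit Defensive.
Import Order.TTheory GRing.Theory Num.Theory.
Import numFieldNormedType.Exports.

Local Open Scope classical_set_scope.
Local Open Scope ring_scope.
Local Open Scope complex_scope.

(* Sums of absolutely convergent families; junk values otherwise. *)

Definition rsum {R : realType} {I : choiceType} (D : set I) (g : I -> R) : R :=
  fine (esum D (EFin \o g)^\+ - esum D (EFin \o g)^\-)%E.

Definition csum {R : realType} {I : choiceType} (D : set I) (g : I -> R[i])
    : R[i] :=
  rsum D (fun i => complex.Re (g i)) +i* rsum D (fun i => complex.Im (g i)).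

(* expi t = e^{i t} and e1 t = e^{2 pi i t} *)
Definition expi {R : realType} (t : R) : R[i] := cos t +i* sin t.
Definition e1 {R : realType} (t : R) : R[i] := expi (2 * pi * t).

(* Functions on T^2 = R^2/Z^2 are Z^2-periodic functions on R * R. *)

Definition dir {R : realType} (b : bool) : R * R :=
  if b then (0, 1) else (1, 0).

Definition partial {R : realType} (b : bool) (g : R * R -> R) : R * R -> R :=
  'D_(dir b) g.

(* All iterated partial derivatives exist and are continuous. *)
Definition smooth {R : realType} (g : R * R -> R) : Prop :=
  forall w : seq bool, let h := foldr partial g w in
    continuous h /\ forall (b : bool) (x : R * R), derivable h x (dir b).

Definition smooth_torus {R : realType} (f : R * R -> R[i]) : Prop :=
  [/\ forall x, f (x.1 + 1, x.2) = f x,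
      forall x, f (x.1, x.2 + 1) = f x,
      smooth (fun x => complex.Re (f x)) &
      smooth (fun x => complex.Im (f x))].

Definition leb2 {R : realType} := (@lebesgue_measure R \x @lebesgue_measure R)%E.

Definition torus_int {R : realType} (f : R * R -> R[i]) : R[i] :=
  (\int[leb2]_(x in `[0, 1] `*` `[0, 1]) complex.Re (f x)) +i*
  (\int[leb2]_(x in `[0, 1] `*` `[0, 1]) complex.Im (f x)).

Definition fourier {R : realType} (f : R * R -> R[i]) (n : int * int) : R[i] :=
  torus_int (fun x => f x * e1 (- (n.1%:~R * x.1 + n.2%:~R * x.2))).

(* (f o B)(x) = f(Bx), x a column vector *)
Definition comp_mx {R : realType} (f : R * R -> R[i]) (B : 'M[int]_2)
    : R * R -> R[i] :=
  fun x => f ((B 0 0)%:~R * x.1 + (B 0 1)%:~R * x.2,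
              (B 1 0)%:~R * x.1 + (B 1 1)%:~R * x.2).

(* The state space H_N = L^2(Z/NZ); 'Z_N is Z/NZ for N > 1. *)

Definition state (R : realType) (N : nat) := {ffun 'Z_N -> R[i]^o}.

Definition inner {R : realType} {N : nat} (phi psi : state R N) : R[i] :=
  (N%:R)^-1 * \sum_(x : 'Z_N) (phi x : R[i]) * ((psi x : R[i])^*)%R.

Definition T_op {R : realType} {N : nat} (n : int * int) (psi : state R N)
    : state R N :=
  [ffun x : 'Z_N => expi (pi * (n.1 * n.2)%:~R / N%:R)
     * e1 (n.2%:~R * (x : nat)%:R / N%:R) * (psi (x + n.1%:~R) : R[i])].

Definition Op {R : realType} {N : nat} (f : R * R -> R[i]) (psi : state R N)
    : state R N :=
  [ffun x : 'Z_N =>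
     csum [set: int * int] (fun n => fourier f n * (T_op n psi x : R[i]))].

Definition redmx (M : nat) (B : 'M[int]_2) : 'M['Z_M]_2 :=
  map_mx (fun z : int => z%:~R) B.

(* {B in SL_2(Z/2NZ) : B = I mod 2}; parity is well defined on Z/2NZ. *)
Definition SL2_2N (N : nat) (B : 'M['Z_(2 * N)%N]_2) : Prop :=
  \det B = 1 /\ forall i j, odd (B i j) = (i == j).

Definition unitary_op {R : realType} {N : nat} (V : state R N -> state R N)
    : Prop :=
  [/\ linear V, bijective V &
      forall phi psi, inner (V phi) (V psi) = inner phi psi].

(* For B in SL_2(Z/2NZ), f o B is computed with an integer lift B' of B;
   Op_N(f o B') does not depend on the lift.  The intertwining relation
   U(B)^-1 Op(f) U(B) = Op(f o B) is written without the inverse. *)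
Definition quantization {R : realType} {N : nat}
    (U : 'M['Z_(2 * N)%N]_2 -> state R N -> state R N) : Prop :=
  [/\ forall B, SL2_2N B -> unitary_op (U B),
      forall (B : 'M['Z_(2 * N)%N]_2) (B' : 'M[int]_2) (f : R * R -> R[i]) psi,
        SL2_2N B -> redmx (2 * N) B' = B -> smooth_torus f ->
        Op f (U B psi) = U B (Op (comp_mx f B') psi) &
      forall B1 B2 psi, SL2_2N B1 -> SL2_2N B2 ->
        U (B1 *m B2) psi = U B1 (U B2 psi)].

(* Elements x + y alpha of O/MO, O = Z[alpha] = Z + Z alpha, are pairs (x, y).
   As alpha and its conjugate have sum tr A and product det A = 1,
   N(x + y alpha) = x^2 + (tr A) x y + y^2. *)

Definition normO (M : nat) (A : 'M[int]_2) (beta : 'Z_M * 'Z_M) : 'Z_M :=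
  beta.1 ^+ 2 + (\tr A)%:~R * beta.1 * beta.2 + beta.2 ^+ 2.

(* The matrix of multiplication by x + y alpha on the ideal Zc + Z(alpha - a), in
   coordinates n = (n_1, n_2) <-> n_1 c + n_2 (alpha - a) taken as row vectors
   acted on from the right.  Since
     alpha c = a c + c (alpha - a)  and  alpha (alpha - a) = b c + d (alpha - a),
   the rows of the matrix of alpha are (a, c) and (b, d): it is A transposed (A
   itself is the matrix of alpha on column vectors).  This is the convention for
   which Q(n iota(beta)) = N(beta) Q(n), i.e. iota(C(2N)) lies in SO(Q, Z/2NZ)
   for the action n |-> n B. *)
Definition iota_mx (M : nat) (A : 'M[int]_2) (beta : 'Z_M * 'Z_M) : 'M['Z_M]_2 :=
  (beta.1)%:M + beta.2 *: (redmx M A)^T.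

(* C(2N): norm 1 mod 2N and congruent to 1 modulo 2O *)
Definition C2N (N : nat) (A : 'M[int]_2) : set ('Z_(2 * N)%N * 'Z_(2 * N)%N) :=
  [set beta | [/\ normO A beta = 1, odd beta.1 & ~~ odd beta.2]].

Definition hecke_eigenfunction {R : realType} {N : nat} (A : 'M[int]_2)
    (U : 'M['Z_(2 * N)%N]_2 -> state R N -> state R N) (psi : state R N) : Prop :=
  psi <> 0 /\
  forall beta, C2N A beta ->
    exists lambda : R[i], U (iota_mx A beta) psi = lambda *: psi.

Definition hecke_basis {R : realType} {N : nat} (A : 'M[int]_2)
    (U : 'M['Z_(2 * N)%N]_2 -> state R N -> state R N)
    (psi : 'I_N -> state R N) : Prop :=
  [/\ forall j k, inner (psi j) (psi k) = (j == k)%:R,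
      basis_of fullv (mktuple psi) &
      forall j, hecke_eigenfunction A U (psi j)].

Definition Fcoef {R : realType} {N : nat} (f : R * R -> R[i]) (psi : state R N)
    : R[i] :=
  (Num.sqrt N%:R)%:C * (inner (Op f psi) psi - torus_int f).

Definition Qform (A : 'M[int]_2) (n : int * int) : int :=
  A 1 0 * n.1 ^+ 2 + (A 1 1 - A 0 0) * n.1 * n.2 - A 0 1 * n.2 ^+ 2.

Definition fsharp {R : realType} (A : 'M[int]_2) (f : R * R -> R[i]) (nu : int)
    : R[i] :=
  csum [set n | Qform A n = nu] (fun n => (-1) ^ (n.1 * n.2) * fourier f n).

Definition sqmod {R : realType} (z : R[i]) : R := Normc.normc z ^+ 2.

(* Haar-random matrices in SU(2) *)

Definition SU2 {R : realType} : set 'M[R[i]]_2 :=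
  [set M | M \is spectral.unitarymx /\ \det M = 1].

Definition borel_mx {R : realType} : set (set 'M[R[i]]_2) :=
  <<s (@open 'M[R[i]^o]_2) >>.

Definition random_SU2 {R : realType} {d : measure_display}
    {Omega : measurableType d} (V : Omega -> 'M[R[i]]_2) : Prop :=
  (forall w, SU2 (V w)) /\ forall S, borel_mx S -> measurable (V @^-1` S).

(* The law of V is the Haar probability measure of SU(2): it is invariant under
   left translations. *)
Definition haar_SU2 {R : realType} {d : measure_display}
    {Omega : measurableType d} (P : probability Omega R)
    (V : Omega -> 'M[R[i]]_2) : Prop :=
  random_SU2 V /\
  forall g S, SU2 g -> borel_mx S ->
    P ((fun w => g *m V w) @^-1` S) = P (V @^-1` S).

Definition mutually_independent {R : realType} {d : measure_display}
    {Omega : measurableType d} (P : probability Omega R) (D : set int)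
    (V : int -> Omega -> 'M[R[i]]_2) : Prop :=
  forall (s : seq int) (S : int -> set 'M[R[i]]_2),
    uniq s -> (forall nu, nu \in s -> D nu) ->
    (forall nu, nu \in s -> borel_mx (S nu)) ->
    P (\bigcap_(nu in [set` s]) (V nu @^-1` S nu)) =
    (\prod_(nu <- s) P (V nu @^-1` S nu))%E.

(* Main.v *)
Require Import Defs.
From HB Require Import structures.
From mathcomp Require Import all_boot all_order all_algebra.
From mathcomp Require Import complex.
From mathcomp Require Import all_classical all_reals all_analysis.
From mathcomp Require Import measurable_realfun ring lra zify.

Import Order.TTheory GRing.Theory Num.Theory.
Import numFieldNormedType.Exports.

(* Up to the sign (-1)^(n1 n2), T_N(n) depends on n mod N only, and for a Hecke
   eigenbasis psi_j the matrix M(n) = (<T_N(n) psi_k, psi_j>)_(j,k) is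
   multiplied entrywise by a character when n moves under the norm one group G
   of O/NO.  As G acts freely off 0, transitively on each level set Q = nu <> 0
   and has order N - 1 or N + 1, averaging over G gives
   sum_j M(m)_jj conj(M(n)_jj) = N / |G| [Q(m) = Q(n)] minus off-diagonal terms.
   Orthogonality of the M(n) shows that at most two off-diagonal positions
   carry equal characters, and the fourth moment bound
   #{x1 + x3 = x2 + x4} <= 3 |G|^2 in G makes these entries small.  So the
   correlations converge to the indicator of Q(m) = Q(n); since smooth f has
   rapidly decreasing Fourier coefficients, the variance can be truncated to
   finitely many frequencies.  On the random side, tr U has mean 0 and second
   moment 1 by invariance of Haar measure under -1, diag(i, -i) and the
   rotation exchanging the rows, and independence kills the cross terms. *)

Local Open Scope ring_scope.

(** * The norm one group of a quadratic algebra *)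

(** The second moment bounds the off-diagonal entries at equal characters only by N / |G|, the size
    of the main term; the fourth moment improves this to 3 N / |G|^2 = O(1/N), and the theorem rests
    on that gain. The algebra O/NO may be split, with zero divisors, or inert; the two cases are
    never separated, since only N - 1 <= |G| <= N + 1 is used. The lower bound comes from
    parametrizing the conic of norm one elements, the upper one from counting equal characters in
    the representation. ['Z_N] enters as a commutative ring whose nonzero elements are units. The
    correlation estimate is available only at frequencies with Q(n) <> 0 mod N. As tr(A)^2 - 4 is
    not a square, Q(n) <> 0 for n <> 0, so a finite set of nonzero frequencies satisfies this once N
    is large; the other frequencies obey a bound uniform in N, so the truncation can be fixed before
    N. The relation defining U is assumed for smooth observables, and exponentials turn it into a
    relation between translations. *)

Lemma lincomb1 (F : pzRingType) (x y k a b : F) :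
  a = b -> x - y = k * (a - b) -> x = y.
Proof. by move=> -> e; apply/eqP; rewrite -subr_eq0 e subrr mulr0. Qed.

(** Certificate for an identity modulo two known equations: the cofactors [k] and [l] are found by
    hand and [ring] checks the last premise. *)
Lemma lincomb2 (F : pzRingType) (x y k l a b c d : F) :
  a = b -> c = d -> x - y = k * (a - b) + l * (c - d) -> x = y.
Proof.
by move=> -> -> e; apply/eqP; rewrite -subr_eq0 e !subrr !mulr0 addr0.
Qed.

Section NormOneGroup.
Variable F : finComUnitRingType.
Hypothesis F_unit : forall x : F, x != 0 -> x \is a GRing.unit.

Lemma unit_mulf_eq0 (x y : F) : x * y = 0 -> x = 0 \/ y = 0.
Proof.
move=> xy; case: (eqVneq x 0) => [->|x0]; [by left|right].
by rewrite -(mulKr (F_unit x x0) y) xy mulr0.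
Qed.

Lemma unit_mulfI (x y z : F) : x != 0 -> x * y = x * z -> y = z.
Proof. by move=> x0; apply: mulrI; exact: F_unit. Qed.

Variable t : F.
Hypothesis two_neq0 : (2 : F) != 0.
Hypothesis disc_neq0 : t ^+ 2 - 4 != 0.

(* A pair [(x, y)] stands for the element [x + y alpha] of the quadratic
   algebra where [alpha ^ 2 = t alpha - 1]. *)
Definition nrm (g : F * F) : F := g.1 ^+ 2 + t * g.1 * g.2 + g.2 ^+ 2.
Definition mulO (g h : F * F) : F * F :=
  (g.1 * h.1 - g.2 * h.2, g.1 * h.2 + g.2 * h.1 + t * g.2 * h.2).
Definition conjO (g : F * F) : F * F := (g.1 + t * g.2, - g.2).
Definition normG : {set F * F} := [set g | nrm g == 1].

Lemma in_normG g : (g \in normG) = (nrm g == 1).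
Proof. by rewrite inE. Qed.

Lemma nrm_mulO g h : nrm (mulO g h) = nrm g * nrm h.
Proof. by rewrite /nrm /mulO /=; ring. Qed.

Lemma nrm_conjO g : nrm (conjO g) = nrm g.
Proof. by rewrite /nrm /conjO /=; ring. Qed.

Lemma nrm_oppO g : nrm (- g) = nrm g.
Proof. by rewrite /nrm /=; ring. Qed.

Lemma mulO_conj g : mulO g (conjO g) = (nrm g, 0).
Proof. by rewrite /mulO /conjO /nrm /=; congr pair; ring. Qed.

Lemma mulOA g h k : mulO g (mulO h k) = mulO (mulO g h) k.
Proof. by rewrite /mulO /=; congr pair; ring. Qed.

Lemma mulOC g h : mulO g h = mulO h g.
Proof. by rewrite /mulO /=; congr pair; ring. Qed.

Lemma mulO1 g : mulO g (1, 0) = g.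
Proof. by case: g => x y; rewrite /mulO /=; congr pair; ring. Qed.

Lemma mulO_scalar (z : F) g : mulO (z, 0) g = (z * g.1, z * g.2).
Proof. by rewrite /mulO /=; congr pair; ring. Qed.

Lemma scale_pair_eq0 (z : F) g : z != 0 -> (z * g.1, z * g.2) = 0 -> g = 0.
Proof.
move=> z0 e; have := congr1 fst e; have := congr1 snd e => /= h2 h1.
case: (unit_mulf_eq0 _ _ h1) => [e'|e1]; first by rewrite e' eqxx in z0.
case: (unit_mulf_eq0 _ _ h2) => [e'|e2]; first by rewrite e' eqxx in z0.
by case: g e1 e2 {e h1 h2} => ? ? /= -> ->.
Qed.

(** Multiplication by the conjugate turns [g] into the scalar [nrm g]. In the split case this
    confines zero divisors to norm 0. *)
Lemma mulO_eq0 g h : mulO g h = 0 -> nrm g != 0 -> h = 0.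
Proof.
move=> gh0 ng; have : mulO (conjO g) (mulO g h) = 0.
  by rewrite gh0 /mulO /= !mulr0 !addr0 subr0.
rewrite mulOA (mulOC (conjO g)) mulO_conj mulO_scalar.
exact: scale_pair_eq0.
Qed.

(* [nrm (g - 1) = 2 - tr g] for [g] of norm 1, and
   [4 nrm g = (tr g)^2 - disc * g.2^2]. *)
Lemma nrm_sub1_eq0 g : nrm g = 1 -> nrm (g - (1, 0)) = 0 -> g = (1, 0).
Proof.
case: g => x y; rewrite /nrm /= => n1 n0.
have e1 : 2 * x = 2 - t * y by apply: (lincomb2 _ _ _ 1 (-1) _ _ _ _ n1 n0); ring.
have e2 : (t ^+ 2 - 4) * (y * y) = 0.
  by apply: (lincomb2 _ _ _ (-4) (2 * x + 2 + t * y) _ _ _ _ n1 e1); ring.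
have y0 : y = 0.
  case: (unit_mulf_eq0 _ _ e2) => [e|]; first by move: disc_neq0; rewrite e eqxx.
  by move=> /unit_mulf_eq0[].
rewrite y0; congr pair; apply: (unit_mulfI 2) => //.
by rewrite e1 y0; ring.
Qed.

(** Norm 0 does not force an element to vanish in the split case. For a difference of norm one
    elements it does: multiplying by [conjO h], the inverse of [h], reduces to the case
    [h = (1, 0)]. *)
Lemma nrm_sub_eq0 g h : nrm g = 1 -> nrm h = 1 -> nrm (g - h) = 0 -> g = h.
Proof.
move=> ng nh ngh.
have : mulO g (conjO h) = (1, 0).
  apply: nrm_sub1_eq0; first by rewrite nrm_mulO nrm_conjO ng nh mulr1.
  have -> : mulO g (conjO h) - (1, 0) = mulO (g - h) (conjO h).
    have : (1, 0) = mulO h (conjO h) by rewrite mulO_conj nh.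
    by move=> ->; rewrite /mulO /conjO /=; congr pair; rewrite /=; ring.
  by rewrite nrm_mulO ngh mul0r.
move=> e; have : mulO (mulO g (conjO h)) h = mulO (1, 0) h by rewrite e.
by rewrite -mulOA (mulOC _ h) mulO_conj nh mulO1 mulOC mulO1.
Qed.

(* Conjugation is inversion on norm one elements, so the sum of two of them
   determines their product as well, unless that sum is zero. *)
Lemma normG_sum_eq g1 g2 g3 g4 :
  g1 \in normG -> g2 \in normG -> g3 \in normG -> g4 \in normG ->
  g1 + g3 = g2 + g4 ->
  [\/ g3 = - g1 /\ g4 = - g2, g1 = g2 /\ g3 = g4 | g1 = g4 /\ g3 = g2].
Proof.
rewrite !in_normG => /eqP n1 /eqP n2 /eqP n3 /eqP n4 e.
have opp g h : nrm g = 1 -> nrm h = 1 -> nrm (g + h) = 0 -> h = - g.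
  move=> ng nh n0; apply/esym/nrm_sub_eq0; rewrite ?nrm_oppO//.
  by rewrite -opprD nrm_oppO.
have [s0|s0] := eqVneq (nrm (g1 + g3)) 0.
  by constructor 1; split; apply: opp => //; rewrite -e.
(* This is g h (1/g + 1/h) = g + h, conjugates being inverses here. *)
have inv g h : nrm g = 1 -> nrm h = 1 -> mulO (mulO g h) (conjO (g + h)) = g + h.
  move=> ng nh.
  transitivity (nrm g * h.1 + nrm h * g.1, nrm g * h.2 + nrm h * g.2).
    by rewrite /mulO /conjO /nrm /=; congr pair; ring.
  by rewrite ng nh; case: g h {ng nh} => ? ? [? ?] /=; congr pair; rewrite /=; ring.
have prod_eq : mulO g1 g3 = mulO g2 g4.
  apply/eqP; rewrite -subr_eq0; apply/eqP.
  apply: (mulO_eq0 (conjO (g1 + g3))); last by rewrite nrm_conjO.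
  have := inv _ _ n1 n3; have := inv _ _ n2 n4; rewrite -e => h1 h2.
  transitivity (mulO (mulO g1 g3) (conjO (g1 + g3))
    - mulO (mulO g2 g4) (conjO (g1 + g3))); last by rewrite h1 h2 subrr.
  by rewrite /mulO /=; congr pair; rewrite /=; ring.
(* With equal sums and equal products, [g2] is a root of the quadratic with roots [g1] and [g3]. *)
have prod0 : mulO (g2 - g1) (g2 - g3) = 0.
  have -> : mulO (g2 - g1) (g2 - g3) =
     mulO g2 g2 - mulO g2 (g1 + g3) + mulO g1 g3.
    by rewrite /mulO /=; congr pair; rewrite /=; ring.
  rewrite e prod_eq.
  by rewrite /mulO /=; congr pair; rewrite /=; ring.
(* A vanishing product may have two nonzero factors in the split case; then [g2 - g1] has norm 0 and
   [nrm_sub_eq0] still gives equality. *)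
have [s1|s1] := eqVneq (nrm (g2 - g1)) 0.
  have e2 := nrm_sub_eq0 _ _ n2 n1 s1.
  by constructor 2; split => //; move: e; rewrite e2 => /addrI.
have := mulO_eq0 _ _ prod0 s1 => /eqP; rewrite subr_eq0 => /eqP e23.
by constructor 3; split => //; move: e; rewrite e23 addrC => /addrI.
Qed.

(* Second intersection with the conic of the line through (1, 0) of
   direction (u, 1). *)
Definition conic_pt (u : F) : F * F :=
  let s := - (2 * u + t) / (u ^+ 2 + t * u + 1) in (1 + s * u, s).

Lemma conic_pt_norm u : u ^+ 2 + t * u + 1 != 0 -> nrm (conic_pt u) = 1.
Proof.
move=> q0; rewrite /conic_pt; set q := u ^+ 2 + t * u + 1; set s := _ / q.
have sq : s * q = - (2 * u + t) by rewrite divrK // F_unit.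
transitivity (1 + s * (2 * u + t) + s * (s * q)).
  by rewrite /nrm /= /q; ring.
by rewrite sq; ring.
Qed.

Lemma conic_pt_inj u v : u ^+ 2 + t * u + 1 != 0 -> v ^+ 2 + t * v + 1 != 0 ->
  conic_pt u = conic_pt v -> u = v.
Proof.
move=> qu qv; rewrite /conic_pt => -[+ es]; rewrite es => /addrI.
set s := _ / _ => e.
(* [s = 0] means that the line is tangent at (1, 0), which happens only for [2 * u = - t]. *)
have [s0|s0] := eqVneq s 0; last by apply: (unit_mulfI s).
have lin w : w ^+ 2 + t * w + 1 != 0 ->
    - (2 * w + t) / (w ^+ 2 + t * w + 1) = 0 -> 2 * w = - t.
  move=> qw /(congr1 ( *%R^~ (w ^+ 2 + t * w + 1))).
  rewrite mul0r divrK ?F_unit// => /eqP.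
  by rewrite oppr_eq0 addr_eq0 => /eqP.
apply: (unit_mulfI 2) => //; rewrite (lin u qu); last by rewrite es.
by rewrite (lin v qv).
Qed.

(** At most two slopes, the roots of u^2 + t u + 1, give no second point on the conic, and the point
    (-1, 0) is gained besides: |G| >= |F| - 2 + 1. *)
Lemma card_normG_ge : (#|F| <= #|normG|.+1)%N.
Proof.
pose q (u : F) := u ^+ 2 + t * u + 1.
pose D := [set u : F | q u != 0].
have cD : (#|F| <= #|D|.+2)%N.
  suff cC : (#|~: D| <= 2)%N.
    by rewrite -(cardsC D) -[X in (_ <= X)%N]addn2 leq_add2l.
  case: (set_0Vmem (~: D)) => [->|[u0]]; first by rewrite cards0.
  rewrite !inE negbK => /eqP u0q.
  apply: (@leq_trans #|[set u0; - t - u0]|); last first.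
    by rewrite cards2; case: (_ != _).
  apply: subset_leq_card; apply/fintype.subsetP => u.
  rewrite !inE negbK => /eqP uq.
  have : (u - u0) * (u - (- t - u0)) = 0.
    have -> : 0 = q u - q u0 by rewrite uq u0q subr0.
    by rewrite /q; ring.
  case/unit_mulf_eq0 => /eqP; rewrite subr_eq0 => /eqP ->; rewrite eqxx //.
  by rewrite orbT.
(* (-1, 0) lies on the line of direction (1, 0), the only direction not of the form (u, 1). *)
have m1 : (-1, 0) \notin conic_pt @: D.
  apply/imsetP => -[u]; rewrite inE => qu; rewrite /conic_pt => -[+ es].
  rewrite -es mul0r addr0 => e; move: two_neq0.
  by rewrite -[2]/(1 + 1 : F) -{1}e addNr eqxx.
apply: (leq_trans cD); rewrite ltnS.
have <- : #|(-1, 0) |: conic_pt @: D| = #|D|.+1.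
  rewrite cardsU1 m1 add1n card_in_imset // => u v; rewrite !inE.
  exact: conic_pt_inj.
apply: subset_leq_card; apply/fintype.subsetP => g; rewrite in_setU1.
move=> /orP[/eqP ->|/imsetP[u]].
  by rewrite in_normG /nrm /=; apply/eqP; ring.
by rewrite inE => qu ->; rewrite in_normG conic_pt_norm.
Qed.

Lemma one_in_normG : (1, 0) \in normG.
Proof. by rewrite in_normG /nrm /=; apply/eqP; ring. Qed.

Lemma normG_gt0 : (0 < #|normG|)%N.
Proof. by apply/card_gt0P; exists (1, 0); exact: one_in_normG. Qed.

Lemma mulO_normG g h : g \in normG -> (mulO g h \in normG) = (h \in normG).
Proof. by rewrite !in_normG nrm_mulO => /eqP ->; rewrite mul1r. Qed.

Lemma conjO_normG g : (conjO g \in normG) = (g \in normG).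
Proof. by rewrite !in_normG nrm_conjO. Qed.

Lemma mulKO g : g \in normG -> cancel (mulO g) (mulO (conjO g)).
Proof.
rewrite in_normG => /eqP n1 h.
by rewrite mulOA (mulOC (conjO g)) mulO_conj n1 mulOC mulO1.
Qed.

Variables a b c d : F.
Hypothesis tE : t = a + d.
Hypothesis detE : b * c = a * d - 1.

(** The action of [x + y alpha] on row vectors through [iota_mx]. As alpha has the matrix A
    transposed, it is [x v + y A v] with [v] read as a column. *)
Definition actO (g v : F * F) : F * F :=
  (g.1 * v.1 + g.2 * (a * v.1 + b * v.2), g.1 * v.2 + g.2 * (c * v.1 + d * v.2)).
(** This is the determinant of the pair [v], [A v]; so [Qz v != 0] says that the two vectors form a
    basis. *)
Definition Qz (v : F * F) : F := c * v.1 ^+ 2 + (d - a) * v.1 * v.2 - b * v.2 ^+ 2.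

Lemma actOM g h v : actO (mulO g h) v = actO g (actO h v).
Proof. by rewrite /actO /mulO /= tE; congr pair; ring: detE. Qed.

Lemma actOB g h v : actO (g - h) v = actO g v - actO h v.
Proof. by rewrite /actO /=; congr pair; rewrite /=; ring. Qed.

Lemma actOD g h v : actO (g + h) v = actO g v + actO h v.
Proof. by rewrite /actO /=; congr pair; rewrite /=; ring. Qed.

Lemma actO1 v : actO (1, 0) v = v.
Proof. by case: v => x y; rewrite /actO /=; congr pair; ring. Qed.

Lemma actO0 g : actO g 0 = 0.
Proof. by rewrite /actO /=; congr pair; ring. Qed.

Lemma actO_conj g v : actO (conjO g) (actO g v) = (nrm g * v.1, nrm g * v.2).
Proof. by rewrite -actOM mulOC mulO_conj /actO /=; congr pair; ring. Qed.

(** Applying the conjugate of [g - h] gives [nrm (g - h) * v = 0]; so the action is free at every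
    [v != 0], isotropic vectors included. *)
Lemma actO_inj g h v : g \in normG -> h \in normG -> v != 0 ->
  actO g v = actO h v -> g = h.
Proof.
rewrite !in_normG => /eqP ng /eqP nh v0 e; apply: nrm_sub_eq0 => //.
apply: contraNeq v0 => n0; apply/eqP/(scale_pair_eq0 _ _ n0).
by rewrite -actO_conj actOB e subrr actO0.
Qed.

Lemma Qz_act g m : Qz (actO g m) = nrm g * Qz m.
Proof. by rewrite /Qz /nrm /actO /=; rewrite tE; ring: detE. Qed.

(** Cramer's rule in the basis [m], [A m], of determinant [Qz m], solves [actO g m = n]; equality of
    the two values of [Qz] then forces norm 1. *)
Lemma actO_orbit m n : Qz m = Qz n -> Qz m != 0 ->
  exists2 g, g \in normG & actO g m = n.
Proof.
move=> Qmn Q0; pose q := (Qz m)^-1.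
have qi : q * Qz m = 1 by rewrite mulVr // F_unit.
pose g := (q * (n.1 * (c * m.1 + d * m.2) - n.2 * (a * m.1 + b * m.2)),
           q * (m.1 * n.2 - m.2 * n.1)).
have e : actO g m = n.
  rewrite /actO [RHS]surjective_pairing /=; congr pair.
    by apply: (lincomb1 _ _ _ n.1 _ _ qi); rewrite /Qz; ring.
  by apply: (lincomb1 _ _ _ n.2 _ _ qi); rewrite /Qz; ring.
exists g => //; rewrite in_normG; apply/eqP/(unit_mulfI (Qz m)) => //.
by rewrite mulr1 mulrC -Qz_act e.
Qed.

(** Independence of [m] and [A m] gives this for every [g]. It is applied to a difference of sums of
    group elements, whose norm is not controlled. *)
Lemma actO_free g m : Qz m != 0 -> actO g m = 0 -> g = 0.
Proof.
move=> Q0 e; have := congr1 fst e; have := congr1 snd e => /= e2 e1.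
apply: (scale_pair_eq0 _ _ Q0); case: g e1 e2 {e} => x y /= e1 e2.
congr pair.
  apply: (lincomb2 _ _ _ (c * m.1 + d * m.2) (- (a * m.1 + b * m.2)) _ _ _ _ e1 e2).
  by rewrite /Qz; ring.
apply: (lincomb2 _ _ _ (- m.2) m.1 _ _ _ _ e1 e2).
by rewrite /Qz; ring.
Qed.

Lemma normG_fourth_moment v : Qz v != 0 ->
  (\sum_(g1 in normG) \sum_(g2 in normG) \sum_(g3 in normG) \sum_(g4 in normG)
     (actO g1 v + actO g3 v == actO g2 v + actO g4 v)%R
   <= 3 * #|normG| ^ 2)%N.
Proof.
move=> Qv.
(* One term for each case of [normG_sum_eq]; in each, two of the elements determine the other two,
   which leaves at most |G|^2 quadruples. *)
pose E (g1 g2 g3 g4 : F * F) : nat :=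
  ((g3 == - g1)%R * (g4 == - g2)%R + (g2 == g1) * (g4 == g3)
   + (g4 == g1) * (g3 == g2))%N.
apply: (@leq_trans (\sum_(g1 in normG) \sum_(g2 in normG) \sum_(g3 in normG)
   \sum_(g4 in normG) E g1 g2 g3 g4)).
  apply: leq_sum => g1 G1; apply: leq_sum => g2 G2; apply: leq_sum => g3 G3.
  apply: leq_sum => g4 G4; case: eqP => // e; rewrite /E.
  have : g1 + g3 = g2 + g4.
    apply/eqP; rewrite -subr_eq0; apply/eqP/(actO_free _ v) => //.
    by rewrite actOB !actOD e subrr.
  by case/normG_sum_eq => // -[-> ->]; rewrite !eqxx //= ?muln1 ?addnS.
have s1 (k : F * F) : (\sum_(g in normG) (g == k) <= 1)%N.
  rewrite (eq_bigr (fun g => if g == k then 1 else 0)%N); last by move=> g _; case: eqP.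
  rewrite -big_mkcondr /= sum1_card.
  apply: (@leq_trans #|[set k]|); last by rewrite cards1.
  by apply: subset_leq_card; apply/fintype.subsetP => g; rewrite !inE => /andP[].
have cst (x : nat) : (\sum_(g in normG) x = #|normG| * x)%N by rewrite sum_nat_const.
rewrite /E.
under eq_bigr do under eq_bigr do under eq_bigr do rewrite !big_split /=.
under eq_bigr do under eq_bigr do rewrite !big_split /=.
under eq_bigr do rewrite !big_split /=.
rewrite !big_split /= !mulSn mul0n addn0 addnA.
apply: leq_add; first apply: leq_add.
- rewrite expnS expn1 -[X in (_ <= X)%N]cst; apply: leq_sum => g1 _.
  rewrite -[X in (_ <= X)%N]muln1 -cst; apply: leq_sum => g2 _.
  under eq_bigr do rewrite -big_distrr /=.
  rewrite -big_distrl /=; apply: (@leq_mul _ _ 1 1); exact: s1.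
- rewrite expnS expn1 -[X in (_ <= X)%N]cst; apply: leq_sum => g1 _.
  under eq_bigr do under eq_bigr do rewrite -big_distrr /=.
  under eq_bigr do rewrite -big_distrr /=.
  rewrite -big_distrl /= -[X in (_ <= X)%N]mul1n; apply: leq_mul; first exact: s1.
  rewrite -[X in (_ <= X)%N]muln1 -cst; apply: leq_sum => g3 _; exact: s1.
- rewrite expnS expn1 -[X in (_ <= X)%N]cst; apply: leq_sum => g1 _.
  rewrite -[X in (_ <= X)%N]muln1 -cst; apply: leq_sum => g2 _.
  under eq_bigr do rewrite -big_distrl /=.
  rewrite -big_distrr /=; apply: (@leq_mul _ _ 1 1); exact: s1.
Qed.

End NormOneGroup.

(** * Diagonal correlations of a projective representation *)

(** A right inverse of a square matrix is a left inverse. It serves twice: for Parseval over all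
    frequencies ([M_parseval]) and for completeness of the Hecke basis ([psi_complete]). *)
Lemma orthogonal_rows_cols (C : numClosedFieldType) (I J : finType)
    (f : I -> J -> C) (c : C) : #|I| = #|J| -> c != 0 ->
    (forall i i', \sum_j f i j * (f i' j)^* = c * (i == i')%:R) ->
  forall j j', \sum_i f i j * (f i j')^* = c * (j == j')%:R.
Proof.
move=> eIJ c0 orth.
pose h (k : 'I_#|I|) : J := enum_val (cast_ord eIJ k).
have h_bij : bijective h.
  apply: bij_comp; first exact: enum_val_bij.
  exists (cast_ord (esym eIJ)) => k; [exact: cast_ordK|exact: cast_ordKV].
pose X := \matrix_(i < #|I|, j < #|I|) f (enum_val i) (h j).
pose Y := \matrix_(j < #|I|, i < #|I|) (c^-1 * (f (enum_val i) (h j))^*).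
have XY : X *m Y = 1%:M.
  apply/matrixP => i i'; rewrite !mxE.
  under eq_bigr do rewrite !mxE mulrCA.
  rewrite -mulr_sumr.
  have -> : \sum_(k < #|I|) f (enum_val i) (h k) * (f (enum_val i') (h k))^*
     = c * (i == i')%:R.
    rewrite -(inj_eq enum_val_inj) -orth [RHS](reindex h) //.
    exact: onW_bij.
  by rewrite mulrA mulVf // mul1r.
have := mulmx1C XY => YX j j'.
case: h_bij => h' hK h'K.
have /matrixP /(_ (h' j') (h' j)) := YX; rewrite !mxE.
under eq_bigr do rewrite !mxE !h'K -mulrA [_^* * _]mulrC.
rewrite -mulr_sumr => /(congr1 ( *%R c)); rewrite mulrA mulfV // mul1r.
rewrite (inj_eq (can_inj h'K)) [j' == j]eq_sym => <-.
rewrite [LHS](reindex (@enum_val I I)) //.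
apply: onW_bij; exact: enum_val_bij.
Qed.

Section DiagonalCorrelations.
Variable C : numClosedFieldType.
Variable F : finComUnitRingType.
Hypothesis F_unit : forall x : F, x != 0 -> x \is a GRing.unit.
Variables a b c d t : F.
Hypothesis two_neq0 : (2 : F) != 0.
Hypothesis disc_neq0 : t ^+ 2 - 4 != 0.
Hypothesis tE : t = a + d.
Hypothesis detE : b * c = a * d - 1.
Variable N : nat.
Hypothesis cardF : #|F| = N.

Local Notation G := (normG F t).
Local Notation act := (actO F a b c d).
Local Notation Q := (Qz F a b c d).

Variable M : F * F -> 'M[C]_N.
Variable cc : F * F -> F * F -> C.
Variable chi : F * F -> 'I_N -> 'I_N -> C.
Hypothesis cc_norm : forall v w, `|cc v w| = 1.
Hypothesis ccN : forall v, cc v (- v) = 1.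
Hypothesis M_mul : forall v w, M v *m M w = cc v w *: M (v + w).
Hypothesis M_adj : forall v j k, (M v j k)^* = M (- v) k j.
Hypothesis M_tr : forall v, \tr (M v) = N%:R * (v == 0)%:R.
Hypothesis M_act : forall g v j k, g \in G -> M (act g v) j k = chi g j k * M v j k.
Hypothesis chi_diag : forall g j, g \in G -> chi g j j = 1.

Let N_gt1 : (1 < N)%N.
Proof.
rewrite -cardF (cardD1 (0 : F)) (cardD1 (1 : F)) !inE oner_neq0 /=.
by rewrite addnA leq_addr.
Qed.

Let N_neq0 : N%:R != 0 :> C.
Proof. by rewrite pnatr_eq0 -lt0n ltnW. Qed.

Let G_neq0 : #|G|%:R != 0 :> C.
Proof. by rewrite pnatr_eq0 -lt0n normG_gt0. Qed.

Let G_gt0 : 0 < #|G|%:R :> C.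
Proof. by rewrite ltr0n normG_gt0. Qed.

(** [M (- w)] is the adjoint of [M w], so the left side is the trace of [M v *m M (- w)]. *)
Lemma M_orth v w :
  \sum_j \sum_k M v j k * (M w j k)^* = N%:R * (v == w)%:R.
Proof.
have -> : \sum_j \sum_k M v j k * (M w j k)^* = \tr (M v *m M (- w)).
  rewrite /mxtrace; apply: eq_bigr => j _; rewrite mxE.
  by apply: eq_bigr => k _; rewrite M_adj.
rewrite M_mul mxtraceZ M_tr subr_eq0; case: eqP => [->|_]; last by rewrite !mulr0.
by rewrite ccN mul1r.
Qed.

(** There are N^2 matrices [M v] and N^2 positions, so the orthogonality in [M_orth] passes from
    rows to columns. *)
Lemma M_parseval j k : \sum_v `|M v j k| ^+ 2 = N%:R.
Proof.
have := @orthogonal_rows_cols C (F * F)%type ('I_N * 'I_N)%type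
  (fun v jk => M v jk.1 jk.2) N%:R.
rewrite !card_prod cardF card_ord => /(_ erefl N_neq0) h.
have -> : \sum_v `|M v j k| ^+ 2 = \sum_v M v j k * (M v j k)^*.
  by apply: eq_bigr => v _; rewrite normCK.
have -> := h _ (j, k) (j, k); first by rewrite eqxx mulr1.
by move=> v w; rewrite -M_orth [RHS]pair_bigA.
Qed.

Lemma M_neq0 j k : exists v, M v j k != 0.
Proof.
apply/existsP; apply: contraT; rewrite negb_exists => /forallP h.
have := M_parseval j k; rewrite big1 ?[_ = N%:R]/esym; last first.
  by move=> v _; have /negPn/eqP -> := h v; rewrite normr0 expr0n.
by move=> /esym/eqP; rewrite (negPf N_neq0).
Qed.

(* By Parseval some entry [M v j k] is nonzero, so that [chi] is determined by
   the action of [G]. *)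
Lemma chiM g h j k : g \in G -> h \in G ->
  chi (mulO F t g h) j k = chi g j k * chi h j k.
Proof.
move=> gG hG; have [v v0] := M_neq0 j k.
apply: (mulIf v0); rewrite -M_act ?mulO_normG // (actOM F t a b c d tE detE).
by rewrite !M_act // mulrA.
Qed.

(** In the application [chi g j k] is the eigenvalue at [k] times the conjugate of the one at [j],
    so this compares two characters of [G]. *)
Definition same_char j k : bool := [forall g in G, chi g j k == 1].

Lemma same_char_diag j : same_char j j.
Proof. by apply/forall_inP => g gG; rewrite chi_diag. Qed.

Lemma sum_chi j k : \sum_(g in G) chi g j k = #|G|%:R * (same_char j k)%:R.
Proof.
case: (boolP (same_char j k)) => [/forall_inP h|].
  rewrite mulr1 (eq_bigr (fun _ => 1)) ?sumr_const //.
  by move=> g gG; exact/eqP/h.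
rewrite negb_forall_in => /exists_inP[g0 g0G g01]; rewrite mulr0.
set S := \sum_(g in G) _.
have : S = chi g0 j k * S.
  rewrite /S mulr_sumr [LHS](reindex (mulO F t g0)) /=; last first.
    exists (mulO F t (conjO F t g0)) => g _; first exact: mulKO.
    have cK : conjO F t (conjO F t g0) = g0.
      by case: (g0) => x y; rewrite /conjO /=; congr pair; ring.
    by have := mulKO F t (conjO F t g0); rewrite conjO_normG cK; exact.
  rewrite (eq_bigl [in G]); last by move=> g; rewrite mulO_normG.
  by apply: eq_bigr => g gG; rewrite chiM.
move=> /eqP; rewrite -{1}[S]mul1r -subr_eq0 -mulrBl mulf_eq0 subr_eq0 eq_sym.
by rewrite (negPf g01) => /eqP.
Qed.

Lemma sum_act v j k :
  \sum_(g in G) M (act g v) j k = #|G|%:R * ((same_char j k)%:R * M v j k).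
Proof.
by rewrite mulrA -sum_chi mulr_suml; apply: eq_bigr => g gG; rewrite M_act.
Qed.

Definition hits v w : nat := \sum_(g in G) (act g v == w).

(** Averaging over [G] keeps exactly the entries at equal characters; [M_orth] then applies to each
    translate [act g v]. *)
Lemma same_char_HS v w :
  \sum_j \sum_k (same_char j k)%:R * (M v j k * (M w j k)^*)
  = N%:R / #|G|%:R * (hits v w)%:R.
Proof.
apply: (mulfI G_neq0).
transitivity (\sum_(g in G) \sum_j \sum_k M (act g v) j k * (M w j k)^*).
  rewrite [RHS]exchange_big mulr_sumr; apply: eq_bigr => j _ /=.
  rewrite [RHS]exchange_big mulr_sumr; apply: eq_bigr => k _ /=.
  by rewrite -mulr_suml sum_act !mulrA.
under eq_bigr do rewrite M_orth.
rewrite -mulr_sumr -natr_sum mulrA [#|G|%:R * _]mulrC divfK //.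
Qed.

Lemma hits_le1 v w : v != 0 -> (hits v w <= 1)%N.
Proof.
move=> v0; rewrite /hits.
rewrite (eq_bigr (fun g => if act g v == w then 1 else 0)%N); last by move=> g _; case: eqP.
rewrite -big_mkcondr /= sum1_card leqNgt; apply/negP => /card_gt1P[g [h [+ + gh]]].
move=> /andP[gG /eqP eg] /andP[hG /eqP eh]; move/eqP: gh; apply.
by apply: (actO_inj F F_unit t two_neq0 disc_neq0 a b c d tE detE g h v) => //; rewrite eg.
Qed.

Lemma hits_self v : hits v v = if v == 0 then #|G| else 1%N.
Proof.
case: eqP => [->|/eqP v0].
  rewrite /hits -sum1_card; apply: eq_bigr => g _.
  by rewrite actO0 eqxx.
apply/eqP; rewrite eqn_leq hits_le1 //= /hits (bigD1 (1, 0)) ?one_in_normG //=.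
by rewrite actO1 eqxx.
Qed.

Lemma hitsE v w : Q v != 0 -> hits v w = (Q v == Q w).
Proof.
move=> Qv; have v0 : v != 0.
  by apply: contraNneq Qv => ->; rewrite /Qz /=; apply/eqP; ring.
case: eqP => [e|ne].
  have [g gG egv] := actO_orbit F F_unit t a b c d tE detE _ _ e Qv.
  apply/eqP; rewrite eqn_leq hits_le1 //= /hits (bigD1 g) //= egv eqxx.
  by rewrite add1n.
rewrite /hits big1 // => g gG; case: eqP => // egv; case: ne.
by rewrite -egv (Qz_act F t a b c d tE detE); move: gG; rewrite in_normG => /eqP ->; rewrite mul1r.
Qed.

(** Sum [same_char_HS] over [v = w]. By [M_parseval] the left side counts each pair N times; on the
    right [v = 0] is hit |G| times and any other [v] once. *)
Lemma sum_same_char :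
  ((\sum_j \sum_k same_char j k) * #|G| = #|G| + (N ^ 2).-1)%N.
Proof.
apply/eqP; rewrite -(eqr_nat C) natrM natr_sum.
under eq_bigr do rewrite natr_sum.
apply/eqP; apply: (mulfI N_neq0); rewrite mulrA.
transitivity ((\sum_v N%:R / #|G|%:R * (hits v v)%:R) * #|G|%:R : C).
  congr (_ * _); under [RHS]eq_bigr do rewrite -same_char_HS.
  rewrite [RHS]exchange_big mulr_sumr; apply: eq_bigr => j _ /=.
  rewrite [RHS]exchange_big mulr_sumr; apply: eq_bigr => k _ /=.
  rewrite -mulr_sumr mulrC -(M_parseval j k); congr (_ * _).
  by apply: eq_bigr => v _; rewrite normCK.
rewrite -mulr_sumr mulrAC divfK //; congr (_ * _); rewrite -natr_sum.
under eq_bigr do rewrite hits_self.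
rewrite (bigD1 (0 : F * F)) //= eqxx (eq_bigr (fun _ => 1%N)); last first.
  by move=> v /negPf ->.
rewrite sum1_card; congr (_ + _)%:R%R.
have := cardC1 (0 : F * F)%type.
rewrite card_prod cardF mulnn => <-.
by apply: eq_card => v; rewrite !inE.
Qed.

Lemma diag_le_same_char : (N <= \sum_j \sum_k same_char j k)%N.
Proof.
rewrite -[X in (X <= _)%N]card_ord -sum1_card; apply: leq_sum => j _.
by rewrite (bigD1 j) //= same_char_diag.
Qed.

(** The N diagonal positions alone give (N - 1) |G| <= N^2 - 1. *)
Lemma card_normG_le : (#|G| <= N.+1)%N.
Proof.
have := diag_le_same_char; have := sum_same_char.
have := normG_gt0 F t; set g := #|G|; set S := (\sum_j _)%N => g0 e h.
have h2 : (N * g <= g + (N ^ 2).-1)%N by rewrite -e leq_mul2r h orbT.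
nia.
Qed.

(** The number of equal pairs is 1 + (N^2 - 1) / |G|, at most N + 2 as |G| >= N - 1, and N of them
    are diagonal. *)
Lemma offdiag_same_char : (\sum_j \sum_(k | k != j) same_char j k <= 2)%N.
Proof.
have := sum_same_char.
have -> : (\sum_j \sum_k same_char j k
    = N + \sum_j \sum_(k | k != j) same_char j k)%N.
  rewrite -[X in (X + _)%N]card_ord -sum1_card -big_split /=; apply: eq_bigr => j _.
  by rewrite [LHS](bigD1 j) //= same_char_diag.
have := card_normG_ge F F_unit t two_neq0; rewrite cardF.
set g := #|G|; set S := (\sum_j _)%N => h1 h2; nia.
Qed.

Definition offdiag v : C :=
  \sum_j \sum_(k | k != j) (same_char j k)%:R * `|M v j k| ^+ 2.

Lemma diag_offdiag v w : \sum_j M v j j * (M w j j)^* =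
  N%:R / #|G|%:R * (hits v w)%:R -
  \sum_j \sum_(k | k != j) (same_char j k)%:R * (M v j k * (M w j k)^*).
Proof.
rewrite -same_char_HS -sumrB; apply: eq_bigr => j _.
by rewrite [in RHS](bigD1 j) //= addrK same_char_diag mul1r.
Qed.

Lemma diag_sq_le v : v != 0 -> \sum_j `|M v j j| ^+ 2 <= N%:R / #|G|%:R.
Proof.
move=> v0; have -> : \sum_j `|M v j j| ^+ 2 = \sum_j M v j j * (M v j j)^*.
  by apply: eq_bigr => j _; rewrite normCK.
rewrite diag_offdiag hits_self (negPf v0) mulr1 lerBlDr lerDl.
apply: sumr_ge0 => j _; apply: sumr_ge0 => k _.
by rewrite mulr_ge0 ?ler0n // mul_conjC_ge0.
Qed.

(** The part [D] of [M v] at equal characters is the average of the [M (act g v)]. So |G|^4 times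
    the trace of the square of [D *m Da] is a sum over four group elements of traces of modulus N or
    0, nonzero only when act g1 v + act g3 v = act g2 v + act g4 v; [normG_fourth_moment] counts
    these. *)
Lemma fourth_moment v : Q v != 0 ->
  \sum_j (\sum_k (same_char j k)%:R * `|M v j k| ^+ 2) ^+ 2
  <= 3 * N%:R / #|G|%:R ^+ 2.
Proof.
move=> Qv.
pose D := \matrix_(j, k) ((same_char j k)%:R * M v j k).
pose Da := \matrix_(j, k) (D k j)^*.
have DE : #|G|%:R *: D = \sum_(g in G) M (act g v).
  apply/matrixP => j k; rewrite summxE sum_act !mxE //.
have DaE : #|G|%:R *: Da = \sum_(g in G) M (- act g v).
  apply/matrixP => j k; rewrite summxE mxE.
  under eq_bigr do rewrite -M_adj.
  by rewrite -rmorph_sum sum_act !mxE rmorphM rmorph_nat.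
have diagE j : (D *m Da) j j = \sum_k (same_char j k)%:R * `|M v j k| ^+ 2.
  rewrite mxE; apply: eq_bigr => k _; rewrite !mxE -normCK normrM exprMn.
  by case: same_char; rewrite ?normr1 ?normr0 ?expr1n ?expr0n.
have herm j k : ((D *m Da) j k)^* = (D *m Da) k j.
  rewrite !mxE rmorph_sum; apply: eq_bigr => l _.
  by rewrite rmorphM /= [Da l k]mxE [Da l j]mxE conjCK mulrC.
have trE : \tr (D *m Da *m (D *m Da)) = \sum_j \sum_k `|(D *m Da) j k| ^+ 2.
  rewrite /mxtrace; apply: eq_bigr => j _; rewrite mxE; apply: eq_bigr => k _.
  by rewrite normCK herm.
(* [D *m Da] is Hermitian, so this trace is the sum of the squared moduli of all its entries; the
   left side retains the diagonal ones. *)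
apply: (@le_trans _ _ (\tr (D *m Da *m (D *m Da)))).
  rewrite trE; apply: ler_sum => j _; rewrite [leRHS](bigD1 j) //= -diagE.
  have r : (D *m Da) j j = `|(D *m Da) j j|.
    rewrite ger0_norm // diagE; apply: sumr_ge0 => k _.
    by rewrite mulr_ge0 ?ler0n // exprn_ge0.
  rewrite -r lerDl; apply: sumr_ge0 => k _; exact: exprn_ge0.
rewrite ler_pdivlMr ?exprn_gt0 // -(ler_pM2r (exprn_gt0 2 G_gt0)) -mulrA -exprD.
have TE : \tr (D *m Da *m (D *m Da)) * #|G|%:R ^+ 4 =
  \sum_(g1 in G) \sum_(g2 in G) \sum_(g3 in G) \sum_(g4 in G)
   \tr (M (act g1 v) *m M (- act g2 v) *m (M (act g3 v) *m M (- act g4 v))).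
  transitivity (\tr ((#|G|%:R *: D) *m (#|G|%:R *: Da)
                     *m ((#|G|%:R *: D) *m (#|G|%:R *: Da)))).
    rewrite -!(scalemxAl, scalemxAr) !scalerA mxtraceZ mulrC; congr (_ * _).
    by rewrite !exprS expr0 mulr1 !mulrA.
  move: DE DaE; set X := _ *: D; set Y := _ *: Da; clearbody X Y => XE YE.
  rewrite {1}XE !mulmx_suml raddf_sum; apply: eq_bigr => g1 _ /=.
  rewrite {1}YE mulmx_sumr mulmx_suml raddf_sum; apply: eq_bigr => g2 _ /=.
  rewrite XE mulmx_suml mulmx_sumr raddf_sum; apply: eq_bigr => g3 _ /=.
  by rewrite YE !mulmx_sumr raddf_sum.
have T_ge0 : 0 <= \tr (D *m Da *m (D *m Da)) * #|G|%:R ^+ 4.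
  rewrite mulr_ge0 ?exprn_ge0 ?ler0n // trE.
  by apply: sumr_ge0 => j _; apply: sumr_ge0 => k _; exact: exprn_ge0.
rewrite -(ger0_norm T_ge0) TE.
apply: (@le_trans _ _ (\sum_(g1 in G) \sum_(g2 in G) \sum_(g3 in G) \sum_(g4 in G)
    N%:R * (act g1 v + act g3 v == act g2 v + act g4 v)%:R)).
  apply: (le_trans (ler_norm_sum _ _ _)); apply: ler_sum => g1 _.
  apply: (le_trans (ler_norm_sum _ _ _)); apply: ler_sum => g2 _.
  apply: (le_trans (ler_norm_sum _ _ _)); apply: ler_sum => g3 _.
  apply: (le_trans (ler_norm_sum _ _ _)); apply: ler_sum => g4 _.
  rewrite !M_mul -!(scalemxAl, scalemxAr) M_mul !scalerA mxtraceZ M_tr.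
  rewrite !normrM !cc_norm !mul1r !normr_nat.
  have -> : (act g1 v - act g2 v + (act g3 v - act g4 v) == 0) =
     (act g1 v + act g3 v == act g2 v + act g4 v).
    by rewrite addrACA -opprD subr_eq0.
  exact: lexx.
under eq_bigr do under eq_bigr do under eq_bigr do rewrite -mulr_sumr.
under eq_bigr do under eq_bigr do rewrite -mulr_sumr.
under eq_bigr do rewrite -mulr_sumr.
rewrite -mulr_sumr mulrAC mulrC ler_wpM2r ?ler0n //.
have := normG_fourth_moment F F_unit t two_neq0 disc_neq0 a b c d v Qv.
rewrite -(ler_nat C) natrM natrX; apply: le_trans.
rewrite natr_sum; apply: ler_sum => g1 _; rewrite natr_sum; apply: ler_sum => g2 _.
by rewrite natr_sum; apply: ler_sum => g3 _; rewrite natr_sum.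
Qed.

(** Each term is split by x <= e + x^2 / e: at most two positions contribute [e], and the squares
    fall under the fourth moment. [e] stays fixed while N grows, and no square roots arise. *)
Lemma offdiag_le v (e : C) : Q v != 0 -> 0 < e ->
  offdiag v <= 2 * e + 3 * N%:R / #|G|%:R ^+ 2 / e.
Proof.
move=> Qv e0.
have step (x : C) : 0 <= x -> x <= e + x ^+ 2 / e.
  move=> x0; rewrite -(ler_pM2r e0) mulrDl divfK ?gt_eqF //.
  have : 0 <= (x - e) ^+ 2.
    rewrite real_exprn_even_ge0 // rpredB ?ger0_real //; exact: ltW.
  rewrite sqrrB => h; rewrite -subr_ge0.
  have -> : e * e + x ^+ 2 - x * e = x ^+ 2 - (x * e) *+ 2 + e ^+ 2 + x * e.
    by ring.
  by rewrite addr_ge0 // mulr_ge0 // ltW.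
apply: (@le_trans _ _ (\sum_j \sum_(k | k != j) (same_char j k)%:R *
    (e + (`|M v j k| ^+ 2) ^+ 2 / e))).
  apply: ler_sum => j _; apply: ler_sum => k _; apply: ler_wpM2l; first exact: ler0n.
  by apply: step; exact: exprn_ge0.
under eq_bigr do under eq_bigr do rewrite mulrDr mulrA.
under eq_bigr do rewrite big_split -!mulr_suml.
rewrite big_split -!mulr_suml; apply: lerD => /=.
  apply: ler_wpM2r; first exact: ltW.
  have := offdiag_same_char; rewrite -(ler_nat C); apply: le_trans.
  by rewrite natr_sum; apply: ler_sum => j _; rewrite natr_sum.
apply: ler_wpM2r; first by rewrite invr_ge0 ltW.
apply: (le_trans _ (fourth_moment v Qv)); apply: ler_sum => j _.
have pos k : 0 <= (same_char j k)%:R * `|M v j k| ^+ 2.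
  by rewrite mulr_ge0 ?ler0n // exprn_ge0.
rewrite expr2 mulr_suml big_mkcond; apply: ler_sum => k _.
case: ifP => _; last by rewrite mulr_ge0 // sumr_ge0.
apply: (@le_trans _ _ ((same_char j k)%:R * `|M v j k| ^+ 2
                       * ((same_char j k)%:R * `|M v j k| ^+ 2))).
  by case: same_char; rewrite ?mul0r ?mul1r -?expr2.
apply: ler_wpM2l => //; rewrite [leRHS](bigD1 k) //= lerDl.
exact: sumr_ge0.
Qed.

(** The mixed off-diagonal products are at most half the sum of the squares, which reduces them to
    [offdiag v] and [offdiag w]. *)
Lemma diag_corr_le v w (e : C) : Q v != 0 -> Q w != 0 -> 0 < e ->
  `|\sum_j M v j j * (M w j j)^* - N%:R / #|G|%:R * (Q v == Q w)%:R|
  <= 2 * e + 3 * N%:R / #|G|%:R ^+ 2 / e.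
Proof.
move=> Qv Qw e0; rewrite diag_offdiag hitsE // addrAC subrr sub0r normrN.
apply: (@le_trans _ _ ((offdiag v + offdiag w) / 2)); last first.
  rewrite ler_pdivrMr // [leRHS]mulrDr mulr1.
  by apply: lerD; exact: offdiag_le.
rewrite ler_pdivlMr // /offdiag -big_split /=.
apply: (le_trans (ler_wpM2r _ (ler_norm_sum _ _ _))) => //.
rewrite mulr_suml; apply: ler_sum => j _; rewrite -big_split /=.
apply: (le_trans (ler_wpM2r _ (ler_norm_sum _ _ _))) => //.
rewrite mulr_suml; apply: ler_sum => k _.
rewrite -mulrDr !normrM normr_nat norm_conjC -mulrA ler_wpM2l ?ler0n //.
rewrite mulr_natr -subr_ge0.
have -> : `|M v j k| ^+ 2 + `|M w j k| ^+ 2 - (`|M v j k| * `|M w j k|) *+ 2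
  = (`|M v j k| - `|M w j k|) ^+ 2 by ring.
by rewrite real_exprn_even_ge0 // rpredB ?ger0_real.
Qed.

End DiagonalCorrelations.

Local Open Scope classical_set_scope.
Local Open Scope ring_scope.
Local Open Scope complex_scope.

(** * Absolutely convergent families *)

Section ComplexModulus.
Context {R : realType}.
Implicit Types z w : R[i].
Local Notation nc := (@Normc.normc R).

Lemma normcC z : `|z| = (nc z)%:C.
Proof. by []. Qed.

Lemma normc_ge0 z : 0 <= nc z.
Proof. by rewrite -lecR -normcC normr_ge0. Qed.

Lemma normcD z w : nc (z + w) <= nc z + nc w.
Proof. by rewrite -lecR rmorphD /= -!normcC ler_normD. Qed.

Lemma normcM z w : nc (z * w) = nc z * nc w.
Proof. by apply: complexI; rewrite rmorphM /= -!normcC normrM. Qed.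

Lemma normc_norm (x : R) : nc x%:C = `|x|.
Proof. by apply: complexI; rewrite -normcC normc_def /= expr0n /= addr0 sqrtr_sqr. Qed.

Lemma normc_sum (I : Type) (s : seq I) (P : pred I) (F : I -> R[i]) :
  nc (\sum_(i <- s | P i) F i) <= \sum_(i <- s | P i) nc (F i).
Proof.
rewrite -lecR rmorph_sum /= -normcC; apply: le_trans (ler_norm_sum _ _ _) _.
by apply: ler_sum => i _.
Qed.

Lemma normc_Re z : `|complex.Re z| <= nc z.
Proof.
case: z => a b; rewrite /nc /= -sqrtr_sqr ler_wsqrtr // lerDl; exact: sqr_ge0.
Qed.

Lemma normc_Im z : `|complex.Im z| <= nc z.
Proof.
case: z => a b; rewrite /nc /= -sqrtr_sqr ler_wsqrtr // lerDr; exact: sqr_ge0.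
Qed.

Lemma normc_le_ReIm z : nc z <= `|complex.Re z| + `|complex.Im z|.
Proof.
case: z => a b /=; rewrite -[leRHS]ger0_norm ?addr_ge0 // -sqrtr_sqr ler_wsqrtr //.
by rewrite sqrrD !real_normK ?num_real // -addrA lerD2l lerDr mulrn_wge0 //.
Qed.

Lemma sqmodE z : (sqmod z)%:C = z * (z^*)%R.
Proof. by rewrite /sqmod rmorphXn /= -normcC normCK. Qed.

Lemma sqmod_ge0 z : 0 <= sqmod z.
Proof. by rewrite /sqmod exprn_ge0 // normc_ge0. Qed.

End ComplexModulus.

Section FamilySums.
Context {R : realType} {I : choiceType}.
Implicit Types (D : set I) (h : I -> R) (s : seq I).
Local Notation nc := (@Normc.normc R).

(** For nonnegative [h] this bounds the sum over [D] by finite sums only. It expresses summability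
    and, on the complement of a finite list, smallness of a tail. *)
Definition sums_le (D : set I) (h : I -> R) (M : R) :=
  forall s, uniq s -> (forall i, i \in s -> D i) -> \sum_(i <- s) h i <= M.

Lemma esum_le D h (M : R) : sums_le D h M -> (\esum_(i in D) (h i)%:E <= M%:E)%E.
Proof.
move=> hM; apply: ge_ereal_sup => _ [A [finA AD] <-].
have [s uA eA] : exists2 s, uniq s & A = [set` s].
  have /finite_seqP[s e] := finA; exists (undup s); first exact: undup_uniq.
  by rewrite e; apply/seteqP; split => i /=; rewrite mem_undup.
rewrite eA -fsbig_seq // sumEFin lee_fin; apply: hM => // i si.
by apply: AD; rewrite eA.
Qed.

Lemma sum_le_esum D h s : uniq s -> (forall i, i \in s -> D i) ->
  ((\sum_(i <- s) h i)%:E <= \esum_(i in D) (h i)%:E)%E.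
Proof.
move=> us sD; apply: ereal_sup_ubound; exists [set` s].
  by split => //; exact: finite_seq.
by rewrite -fsbig_seq // sumEFin.
Qed.

(** The positive and the negative part each leave a tail in [0, e], and the difference of two such
    numbers is at most [e] in modulus. *)
Lemma rsum_approx D h s e : uniq s -> (forall i, i \in s -> D i) ->
  (exists M, sums_le D (fun i => `|h i|) M) ->
  sums_le (D `\` [set` s]) (fun i => `|h i|) e ->
  `|rsum D h - \sum_(i <- s) h i| <= e.
Proof.
move=> us sD [M hM] he; rewrite /rsum.
have split_esum (k : I -> \bar R) : (forall i, 0 <= k i)%E ->
    (esum D k = \sum_(i <- s) k i + esum (D `\` [set` s]) k)%E.
  move=> k0; rewrite (esumID [set` s]) // -setDE; congr (_ + _)%E.
  rewrite (_ : D `&` [set` s] = [set` s]); last first.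
    by apply/seteqP; split => [i []|i si] //; split => //; exact: sD.
  rewrite esum_fset; [by rewrite -fsbig_seq|exact: finite_seq|by move=> i _; exact: k0].
have fin (D' : set I) (k : I -> \bar R) M' : sums_le D' (fun i => `|h i|) M' ->
    (forall i, 0 <= k i <= `|h i|%:E)%E ->
    (esum D' k \is a fin_num) /\ (0 <= fine (esum D' k) <= M').
  move=> hM' kh.
  have k0 : (0 <= esum D' k)%E by apply: esum_ge0 => i _; case/andP: (kh i).
  have kM : (esum D' k <= M'%:E)%E.
    apply: (@le_trans _ _ (\esum_(i in D') (`|h i|)%:E)%E); last exact: esum_le.
    by apply: le_esum => i _; case/andP: (kh i).
  have f : esum D' k \is a fin_num.
    by rewrite ge0_fin_numE // (le_lt_trans kM) // ltry.
  by split => //; rewrite -!lee_fin fineK // k0.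
have hp i : (0 <= (EFin \o h)^\+ i <= `|h i|%:E)%E.
  by rewrite funepos_ge0 funeposE /= -EFin_max lee_fin ge_max ler_norm normr_ge0.
have hn i : (0 <= (EFin \o h)^\- i <= `|h i|%:E)%E.
  rewrite funeneg_ge0 funenegE /= -EFin_max lee_fin ge_max normr_ge0 andbT.
  by rewrite -normrN ler_norm.
have he' : sums_le (D `\` [set` s]) (fun i => `|h i|) e by [].
rewrite !split_esum; [|by move=> i; case/andP: (hn i)|by move=> i; case/andP: (hp i)].
have [f1 /andP[a1 b1]] := fin _ _ _ he' hp; have [f2 /andP[a2 b2]] := fin _ _ _ he' hn.
set A := esum _ _ in f1 a1 b1 *; set B := esum _ _ in f2 a2 b2 *.
have sp : (\sum_(i <- s) (EFin \o h)^\+ i = (\sum_(i <- s) Num.max (h i) 0)%:E)%E.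
  by rewrite -sumEFin; apply: eq_bigr => i _; rewrite funeposE /= -EFin_max.
have sn : (\sum_(i <- s) (EFin \o h)^\- i = (\sum_(i <- s) Num.max (- h i) 0)%:E)%E.
  by rewrite -sumEFin; apply: eq_bigr => i _; rewrite funenegE /= -EFin_max.
rewrite sp sn -(fineK f1) -(fineK f2) -!EFinD /=.
have -> : \sum_(i <- s) h i = \sum_(i <- s) Num.max (h i) 0 - \sum_(i <- s) Num.max (- h i) 0.
  rewrite -sumrB; apply: eq_bigr => i _.
  by case: (lerP (h i) 0) => hi; case: (lerP (- h i) 0) => hi' //; lra.
by rewrite ler_norml; apply/andP; split; lra.
Qed.

Lemma sums_leW D D' h h' M : (forall i, D' i -> D i) ->
  (forall i, D' i -> h' i <= h i) -> sums_le D h M -> sums_le D' h' M.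
Proof.
move=> DD hh' hM s us sD; apply: (le_trans _ (hM s us _)).
  by rewrite big_seq [leRHS]big_seq; apply: ler_sum => i /sD; exact: hh'.
by move=> i /sD /DD.
Qed.

Lemma sums_leZ D h M k : 0 <= k -> sums_le D h M -> sums_le D (fun i => k * h i) (k * M).
Proof. by move=> k0 hM s us sD; rewrite -mulr_sumr ler_wpM2l // hM. Qed.

Lemma rsum_eq D (h h' : I -> R) : (forall i, D i -> h i = h' i) -> rsum D h = rsum D h'.
Proof.
by move=> hh'; rewrite /rsum; congr (fine (_ - _)%E); apply: eq_esum => i Di;
  rewrite ?funeposE ?funenegE /= hh'.
Qed.

Lemma rsum0 D : rsum D (fun=> 0) = 0 :> R.
Proof.
have s0 (D' : set I) (M : R) : 0 <= M -> sums_le D' (fun i => `|0 : R|) M.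
  by move=> M0 s _ _; rewrite big1 // => i _; rewrite normr0.
have := @rsum_approx D (fun=> 0) [::] 0 isT; rewrite big_nil subr0 normr_le0.
by move=> h; apply/eqP/h => //; [exists 0; exact: s0|exact: s0].
Qed.

(** Real and imaginary parts are approximated separately, hence the factor 2. *)
Lemma csum_approx D (g : I -> R[i]) h s e : (forall i, D i -> nc (g i) <= h i) ->
  uniq s -> (forall i, i \in s -> D i) -> (exists M, sums_le D h M) ->
  sums_le (D `\` [set` s]) h e ->
  nc (csum D g - \sum_(i <- s) g i) <= 2 * e.
Proof.
move=> gh us sD [M hM] he; apply: (le_trans (normc_le_ReIm _)).
have -> : complex.Re (csum D g - \sum_(i <- s) g i) =
    rsum D (fun i => complex.Re (g i)) - \sum_(i <- s) complex.Re (g i).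
  by rewrite raddfB /= raddf_sum.
have -> : complex.Im (csum D g - \sum_(i <- s) g i) =
    rsum D (fun i => complex.Im (g i)) - \sum_(i <- s) complex.Im (g i).
  by rewrite raddfB /= raddf_sum.
rewrite mulrDl mul1r.
apply: lerD; apply: rsum_approx => //.
- exists M; apply: sums_leW hM => // i Di; exact: le_trans (normc_Re _) (gh i Di).
- apply: sums_leW he => // i [Di _]; exact: le_trans (normc_Re _) (gh i Di).
- exists M; apply: sums_leW hM => // i Di; exact: le_trans (normc_Im _) (gh i Di).
- apply: sums_leW he => // i [Di _]; exact: le_trans (normc_Im _) (gh i Di).
Qed.

(** The list comes within [e] of the supremum of the finite sums; a disjoint list of sum above [e]
    would push past it. *)
Lemma tail_exists D h M e : (forall i, D i -> 0 <= h i) -> sums_le D h M -> 0 < e ->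
  exists s, [/\ uniq s, forall i, i \in s -> D i & sums_le (D `\` [set` s]) h e].
Proof.
move=> h0 hM e0.
pose S := [set x | exists s, [/\ uniq s, forall i, i \in s -> D i & x = \sum_(i <- s) h i]].
have hS : has_sup S.
  split; first by exists 0, [::]; rewrite big_nil.
  by exists M => _ [s [us sD ->]]; exact: hM.
have [_ [s [us sD ->]] sS] := sup_adherent e0 hS.
exists s; split => // s' us' s'D.
have : \sum_(i <- s ++ s') h i <= sup S.
  apply: ub_le_sup; first by case: hS.
  exists (s ++ s'); split => //.
    rewrite cat_uniq us us' andbT /=; apply/hasPn => i /s'D [_ /=].
    by move/negP.
  by move=> i; rewrite mem_cat => /orP[/sD //|/s'D []].
rewrite big_cat /=; lra.
Qed.

Lemma csum_single (g : I -> R[i]) i0 : (forall i, i != i0 -> g i = 0) ->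
  csum setT g = g i0.
Proof.
move=> g0; pose h i := if i == i0 then nc (g i0) else 0.
have h0 i : 0 <= h i by rewrite /h; case: ifP => // _; exact: normc_ge0.
have : nc (csum setT g - \sum_(i <- [:: i0]) g i) <= 2 * 0.
  apply: (csum_approx _ _ h) => //.
  - move=> i _; rewrite /h; case: eqVneq => [->//|/g0 ->].
    by rewrite -lecR -normcC normr0.
  - exists (nc (g i0)) => s us _; have [is0|is0] := boolP (i0 \in s).
      rewrite (bigD1_seq i0) //= /h eqxx big1 ?addr0 // => i /negPf -> //.
    rewrite big_seq big1 ?normc_ge0 // => i si; rewrite /h.
    by case: eqP => // e; rewrite -e si in is0.
  - move=> s us sD; rewrite big_seq big1 // => i /sD [_ /=]; rewrite inE /h.
    by move=> /negP/negPf ->.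
rewrite mulr0 big_seq1 => hle.
apply/eqP; rewrite -subr_eq0 -normr_eq0 normcC eq_le lecR hle /= lecR.
exact: normc_ge0.
Qed.

End FamilySums.

(** * Summability over pairs of integers *)

Section IntPairs.
Context {R : realType}.

Definition ints (k : nat) : seq int :=
  [seq Posz m | m <- iota 0 k] ++ [seq Negz m | m <- iota 0 k].

Lemma mem_ints k (i : int) : (`|i| < k)%N -> i \in ints k.
Proof.
rewrite /ints mem_cat; case: i => m /= mk; apply/orP; [left|right].
  by apply/mapP; exists m; rewrite // mem_iota.
by apply/mapP; exists m; rewrite // mem_iota /= (ltn_trans _ mk).
Qed.

Definition invsq (i : int) : R := ((1 + `|i|%N%:R) ^+ 2)^-1.

Lemma invsq_ge0 i : 0 <= invsq i.
Proof. by rewrite invr_ge0 exprn_ge0 // addr_ge0. Qed.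

(** Telescoping with 1/(x + 1)^2 <= 1/x - 1/(x + 1) bounds each half-line by 2. *)
Lemma sum_invsq k : \sum_(i <- ints k) invsq i <= 4.
Proof.
have tel m : \sum_(j <- iota 0 m.+1) ((1 + j%:R) ^+ 2)^-1 <= 2 - (m%:R + 1)^-1 :> R.
  elim: m => [|m IH].
    by rewrite big_seq1 addr0 add0r expr1n invr1; lra.
  rewrite -addn1 iotaD big_cat [X in _ + X <= _]big_seq1 /= add0n.
  apply: (le_trans (lerD IH (lexx _))); rewrite -[m.+1%:R]natr1.
  have m0 : 0 < m%:R + 1 :> R by rewrite ltr_wpDl.
  set x := m%:R + 1 in m0 *; rewrite [1 + _]addrC.
  have x1 : 0 < x + 1 by rewrite addr_gt0.
  have -> : ((x + 1) ^+ 2)^-1 = (x + 1)^-1 * (x + 1)^-1 by rewrite -exprVn expr2.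
  have h : (x + 1)^-1 * (x + 1)^-1 <= x^-1 * (x + 1)^-1.
    apply: ler_wpM2r; first by rewrite invr_ge0 ltW.
    by rewrite lef_pV2 ?posrE // lerDl.
  have e : x^-1 * (x + 1)^-1 = x^-1 - (x + 1)^-1.
    by field; rewrite !gt_eqF.
  by move: h; rewrite e; lra.
have tel2 m : \sum_(j <- iota 0 m) ((1 + j%:R) ^+ 2)^-1 <= 2 :> R.
  case: m => [|m]; first by rewrite big_nil.
  by apply: (le_trans (tel m)); rewrite gerBl invr_ge0 addr_ge0.
rewrite /ints big_cat !big_map /=.
apply: (@le_trans _ _ (2 + 2)); last by lra.
apply: lerD; first exact: tel2.
apply: le_trans (tel2 k); apply: ler_sum => j _.
rewrite /invsq /= lef_pV2 ?posrE ?exprn_gt0 ?ltr_pwDl //.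
by rewrite lerXn2r ?nnegrE ?addr_ge0 // lerD2l ler_nat.
Qed.

Lemma sum_subset_le (T : eqType) (F : T -> R) (s t : seq T) :
  uniq s -> {subset s <= t} -> (forall x, 0 <= F x) ->
  \sum_(x <- s) F x <= \sum_(x <- t) F x.
Proof.
move=> us st F0; elim: s t us st => [|x s IH] t /=.
  by move=> _ _; rewrite big_nil sumr_ge0.
move=> /andP[xs us] st; rewrite big_cons [leRHS](big_rem x) /=; last first.
  by apply: st; rewrite mem_head.
rewrite lerD2l; apply: IH => // y ys; apply: rem_mem.
  by apply: contraNneq xs => <-.
by apply: st; rewrite in_cons ys orbT.
Qed.

Lemma sum_invsq2 (s : seq (int * int)) : uniq s ->
  \sum_(n <- s) invsq n.1 * invsq n.2 <= 16.
Proof.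
move=> us; pose k := (\sum_(n <- s) (`|n.1| + `|n.2|)).+1.
apply: (@le_trans _ _ (\sum_(n <- [seq (i, j) | i <- ints k, j <- ints k])
    invsq n.1 * invsq n.2)).
  apply: sum_subset_le => // [[i j] ns|n]; last by rewrite mulr_ge0 // invsq_ge0.
  have h : (`|i| + `|j| < k)%N by rewrite /k ltnS (big_rem (i, j)) //= leq_addr.
  apply/allpairsP; exists (i, j); split => //; apply: mem_ints.
    by rewrite (leq_ltn_trans _ h) // leq_addr.
  by rewrite (leq_ltn_trans _ h) // leq_addl.
rewrite big_allpairs /=; under eq_bigr do rewrite -mulr_sumr.
rewrite -mulr_suml [leRHS](_ : _ = 4 * 4); last by ring.
by apply: ler_pM; rewrite ?sum_invsq // sumr_ge0 // => i _; exact: invsq_ge0.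
Qed.

End IntPairs.

(** * Fourier analysis on the torus *)

Section SquareIntegral.
Context {R : realType}.
Implicit Types (g h : R * R -> R).

(** An open set is the countable union of the rational boxes inside it; this links the topology of
    the plane to the product sigma-algebra. *)
Lemma open_measurable_prod (O : set (R * R)) : open O -> measurable O.
Proof.
move=> oO.
pose box (q : (rat * rat) * (rat * rat)) : set (R * R) :=
  `]ratr q.1.1, ratr q.1.2[%classic `*` `]ratr q.2.1, ratr q.2.2[%classic.
have -> : O = \bigcup_q (if `[< box q `<=` O >] then box q else set0).
  apply/seteqP; split => [[x y] Oxy|z [q _]]; last first.
    by case: asboolP => // bO /bO.
  have /nbhs_ballP[e /= e0 be] : nbhs (x, y) O by exact: open_nbhs_nbhs.
  have ratb (u : R) : exists q : rat * rat,
      (u \in `]ratr q.1, ratr q.2[) /\ (`]ratr q.1, ratr q.2[%classic `<=` ball u e).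
    have [q1 /itvP h1] : exists q : rat, ratr q \in `]u - e, u[.
      by apply: rat_in_itvoo; rewrite ltrBlDr ltrDl.
    have [q2 /itvP h2] : exists q : rat, ratr q \in `]u, u + e[.
      by apply: rat_in_itvoo; rewrite ltrDl.
    exists (q1, q2); split; first by rewrite in_itv/= h1 h2.
    move=> z /=; rewrite in_itv/= => /andP[z1 z2].
    rewrite /ball/= ltr_distlC; apply/andP; split.
      by rewrite (lt_trans _ z1) // h1.
    by rewrite (lt_trans z2) // h2.
  have [q1 [xq1 bq1]] := ratb x; have [q2 [yq2 bq2]] := ratb y.
  exists (q1, q2) => //; case: asboolP => [_|]; first by split.
  by case => -[u v] [/= bu bv]; apply: be; split => /=; [exact: bq1|exact: bq2].
apply: countable_bigcupT_measurable => // q.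
by case: asboolP => // _; apply: measurableX; exact: measurable_itv.
Qed.

Lemma continuous_measurable_prod g : continuous g -> measurable_fun setT g.
Proof.
move=> cg; apply: (measurability _ (measurable_realfun.RGenOInfty.measurableE R)) => //.
move=> _ [_ [x ->] <-]; rewrite setTI; apply: open_measurable_prod.
by apply: open_comp => // z _; exact: cg.
Qed.

Definition sq : set (R * R) := `[0, 1]%classic `*` `[0, 1]%classic.

Lemma measurable_sq : measurable sq.
Proof. by apply: measurableX; exact: measurable_itv. Qed.

Lemma leb2_sq : leb2 sq = 1%E.
Proof.
rewrite /leb2 product_measure1E; try exact: measurable_itv.
by rewrite /= lebesgue_measure_itv/= lte_fin ltr01 oppr0 adde0 mule1.
Qed.

Lemma compact_sq : compact sq.
Proof. by apply: compact_setX; exact: segment_compact. Qed.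

Lemma sq_bounded g : continuous g -> exists2 B, 0 < B & forall z, sq z -> `|g z| <= B.
Proof.
move=> cg.
have /compact_bounded[B [_ hB]] : compact (g @` sq).
  by apply: continuous_compact; [exact: continuous_subspaceT|exact: compact_sq].
exists (`|B| + 1) => [|z sz]; first by rewrite ltr_pwDr.
by apply: hB; [rewrite (le_lt_trans (ler_norm _)) // ltrDl|exists z].
Qed.

Lemma sq_integrable g : continuous g -> leb2.-integrable sq (EFin \o g).
Proof.
move=> cg; apply: measurable_bounded_integrable.
- exact: measurable_sq.
- by rewrite [X in (X < _)%E]leb2_sq ltry.
- by apply: measurable_funTS; exact: continuous_measurable_prod.
- have [B B0 hB] := sq_bounded _ cg.
  exists B; split; first exact: gtr0_real.
  by move=> x /ltW Bx z /= sz; rewrite (le_trans _ Bx) // hB.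
Qed.

Definition I2 g : R := \int[leb2]_(z in sq) g z.

Lemma I2_eq g h : g =1 h -> I2 g = I2 h.
Proof. by move=> gh; congr (I2 _); apply/funext. Qed.

Lemma I2D g h : continuous g -> continuous h ->
  I2 (fun z => g z + h z) = I2 g + I2 h.
Proof.
by move=> cg ch; rewrite /I2 RintegralD//; [exact: measurable_sq
  |exact: sq_integrable|exact: sq_integrable].
Qed.

Lemma I2Z k g : continuous g -> I2 (fun z => k * g z) = k * I2 g.
Proof.
by move=> cg; rewrite /I2 RintegralZl//; [exact: measurable_sq|exact: sq_integrable].
Qed.

Lemma I2_cst k : I2 (fun=> k) = k.
Proof.
rewrite /I2 Rintegral_cst; last exact: measurable_sq.
by rewrite [X in fine X]leb2_sq mulr1.
Qed.

Lemma I2_le g B : continuous g -> (forall z, sq z -> `|g z| <= B) -> `|I2 g| <= B.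
Proof.
move=> cg gB; rewrite -[leRHS](I2_cst B); apply: (le_trans (le_normr_Rintegral _ _)).
- exact: measurable_sq.
- exact: sq_integrable.
apply: le_Rintegral => //; first exact: measurable_sq.
- have := sq_integrable (fun z => `|g z|); apply.
  by move=> z; apply: continuous_comp; [exact: cg|exact: norm_continuous].
- by apply: (sq_integrable (cst B)) => z; exact: cvg_cst.
Qed.

Lemma sq_restrict_integrable g : continuous g ->
  leb2.-integrable setT ((EFin \o g) \_ sq).
Proof.
move=> cg; rewrite -integrable_mkcond; last exact: measurable_sq.
exact: sq_integrable.
Qed.

Lemma I2_fubini1 g : continuous g ->
  I2 g = fine (\int[lebesgue_measure]_(x in `[0%R, 1%R])
           \int[lebesgue_measure]_(y in `[0%R, 1%R]) (g (x, y))%:E)%E.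
Proof.
move=> cg; rewrite /I2 /Rintegral integral_mkcond; congr fine.
rewrite -(integral12_prod_meas1 (sq_restrict_integrable _ cg)).
rewrite [RHS]integral_mkcond; apply: eq_integral => x _.
rewrite /fubini_F /patch; case: ifPn => xI.
  rewrite [RHS]integral_mkcond; apply: eq_integral => y _.
  rewrite /patch; case: ifPn => yI; case: ifPn => //.
    by move: yI; rewrite !inE => -[_ yI]; rewrite notin_setE => /(_ yI).
  by move: yI xI; rewrite notin_setE !inE => yI xI yI'; case: yI; split.
rewrite integral0_eq // => y _; case: ifPn => //.
by move: xI; rewrite notin_setE inE => xI [].
Qed.

Lemma I2_fubini2 g : continuous g ->
  I2 g = fine (\int[lebesgue_measure]_(y in `[0%R, 1%R])
           \int[lebesgue_measure]_(x in `[0%R, 1%R]) (g (x, y))%:E)%E.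
Proof.
move=> cg; rewrite /I2 /Rintegral integral_mkcond; congr fine.
rewrite -(integral21_prod_meas1 (sq_restrict_integrable _ cg)).
rewrite [RHS]integral_mkcond; apply: eq_integral => y _.
rewrite /fubini_G /patch; case: ifPn => yI.
  rewrite [RHS]integral_mkcond; apply: eq_integral => x _.
  rewrite /patch; case: ifPn => xI; case: ifPn => //.
    by move: xI; rewrite !inE => -[xI _]; rewrite notin_setE => /(_ xI).
  by move: yI xI; rewrite notin_setE !inE => yI xI yI'; case: xI; split.
rewrite integral0_eq // => x _; case: ifPn => //.
by move: yI; rewrite notin_setE inE => yI [].
Qed.

Definition line (b : bool) (z : R * R) (s : R) : R * R :=
  if b then (z.1, s) else (s, z.2).

Lemma line_shift b z s u : line b z (u + s) = u *: dir b + line b z s.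
Proof.
by case: b; rewrite /line /dir /=; congr pair; rewrite /= ?scaler0 ?add0r //;
  rewrite -[u *: _]/(u * _) mulr1.
Qed.

Lemma line_diffE g b z s : (fun u => u^-1 *: (g (line b z (u + s)) - g (line b z s))) =
  (fun u => u^-1 *: ((g \o shift (line b z s)) (u *: dir b) - g (line b z s))).
Proof. by apply/funext => u /=; rewrite line_shift. Qed.

Lemma partial_line g b z s :
  partial b g (line b z s) = derive1 (fun u => g (line b z u)) s.
Proof. by rewrite /partial /derive /derive1 line_diffE. Qed.

Lemma derivable_line g b z s : derivable g (line b z s) (dir b) ->
  derivable (fun u => g (line b z u)) s 1.
Proof.
rewrite /derivable -line_diffE => dg.
rewrite [X in cvg (X @ _)](_ : _ = fun u => u^-1 *: (g (line b z (u + s)) - g (line b z s))) //.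
by apply/funext => u /=; rewrite -[u *: _]/(u * _) mulr1.
Qed.

Lemma line_continuous b z : continuous (line b z).
Proof.
move=> s; case: b; rewrite /line.
  exact: (cvg_pair (cvg_cst _) cvg_id).
exact: (cvg_pair cvg_id (cvg_cst _)).
Qed.

Lemma line_integral_partial h b z : continuous (partial b h) ->
  (forall z, derivable h z (dir b)) -> (forall z, h (z + dir b) = h z) ->
  (\int[lebesgue_measure]_(s in `[0%R, 1%R]) (partial b h (line b z s))%:E = 0)%E.
Proof.
move=> cp dh ph.
have dl s : derivable (fun u => h (line b z u)) s 1.
  by apply: derivable_line; exact: dh.
have cl : continuous (fun u => h (line b z u)).
  by move=> s; apply: differentiable_continuous; exact/derivable1_diffP.
have -> := @continuous_FTC2 R (fun s => partial b h (line b z s))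
  (fun u => h (line b z u)) 0 1 ltr01.
- have -> : h (line b z 1) = h (line b z 0); last by rewrite -EFinB subrr.
  by rewrite -[1 in LHS](addr0 1) line_shift scale1r addrC ph.
- apply: continuous_subspaceT => s.
  by apply: (@continuous_comp _ _ _ (line b z)); [exact: line_continuous|exact: cp].
- split => [s _| |]; first exact: dl.
    by apply: cvg_at_right_filter; exact: cl.
  by apply: cvg_at_left_filter; exact: cl.
- by move=> s _; rewrite partial_line.
Qed.

(** Fubini with the differentiated variable innermost: over a full period the fundamental theorem of
    calculus gives 0. *)
Lemma I2_partial_eq0 h b : continuous (partial b h) ->
  (forall z, derivable h z (dir b)) -> (forall z, h (z + dir b) = h z) ->
  I2 (partial b h) = 0.
Proof.
move=> cp dh ph; case: b cp dh ph => cp dh ph.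
  rewrite I2_fubini1 // (eq_integral (cst 0%E)) ?integral0 // => x _.
  exact: (line_integral_partial _ true (x, 0)).
rewrite I2_fubini2 // (eq_integral (cst 0%E)) ?integral0 // => y _.
exact: (line_integral_partial _ false (0, y)).
Qed.

Lemma derive_lineE g z v d : is_derive (0 : R) (1 : R) (fun u : R => g (u *: v + z)) d ->
  is_derive z v g d.
Proof.
have e : (fun u : R => u^-1 *: ((g \o shift z) (u *: v) - g z)) =
  (fun u : R => u^-1 *: (((fun u : R => g (u *: v + z)) \o shift 0) (u *: 1)
     - (fun u : R => g (u *: v + z)) 0)).
  by apply/funext => u /=; rewrite addr0 scale0r add0r -[u *: 1]/(u * 1) mulr1.
by case=> dF <-; split; [rewrite /derivable e|rewrite /derive e].
Qed.

Implicit Types n : int * int.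

Definition ph n z : R := 2 * pi * (n.1%:~R * z.1 + n.2%:~R * z.2).
Definition kap n (b : bool) : R := 2 * pi * (if b then n.2 else n.1)%:~R.

Lemma ph_shift n b z u : ph n (u *: dir b + z) = ph n z + u * kap n b.
Proof.
rewrite /ph /kap /dir; case: b; case: z => x y /=.
  by rewrite -![u *: _]/(u * _); ring.
by rewrite -![u *: _]/(u * _); ring.
Qed.

Lemma ph0 z : ph 0 z = 0.
Proof. by rewrite /ph !mul0r addr0 mulr0. Qed.

(** The real span of cosine and sine at one frequency is stable under [partial], which allows
    exponentials to be treated by real calculus. *)
Definition trig n (k l : R) : R * R -> R := fun z => k * cos (ph n z) + l * sin (ph n z).

Lemma trig_is_derive n k l b z :
  is_derive z (dir b) (trig n k l) (trig n (l * kap n b) (- (k * kap n b)) z).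
Proof.
apply: derive_lineE.
have -> : (fun u : R => trig n k l (u *: dir b + z)) =
  (fun u => k * cos (ph n z + u * kap n b) + l * sin (ph n z + u * kap n b)).
  by apply/funext => u; rewrite /trig ph_shift.
have di : is_derive (0 : R) (1 : R) (fun u => ph n z + u * kap n b) (kap n b).
  have h := is_deriveD (is_derive_cst (ph n z) (0 : R) (1 : R))
    (is_deriveZ (kap n b) (is_derive_id (0 : R) (1 : R))).
  rewrite (_ : (fun u => _) = cst (ph n z) + kap n b *: @id R); last first.
    by apply/funext => u; rewrite mulrC.
  by apply: is_derive_eq h _; rewrite add0r -[_ *: 1]/(_ * 1) mulr1.
have dc : is_derive (0 : R) (1 : R) (fun u => cos (ph n z + u * kap n b)) (- sin (ph n z) * kap n b).
  have := @is_derive1_comp R cos (fun u => ph n z + u * kap n b) 0 _ _ (is_derive_cos _) di.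
  by rewrite mul0r addr0.
have ds : is_derive (0 : R) (1 : R) (fun u => sin (ph n z + u * kap n b)) (cos (ph n z) * kap n b).
  have := @is_derive1_comp R sin (fun u => ph n z + u * kap n b) 0 _ _ (is_derive_sin _) di.
  by rewrite mul0r addr0.
apply: is_derive_eq (is_deriveD (is_deriveZ k dc) (is_deriveZ l ds)) _.
rewrite /trig.
by rewrite -![_ *: _]/(_ * _); ring.
Qed.

Lemma ph_continuous n : continuous (ph n).
Proof.
move=> z; apply: cvgM; first exact: cvg_cst.
apply: cvgD; apply: cvgM; try exact: cvg_cst.
  exact: cvg_fst.
exact: cvg_snd.
Qed.

Lemma trig_continuous n k l : continuous (trig n k l).
Proof.
move=> z; apply: cvgD; apply: cvgM; try exact: cvg_cst.
  by apply: continuous_comp; [exact: ph_continuous|exact: continuous_cos].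
by apply: continuous_comp; [exact: ph_continuous|exact: continuous_sin].
Qed.

Lemma partial_trig n k l b :
  partial b (trig n k l) = trig n (l * kap n b) (- (k * kap n b)).
Proof. by apply/funext => z; case: (trig_is_derive n k l b z). Qed.

Lemma smooth_trig n k l : smooth (trig n k l).
Proof.
move=> w; have [k' [l' ->]] : exists k' l', foldr partial (trig n k l) w = trig n k' l'.
  elim: w => [|b w [k' [l' IH]]]; first by exists k, l.
  by exists (l' * kap n b), (- (k' * kap n b)); rewrite /= IH partial_trig.
split; first exact: trig_continuous.
by move=> b z; case: (trig_is_derive n k' l' b z).
Qed.

Lemma trig2piZ (x : R) (m : int) :
  cos (x + 2 * pi * m%:~R) = cos x /\ sin (x + 2 * pi * m%:~R) = sin x.
Proof.
have nat_case (y : R) (j : nat) :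
    cos (y + 2 * pi * j%:R) = cos y /\ sin (y + 2 * pi * j%:R) = sin y.
  elim: j => [|j [IHc IHs]]; first by rewrite mulr0 addr0.
  have -> : y + 2 * pi * j.+1%:R = (y + 2 * pi * j%:R) + pi *+ 2.
    by rewrite -natr1 mulr2n; ring.
  by rewrite cosD2pi sinD2pi.
case: (intP m) => [|j|j]; first by rewrite mulr0 addr0.
  exact: (nat_case x j.+1).
have [hc hs] := nat_case (x + 2 * pi * (- (j.+1)%:Z)%:~R) j.+1.
rewrite -hc -hs; have -> : x + 2 * pi * (- (j.+1)%:Z)%:~R + 2 * pi * j.+1%:R = x.
  by rewrite rmorphN /=; ring.
by [].
Qed.

Lemma ph_periodic n b z : ph n (z + dir b) = ph n z + 2 * pi * (if b then n.2 else n.1)%:~R.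
Proof. by rewrite addrC -[dir b]scale1r ph_shift mul1r. Qed.

Lemma trig_periodic n k l b z : trig n k l (z + dir b) = trig n k l z.
Proof.
by rewrite /trig ph_periodic; have [-> ->] := trig2piZ (ph n z) (if b then n.2 else n.1).
Qed.

(** For continuous real [g], [csin] is minus the imaginary part and [ccos] the real part of the
    Fourier coefficient ([fourier_real]). *)
Definition csin n g := I2 (fun z => g z * sin (ph n z)).
Definition ccos n g := I2 (fun z => g z * cos (ph n z)).

(** Integration by parts: the derivative of the periodic product has integral 0. *)
Lemma I2_trig_partial n g b k l : continuous g -> continuous (partial b g) ->
  (forall z, derivable g z (dir b)) -> (forall z, g (z + dir b) = g z) ->
  I2 (fun z => partial b g z * trig n k l z) =
  - I2 (fun z => g z * trig n (l * kap n b) (- (k * kap n b)) z).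
Proof.
move=> cg cpg dg pg.
have pE : partial b (g * trig n k l) = fun z =>
   g z * trig n (l * kap n b) (- (k * kap n b)) z + partial b g z * trig n k l z.
  apply/funext => z; rewrite /partial deriveM //; last by case: (trig_is_derive n k l b z).
  by rewrite -/(partial b (trig n k l) z) partial_trig -![_ *: _]/(_ * _) [X in _ + X]mulrC.
have c1 : continuous (fun z => g z * trig n (l * kap n b) (- (k * kap n b)) z).
  by move=> z; apply: cvgM; [exact: cg|exact: trig_continuous].
have c2 : continuous (fun z => partial b g z * trig n k l z).
  by move=> z; apply: cvgM; [exact: cpg|exact: trig_continuous].
apply/eqP; rewrite -addr_eq0 addrC -I2D // -pE; apply/eqP/I2_partial_eq0.
- by rewrite pE => z; apply: cvgD; [exact: c1|exact: c2].
- by move=> z; apply: derivableM => //; case: (trig_is_derive n k l b z).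
- by move=> z; rewrite /GRing.mul /= /mul_fun pg trig_periodic.
Qed.

Definition smoothp g := smooth g /\ forall b z, g (z + dir b) = g z.

Lemma smooth_partial b g : smooth g -> smooth (partial b g).
Proof. by move=> sg w; have := sg (rcons w b); rewrite foldr_rcons. Qed.

Lemma smoothp_partial b g : smoothp g -> smoothp (partial b g).
Proof.
move=> [sg pg]; split; first exact: smooth_partial.
move=> b' z; rewrite /partial /derive.
rewrite (_ : (fun u => _) =
    (fun u : R => u^-1 *: ((g \o shift z) (u *: dir b) - g z))) //.
by apply/funext => u /=; rewrite addrA !pg.
Qed.

Lemma smoothp_continuous g : smoothp g -> continuous g.
Proof. by case=> /(_ [::]) []. Qed.

Lemma smoothp_derivable g b z : smoothp g -> derivable g z (dir b).
Proof. by case=> /(_ [::]) [_ +] _; exact. Qed.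

Lemma ccos_partial n g b : smoothp g -> ccos n (partial b g) = kap n b * csin n g.
Proof.
move=> sg.
have cpg : continuous (partial b g) := smoothp_continuous _ (smoothp_partial b g sg).
have := I2_trig_partial n g b 1 0 (smoothp_continuous _ sg) cpg.
move=> /(_ (fun z => smoothp_derivable g b z sg) (sg.2 b)) h.
rewrite /ccos (I2_eq _ (fun z => partial b g z * trig n 1 0 z)); last first.
  by move=> z; rewrite /trig mul1r mul0r addr0.
rewrite h; transitivity (- (- kap n b * csin n g)); last by ring.
rewrite /csin -I2Z; first congr (- I2 _).
  by apply/funext => z; rewrite /trig; ring.
move=> z; apply: cvgM; first exact: smoothp_continuous.
by apply: continuous_comp; [exact: ph_continuous|exact: continuous_sin].
Qed.

Lemma csin_partial n g b : smoothp g -> csin n (partial b g) = - kap n b * ccos n g.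
Proof.
move=> sg.
have cpg : continuous (partial b g) := smoothp_continuous _ (smoothp_partial b g sg).
have := I2_trig_partial n g b 0 1 (smoothp_continuous _ sg) cpg.
move=> /(_ (fun z => smoothp_derivable g b z sg) (sg.2 b)) h.
rewrite /csin (I2_eq _ (fun z => partial b g z * trig n 0 1 z)); last first.
  by move=> z; rewrite /trig mul1r mul0r add0r.
rewrite h mulNr /ccos -I2Z; first congr (- I2 _).
  by apply/funext => z; rewrite /trig; ring.
move=> z; apply: cvgM; first exact: smoothp_continuous.
by apply: continuous_comp; [exact: ph_continuous|exact: continuous_cos].
Qed.

(** A derivative swaps the two terms up to sign and the factor [kap n b], so this norm makes
    [fabs_foldr] an equality. *)
Definition fabs n g : R := `|ccos n g| + `|csin n g|.

Lemma fabs_foldr n g w : smoothp g ->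
  fabs n (foldr partial g w) = \prod_(b <- w) `|kap n b| * fabs n g.
Proof.
move=> sg; have : smoothp (foldr partial g w) /\
    fabs n (foldr partial g w) = \prod_(b <- w) `|kap n b| * fabs n g; last by case.
elim: w => [|b w [sw IH]]; first by rewrite big_nil mul1r.
split; first exact: smoothp_partial.
rewrite big_cons -mulrA -IH /= /fabs ccos_partial // csin_partial //.
by rewrite mulNr normrN !normrM addrC mulrDr.
Qed.

Lemma fabs_bound g : smoothp g -> exists2 B, 0 < B & forall n, fabs n g <= B.
Proof.
move=> sg; have [B B0 hB] := sq_bounded _ (smoothp_continuous _ sg).
exists (B + B) => [|n]; first by rewrite addr_gt0.
apply: lerD; apply: I2_le.
- move=> z; apply: cvgM; first exact: smoothp_continuous.
  by apply: continuous_comp; [exact: ph_continuous|exact: continuous_cos].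
- move=> z sz; rewrite normrM -[leRHS]mulr1 ler_pM ?hB //.
  by rewrite ler_norml cos_geN1 cos_le1.
- move=> z; apply: cvgM; first exact: smoothp_continuous.
  by apply: continuous_comp; [exact: ph_continuous|exact: continuous_sin].
- move=> z sz; rewrite normrM -[leRHS]mulr1 ler_pM ?hB //.
  by rewrite ler_norml sin_geN1 sin_le1.
Qed.

(** Three derivatives per direction: one power of each |n_i| will pay for [weight], two for
    summability through [invsq]. The four words of derivatives match the four terms of the expanded
    product. *)
Lemma fabs_decay g : smoothp g -> exists2 K, 0 < K & forall n,
  (1 + `|n.1%:~R| ^+ 3) * (1 + `|n.2%:~R| ^+ 3) * fabs n g <= K.
Proof.
move=> sg.
have sgw w : smoothp (foldr partial g w) by elim: w => //= b w; exact: smoothp_partial.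
have [B0 B00 h0] := fabs_bound _ sg.
have [B1 B10 h1] := fabs_bound _ (sgw (nseq 3 false)).
have [B2 B20 h2] := fabs_bound _ (sgw (nseq 3 true)).
have [B3 B30 h3] := fabs_bound _ (sgw (nseq 3 false ++ nseq 3 true)).
exists (B0 + B1 + B2 + B3) => [|n]; first by rewrite !addr_gt0.
have kge b : `|(if b then n.2 else n.1)%:~R| <= `|kap n b|.
  rewrite /kap normrM -[leLHS]mul1r ler_wpM2r // ger0_norm ?mulr_ge0 ?pi_ge0 //.
  by have := pi_ge2 R; lra.
have F0 : 0 <= fabs n g by rewrite addr_ge0.
have e1 : `|n.1%:~R| ^+ 3 * fabs n g <= B1.
  apply: le_trans (h1 n); rewrite fabs_foldr // ler_wpM2r //.
  by rewrite big_nseq -Monoid.iteropE /= !ler_pM // ?mulr_ge0 // (kge false).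
have e2 : `|n.2%:~R| ^+ 3 * fabs n g <= B2.
  apply: le_trans (h2 n); rewrite fabs_foldr // ler_wpM2r //.
  by rewrite big_nseq -Monoid.iteropE /= !ler_pM // ?mulr_ge0 // (kge true).
have e3 : `|n.1%:~R| ^+ 3 * `|n.2%:~R| ^+ 3 * fabs n g <= B3.
  apply: le_trans (h3 n); rewrite fabs_foldr // ler_wpM2r //.
  rewrite big_cat !big_nseq -!Monoid.iteropE /=.
  by rewrite !ler_pM // ?mulr_ge0 // ?(kge true) // (kge false).
rewrite [leLHS](_ : _ = fabs n g + `|n.1%:~R| ^+ 3 * fabs n g
    + `|n.2%:~R| ^+ 3 * fabs n g + `|n.1%:~R| ^+ 3 * `|n.2%:~R| ^+ 3 * fabs n g).
  by rewrite !lerD.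
by ring.
Qed.

Lemma expiD (s t : R) : expi (s + t) = expi s * expi t.
Proof. by rewrite /expi cosD sinD; simpc; congr (_ +i* _); ring. Qed.

Lemma e1D (s t : R) : e1 (s + t) = e1 s * e1 t.
Proof. by rewrite /e1 mulrDr expiD. Qed.

Lemma e10 : e1 (0 : R) = 1.
Proof. by rewrite /e1 /expi mulr0 cos0 sin0. Qed.

Lemma fourier_real (f0 : R * R -> R) n : continuous f0 ->
  fourier (fun z => (f0 z)%:C) n = ccos n f0 +i* - csin n f0.
Proof.
move=> cf; rewrite /fourier /torus_int; congr (_ +i* _).
  apply: eq_Rintegral => z _; rewrite /e1 /expi /=.
  by rewrite mul0r subr0 mulrN cosN.
rewrite /csin /I2 -mulN1r -RintegralZl; last 2 first.
- exact: measurable_sq.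
- apply: sq_integrable => z; apply: cvgM; first exact: cf.
  by apply: continuous_comp; [exact: ph_continuous|exact: continuous_sin].
apply: eq_Rintegral => z _; rewrite /e1 /expi /=.
by rewrite mul0r addr0 mulrN sinN mulrN mulN1r.
Qed.

Definition echar n (z : R * R) : R[i] := e1 (n.1%:~R * z.1 + n.2%:~R * z.2).

(** Exponentials are thus admissible observables, and they isolate a single operator [T_op n] in the
    intertwining relation. *)
Lemma smooth_torus_echar n : smooth_torus (echar n).
Proof.
have pe b z : echar n (z + dir b) = echar n z.
  rewrite /echar /e1 /expi -!/(ph n _) ph_periodic.
  by have [-> ->] := trig2piZ (ph n z) (if b then n.2 else n.1).
split.
- move=> z; rewrite -[RHS](pe false z); congr echar.
  by case: z => x y; rewrite /dir /=; congr pair; rewrite addr0.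
- move=> z; rewrite -[RHS](pe true z); congr echar.
  by case: z => x y; rewrite /dir /=; congr pair; rewrite addr0.
- have -> : (fun x => complex.Re (echar n x)) = trig n 1 0.
    by apply/funext => z; rewrite /trig mul1r mul0r addr0.
  exact: smooth_trig.
- have -> : (fun x => complex.Im (echar n x)) = trig n 0 1.
    by apply/funext => z; rewrite /trig mul1r mul0r add0r.
  exact: smooth_trig.
Qed.

(** Integration by parts against the constant 1: its derivative is 0, while [kap n b] is nonzero for
    some [b]. *)
Lemma I2_trig n : n != 0 -> I2 (fun z => cos (ph n z)) = 0 /\ I2 (fun z => sin (ph n z)) = 0.
Proof.
move=> n0.
have [b kb] : exists b, kap n b != 0.
  have pi0 : 2 * pi != 0 :> R by rewrite mulf_neq0 // gt_eqF // pi_gt0.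
  case: n n0 => n1 n2; case: (eqVneq n1 0) => [->|n10 _]; last first.
    by exists false; rewrite /kap /= mulf_neq0 // intr_eq0.
  case: (eqVneq n2 0) => [->|n20 _]; first by rewrite eqxx.
  by exists true; rewrite /kap /= mulf_neq0 // intr_eq0.
have s1 : smoothp (fun=> 1 : R).
  have -> : (fun=> 1 : R) = trig 0 1 0.
    by apply/funext => z; rewrite /trig ph0 cos0 mulr1 mul0r addr0.
  by split; [exact: smooth_trig|move=> *; rewrite trig_periodic].
have p0 : partial b (fun=> 1 : R) = (fun=> 0).
  by apply/funext => z; rewrite /partial derive_cst.
have := ccos_partial n _ b s1; have := csin_partial n _ b s1; rewrite p0.
rewrite /ccos /csin.
have z0 (t : R * R -> R) : I2 (fun z => 0 * t z) = 0.
  by rewrite (I2_eq _ (fun=> 0)) ?I2_cst // => z; rewrite mul0r.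
rewrite !z0 => /esym/eqP; rewrite mulf_eq0 oppr_eq0 (negPf kb) /= => /eqP hc.
move=> /esym/eqP; rewrite mulf_eq0 (negPf kb) /= => /eqP hs.
by split; [rewrite -[RHS]hc|rewrite -[RHS]hs]; apply: I2_eq => z; rewrite mul1r.
Qed.

Lemma fourier_echar n m : fourier (echar n) m = (n == m)%:R.
Proof.
pose k : int * int := n - m.
transitivity (torus_int (echar k)).
  rewrite /fourier; congr torus_int; apply/funext => z.
  rewrite /echar -e1D; congr e1; rewrite /k /= !rmorphB /=; ring.
rewrite /torus_int -/(I2 (fun z => cos (ph k z))) -/(I2 (fun z => sin (ph k z))).
rewrite -subr_eq0 -/k; case: eqP => [->|/eqP k0]; last by have [-> ->] := I2_trig k k0.
rewrite (I2_eq _ (fun=> 1)) ?I2_cst; last by move=> z; rewrite ph0 cos0.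
by rewrite (I2_eq _ (fun=> 0)) ?I2_cst // => z; rewrite ph0 sin0.
Qed.

End SquareIntegral.

(** * Translation operators and Hecke operators *)

Section AdditiveCharacter.
Context {R : realType}.
Local Notation C := R[i].

Lemma e1_int (m : int) : e1 (m%:~R : R) = 1 :> C.
Proof.
by rewrite /e1 /expi -[2 * pi * _]add0r; have [-> ->] := trig2piZ (0 : R) m; rewrite cos0 sin0.
Qed.

Lemma e1_conj (s : R) : ((e1 s : C)^*)%R = e1 (- s).
Proof. by rewrite /e1 /expi mulrN cosN sinN. Qed.

Lemma e1_unit (s : R) : e1 s * e1 (- s) = 1 :> C.
Proof. by rewrite -e1D subrr e10. Qed.

Lemma e1_half_int (m : int) : e1 (m%:~R / 2 : R) = (-1) ^ m :> C.
Proof.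
have e2 : e1 (2^-1 : R) = -1 :> C.
  by rewrite /e1 /expi mulrAC mulfV // mul1r cospi sinpi; apply/eqP; rewrite eq_complex /= oppr0 !eqxx.
have nat_case (j : nat) : e1 (j%:R / 2 : R) = (-1) ^+ j :> C.
  elim: j => [|j IH]; first by rewrite mul0r e10.
  by rewrite -natr1 mulrDl mul1r e1D IH e2 exprSr.
case: (intP m) => [|j|j]; first by rewrite mul0r e10.
  exact: nat_case.
rewrite rmorphN /= mulNr -exprnN -nat_case.
apply: (mulfI (x := e1 (j.+1%:R / 2 : R))).
  by rewrite nat_case signr_eq0.
rewrite e1_unit mulfV // nat_case signr_eq0 //.
Qed.

Variable N : nat.
Hypothesis N_gt1 : (1 < N)%N.
Local Notation Z := 'Z_N.

Definition eN (x : Z) : C := e1 ((x : nat)%:R / N%:R).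

Let N_neq0 : N%:R != 0 :> R.
Proof. by rewrite pnatr_eq0 -lt0n ltnW. Qed.

Lemma eN_nat (m : nat) : e1 (m%:R / N%:R : R) = eN m%:R :> C.
Proof.
rewrite /eN val_Zp_nat // {1}(divn_eq m N) natrD natrM mulrDl mulfK // e1D.
by rewrite -[(m %/ N)%:R]/((m %/ N)%:Z%:~R) e1_int mul1r.
Qed.

Lemma eND (x y : Z) : eN (x + y) = eN x * eN y.
Proof.
by rewrite -[x in LHS]natr_Zp -[y in LHS]natr_Zp -natrD -eN_nat natrD mulrDl e1D.
Qed.

Lemma eN0 : eN 0 = 1.
Proof. by rewrite /eN /= mul0r e10. Qed.

Lemma eNN (x : Z) : eN (- x) = ((eN x)^*)%R.
Proof.
rewrite /eN e1_conj.
have u : (eN x : C) != 0.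
  by apply: contraTneq (oner_neq0 C) => h; rewrite -eN0 -(subrr x) eND h mul0r eqxx.
by apply: (mulfI u); rewrite -eND subrr eN0 /eN e1_unit.
Qed.

Lemma eN_norm (x : Z) : `|eN x| = 1.
Proof.
apply/eqP; rewrite -(@pexpr_eq1 _ _ 2) // normCK -eNN -eND subrr eN0.
by [].
Qed.

Lemma eN_int (z : int) : e1 (z%:~R / N%:R : R) = eN z%:~R :> C.
Proof.
case: (intP z) => [|j|j]; first by rewrite mul0r e10 eN0.
  exact: eN_nat.
rewrite !rmorphN /= mulNr eNN -e1_conj; congr (_^*)%R.
exact: eN_nat.
Qed.

Lemma eN_eq1 (x : Z) : eN x = 1 -> x = 0.
Proof.
move=> h; apply/eqP; apply: contraT => x0.
have x_gt0 : (0 < x)%N by rewrite lt0n; apply: contraNneq x0 => e; apply/eqP/val_inj.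
have xlt : (nat_of_ord x < N)%N by rewrite -[X in (_ < X)%N](Zp_cast N_gt1).
move: h; rewrite /eN /e1 /expi => /(congr1 (@complex.Re R)) /=.
set y : R := _ / _.
have y0 : 0 < y by rewrite divr_gt0 ?ltr0n // ltnW.
have y1 : y < 1 by rewrite ltr_pdivrMr ?mul1r ?ltr_nat ?ltr0n // ltnW.
(* With theta = pi y strictly between 0 and pi, cos(2 theta) = 1 would force sin theta = 0. *)
have -> : 2 * pi * y = (pi * y) *+ 2 by rewrite mulr2n; ring.
rewrite cos_mulr2n => hc.
have s0 : 0 < sin (pi * y).
  by apply: sin_gt0_pi; rewrite mulr_gt0 ?pi_gt0 //= -[ltRHS]mulr1 ltr_pM2l ?pi_gt0.
have := cos2Dsin2 (pi * y) => hcs.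
have : sin (pi * y) ^+ 2 = 0 by lra.
by move=> /eqP; rewrite expf_eq0 /= => /eqP s00; rewrite s00 ltxx in s0.
Qed.

Lemma sum_eN (a : Z) : \sum_(x : Z) eN (a * x) = N%:R * (a == 0)%:R.
Proof.
case: eqP => [->|/eqP a0].
  rewrite mulr1 (eq_bigr (fun=> 1)); last by move=> x _; rewrite mul0r eN0.
  by rewrite sumr_const card_ord Zp_cast.
rewrite mulr0; set S := \sum_x _.
have : S = eN a * S.
  rewrite {1}/S (reindex_inj (addrI 1)) /= /S mulr_sumr; apply: eq_bigr => x _.
  by rewrite mulrDr mulr1 eND.
move=> /eqP; rewrite -{1}[S]mul1r -subr_eq0 -mulrBl mulf_eq0 subr_eq0 eq_sym.
by case/orP => [/eqP/eN_eq1 h|/eqP //]; rewrite h eqxx in a0.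
Qed.

End AdditiveCharacter.

(** * Weyl operators on residues and their matrices in an orthonormal basis *)

Section Weyl.
Context {R : realType} {N : nat}.
Hypothesis N_gt1 : (1 < N)%N.
Hypothesis oN : odd N.
Local Notation C := R[i].
Local Notation Z := 'Z_N.
Local Notation eN := (@eN R N).
Implicit Types (phi chi : state R N) (v w : Z * Z) (n : int * int).

Definition half : Z := (uphalf N)%:R.

Lemma half_half : half + half = 1.
Proof.
rewrite /half -natrD addnn; have -> : ((uphalf N).*2 = N + 1)%N.
  by have := odd_double_half N; rewrite uphalf_half oN; lia.
by rewrite natrD char_Zp // add0r.
Qed.

(** The phase exp(i pi n1 n2 / N) does not depend on n mod N only. Replacing 1/2 by the inverse of 2
    mod N makes it a function of residues, at the cost of the sign (-1)^(n1 n2) in [T_opE]. *)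
Definition Tmod v phi : state R N :=
  [ffun x => eN (half * v.1 * v.2 + v.2 * x) * (phi (x + v.1) : C)].

Definition red n : Z * Z := (n.1%:~R, n.2%:~R).

Lemma T_opE n phi : T_op n phi = ((-1) ^ (n.1 * n.2) : C) *: Tmod (red n) phi.
Proof.
apply/ffunP => x; rewrite !ffunE /= -[_ *: _]/(_ * _) !mulrA; congr (_ * _).
rewrite eND // mulrA; congr (_ * _); last first.
  have -> : n.2%:~R * x = (n.2 * (x : nat)%:Z)%:~R.
    by rewrite rmorphM /= -[(x : nat)%:Z%:~R]/((x : nat)%:R) natr_Zp.
  by rewrite -eN_int // rmorphM.
set k := n.1 * n.2.
have -> : half * n.1%:~R * n.2%:~R = ((uphalf N)%:Z * k)%:~R.
  by rewrite !rmorphM /= mulrA.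
rewrite -eN_int // -e1_half_int -e1D.
have N0 : N%:R != 0 :> R by rewrite pnatr_eq0 -lt0n ltnW.
have u : (uphalf N)%:R = (N%:R + 1) / 2 :> R.
  apply: (mulIf (x := 2)) => //; rewrite divfK // mulr_natr -mulrnA muln2.
  rewrite natr1; congr _%:R.
  by have := odd_double_half N; rewrite uphalf_half oN; lia.
have -> : k%:~R / 2 + ((uphalf N)%:Z * k)%:~R / N%:R = k%:~R + k%:~R / 2 / N%:R :> R.
  have uz : (uphalf N)%:Z%:~R = (N%:R + 1) / 2 :> R by exact: u.
  by rewrite intrM uz; field.
by rewrite e1D e1_int mul1r /e1; congr expi; field.
Qed.

Lemma TmodZ v (k : C) phi : Tmod v (k *: phi) = k *: Tmod v phi.
Proof.
by apply/ffunP => x; rewrite !ffunE -![_ *: _]/(_ * _) mulrCA.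
Qed.

Lemma Tmod_sum v (I : Type) (r : seq I) (F : I -> state R N) :
  Tmod v (\sum_(i <- r) F i) = \sum_(i <- r) Tmod v (F i).
Proof.
apply/ffunP => x; rewrite !ffunE !sum_ffunE mulr_sumr.
by apply: eq_bigr => i _; rewrite !ffunE.
Qed.

Definition wcc v w : C := eN (half * (v.1 * w.2 - w.1 * v.2)).

Lemma Tmod_comp v w phi : Tmod v (Tmod w phi) = wcc v w *: Tmod (v + w) phi.
Proof.
apply/ffunP => x; rewrite !ffunE -[_ *: _]/(_ * _) /wcc /= !mulrA -!eND // addrA.
congr (eN _ * _); last by rewrite addrA.
apply: (lincomb1 _ _ _ (v.1 * w.2) _ _ (esym half_half)); ring.
Qed.

Lemma wcc_norm v w : `|wcc v w| = 1.
Proof. exact: eN_norm. Qed.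

Lemma wccN v : wcc v (- v) = 1.
Proof. by rewrite /wcc /= -[RHS](eN0 N); congr eN; ring. Qed.

Lemma Tmod0 phi : Tmod 0 phi = phi.
Proof.
apply/ffunP => x; rewrite !ffunE /= addr0 !mulr0 mul0r addr0 eN0 mul1r //.
Qed.

Lemma innerZl (k : C) phi chi : inner (k *: phi) chi = k * inner phi chi.
Proof.
rewrite /inner [RHS]mulrCA [in RHS]mulr_sumr; congr (_ * _); apply: eq_bigr => x _.
by rewrite !ffunE -[_ *: _]/(_ * _) mulrA.
Qed.

Lemma innerZr (k : C) phi chi : inner phi (k *: chi) = (k^*)%R * inner phi chi.
Proof.
rewrite /inner [RHS]mulrCA [in RHS]mulr_sumr; congr (_ * _); apply: eq_bigr => x _.
by rewrite !ffunE -[_ *: _]/(_ * _) rmorphM mulrCA.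
Qed.

Lemma inner_suml (I : Type) (r : seq I) (F : I -> state R N) chi :
  inner (\sum_(i <- r) F i) chi = \sum_(i <- r) inner (F i) chi.
Proof.
rewrite /inner -mulr_sumr exchange_big; congr (_ * _); apply: eq_bigr => x _ /=.
by rewrite sum_ffunE mulr_suml.
Qed.

Lemma Tmod_adj v phi chi : ((inner (Tmod v phi) chi)^*)%R = inner (Tmod (- v) chi) phi.
Proof.
rewrite /inner rmorphM /= fmorphV /= rmorph_nat; congr (_ * _).
rewrite rmorph_sum /= [RHS](reindex_inj (addIr v.1)) /=; apply: eq_bigr => x _.
rewrite !ffunE /= !rmorphM /= conjCK -eNN // addrK.
rewrite [_ * chi x]mulrC mulrCA -!mulrA; congr (_ * _).
congr eN.
apply: (lincomb1 _ _ _ (- (v.1 * v.2)) _ _ half_half); ring.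
Qed.

Variable psi : 'I_N -> state R N.
Hypothesis psi_orth : forall j k, inner (psi j) (psi k) = (j == k)%:R.

Let NC0 : N%:R != 0 :> C.
Proof. by rewrite pnatr_eq0 -lt0n ltnW. Qed.

Lemma psi_complete (x y : Z) :
  \sum_j (psi j x : C) * ((psi j y : C)^*)%R = N%:R * (x == y)%:R.
Proof.
apply: (orthogonal_rows_cols C _ _ (fun j x => psi j x : C)) => //.
  by rewrite !card_ord Zp_cast.
move=> j k; have := psi_orth j k; rewrite /inner => <-.
by rewrite mulrA mulfV // mul1r.
Qed.

Lemma psi_expand phi : phi = \sum_j inner phi (psi j) *: psi j.
Proof.
apply/ffunP => x; rewrite sum_ffunE.
under eq_bigr do rewrite ffunE -[_ *: _]/(_ * _) /inner -mulrA mulr_suml.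
rewrite -mulr_sumr exchange_big /=.
under eq_bigr => y _.
  under eq_bigr do rewrite -mulrA [_ * psi _ x]mulrC.
  rewrite -mulr_sumr psi_complete; over.
rewrite (bigD1 x) //= eqxx big1 => [|y yx]; last by rewrite eq_sym (negPf yx) !mulr0.
by rewrite addr0 mulr1 mulrC mulfK.
Qed.

Definition wM v : 'M[C]_N := \matrix_(j, k) inner (Tmod v (psi k)) (psi j).

Lemma wM_mul v w : wM v *m wM w = wcc v w *: wM (v + w).
Proof.
apply/matrixP => j k; rewrite !mxE -innerZl -Tmod_comp.
rewrite [Tmod w (psi k) in RHS]psi_expand Tmod_sum inner_suml.
by apply: eq_bigr => l _; rewrite !mxE TmodZ innerZl mulrC.
Qed.

Lemma wM_adj v j k : ((wM v j k)^*)%R = wM (- v) k j.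
Proof. by rewrite !mxE Tmod_adj. Qed.

Lemma wM_tr v : \tr (wM v) = N%:R * (v == 0)%:R.
Proof.
rewrite /mxtrace; under eq_bigr do rewrite mxE /inner.
rewrite -mulr_sumr exchange_big /=.
under eq_bigr => x _.
  under eq_bigr do rewrite ffunE -mulrA.
  rewrite -mulr_sumr psi_complete; over.
have e1' (x : Z) : (x + v.1 == x) = (v.1 == 0) by rewrite -{2}[x]addr0 (inj_eq (addrI x)).
under eq_bigr do rewrite e1'.
rewrite -mulr_suml [_ * (N%:R * _)]mulrCA mulKf //.
case: v e1' => v1 v2 _ /=; case: (eqVneq v1 0) => [->|v10]; last first.
  by rewrite !mulr0 xpair_eqE (negPf v10) mulr0.
rewrite xpair_eqE eqxx /= mulr1 -sum_eN //.
by apply: eq_bigr => x _; rewrite mulr0 mul0r add0r.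
Qed.

End Weyl.

Lemma det_mx22 (K : comNzRingType) (B : 'M[K]_2) :
  \det B = B 0 0 * B 1 1 - B 0 1 * B 1 0.
Proof.
have l0 : lift ord0 ord0 = 1 :> 'I_2 by apply: val_inj.
have l1 : lift 1 ord0 = 0 :> 'I_2 by apply: val_inj.
rewrite (expand_det_row _ ord0) !big_ord_recl big_ord0 addr0 /cofactor.
rewrite !det_mx11 !mxE /= !l0 !l1 /bump /= addn0 expr0 add0n expr1.
by rewrite mul1r mulN1r mulrN.
Qed.

Lemma tr_mx22 (K : pzRingType) (B : 'M[K]_2) : \tr B = B 0 0 + B 1 1.
Proof.
have l0 : lift ord0 ord0 = 1 :> 'I_2 by apply: val_inj.
by rewrite /mxtrace !big_ord_recl big_ord0 addr0 l0.
Qed.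

Lemma sign_parity (K : fieldType) (k l : int) : odd `|k| = odd `|l| ->
  (-1) ^ k = (-1) ^ l :> K.
Proof.
have h (m : int) : (-1) ^ m = (-1) ^+ odd `|m| :> K.
  case: m => m /=; first by rewrite signr_odd.
  by rewrite NegzE -exprnN invr_sign -signr_odd /=.
by rewrite !h => ->.
Qed.

(** * From norm one elements mod N to Hecke operators mod 2N *)

Section HeckeAction.
Context {R : realType} {N : nat}.
Hypothesis pN : prime N.
Hypothesis oN : odd N.
Local Notation C := R[i].
Local Notation Z := 'Z_N.
Variable A : 'M[int]_2.
Hypothesis detA : \det A = 1.

Let N_gt1 : (1 < N)%N := prime_gt1 pN.
Let a : Z := (A 0 0)%:~R.
Let b : Z := (A 0 1)%:~R.
Let c : Z := (A 1 0)%:~R.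
Let d : Z := (A 1 1)%:~R.
Let t : Z := (\tr A)%:~R.

Lemma Zp_neq0_unit (x : Z) : x != 0 -> x \is a GRing.unit.
Proof.
move=> x0; rewrite -[x]natr_Zp unitZpE // prime_coprime //.
apply: contraNN x0 => xN.
have xlt : (nat_of_ord x < N)%N by rewrite -[X in (_ < X)%N](Zp_cast N_gt1).
case: (posnP x) => [x0|x0]; first by rewrite -[x]natr_Zp x0.
by have := dvdn_leq x0 xN; rewrite leqNgt xlt.
Qed.

Lemma Zp_two_neq0 : (2 : Z) != 0.
Proof.
by apply/eqP => /(congr1 (fun x => half * x)); rewrite mulr0 mulr2n mulrDr mulr1 half_half.
Qed.

Lemma t_ad : t = a + d.
Proof. by rewrite /t tr_mx22 rmorphD. Qed.

Lemma bc_det : b * c = a * d - 1.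
Proof.
rewrite /a /b /c /d -!rmorphM /= -[X in _ - X]/(1%:~R) -rmorphB /=; congr (_%:~R).
by rewrite -detA det_mx22; ring.
Qed.

Lemma Zp_int_eq0 (M : nat) (z : int) : (1 < M)%N -> (z%:~R == 0 :> 'Z_M) = (M %| `|z|)%N.
Proof.
move=> M1.
have nat_case (m : nat) : (m%:R == 0 :> 'Z_M) = (M %| m)%N.
  rewrite /dvdn; apply/eqP/eqP => [/(congr1 val)|e].
    by rewrite /= val_Zp_nat.
  by apply: val_inj; rewrite /= val_Zp_nat.
case: (intP z) => [|j|j]; first by rewrite eqxx dvdn0.
  exact: nat_case.
by rewrite rmorphN oppr_eq0 abszN; exact: nat_case.
Qed.

Lemma odd_Zp2N_int (z : int) : odd ((z%:~R : 'Z_(2 * N)) : nat) = odd `|z|.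
Proof.
have M1 : (1 < 2 * N)%N by lia.
set x : 'Z_(2 * N) := z%:~R.
have : ((x : nat)%:Z - z)%:~R == 0 :> 'Z_(2 * N).
  by rewrite rmorphB /= -[(x : nat)%:Z%:~R]/((x : nat)%:R) natr_Zp subrr.
rewrite Zp_int_eq0 // => h.
have : (2 %| `|(x : nat)%:Z - z|)%N by apply: dvdn_trans h; exact: dvdn_mulr.
by lia.
Qed.

(** Chinese remaindering by hand: N being odd, adding N where necessary makes the first coordinate
    odd and the second even. The lift is then 1 modulo 2, so it preserves the parity of n1 n2; hence
    the signs of [T_opE] will cancel. *)
Lemma hecke_lift (g : Z * Z) : g \in normG Z t -> exists beta : 'Z_(2 * N) * 'Z_(2 * N),
  exists B' : 'M[int]_2,
  [/\ C2N A beta, SL2_2N (iota_mx A beta), redmx (2 * N) B' = iota_mx A beta,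
      forall n : int * int, red (n.1 * B' 0 0 + n.2 * B' 1 0, n.1 * B' 0 1 + n.2 * B' 1 1)
        = actO Z a b c d g (red n) :> Z * Z &
      forall n : int * int,
        (-1) ^ ((n.1 * B' 0 0 + n.2 * B' 1 0) * (n.1 * B' 0 1 + n.2 * B' 1 1))
        = (-1) ^ (n.1 * n.2) :> C].
Proof.
have M1 : (1 < 2 * N)%N by lia.
rewrite in_normG => /eqP ng.
pose x' : nat := (g.1 + N * ~~ odd g.1)%N; pose y' : nat := (g.2 + N * odd g.2)%N.
have glt (x : Z) : (nat_of_ord x < N)%N by rewrite -[X in (_ < X)%N](Zp_cast N_gt1).
have ox : odd x' by rewrite /x' oddD oddM oN /= ; case: (odd g.1).
have oy : ~~ odd y' by rewrite /y' oddD oddM oN /= ; case: (odd g.2).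
have xlt : (x' < 2 * N)%N.
  by rewrite /x'; have := glt g.1; case: (~~ odd g.1); rewrite ?muln1 ?muln0; lia.
have ylt : (y' < 2 * N)%N.
  by rewrite /y'; have := glt g.2; case: (odd g.2); rewrite ?muln1 ?muln0; lia.
have xr : x'%:R = g.1 :> Z by rewrite /x' natrD natrM char_Zp // mul0r addr0 natr_Zp.
have yr : y'%:R = g.2 :> Z by rewrite /y' natrD natrM char_Zp // mul0r addr0 natr_Zp.
clearbody x' y'.
have [x2 xE] : exists x2, x' = (x2 * 2 + 1)%N by exists x'./2; lia.
have [y2 yE] : exists y2, y' = (y2 * 2)%N by exists y'./2; lia.
pose T : int := \tr A.
have nint : ((x'%:Z * x'%:Z + T * x'%:Z * y'%:Z + y'%:Z * y'%:Z)%:~R : 'Z_(2 * N)) = 1.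
  apply/eqP; rewrite -subr_eq0 -[1]/(1%:~R) -rmorphB /= Zp_int_eq0 //.
  (* Norm 1 is checked modulo 2, from the parities, and modulo N, from [g]. *)
  rewrite Gauss_dvd; last by rewrite coprime2n.
  apply/andP; split.
    rewrite xE yE !PoszD !PoszM.
    have -> : (x2%:Z * 2%:Z + 1%:Z) * (x2%:Z * 2%:Z + 1%:Z)
       + T * (x2%:Z * 2%:Z + 1%:Z) * (y2%:Z * 2%:Z)
       + (y2%:Z * 2%:Z) * (y2%:Z * 2%:Z) - 1 =
       2 * (2 * x2%:Z ^+ 2 + 2 * x2%:Z + T * (x2%:Z * 2%:Z + 1%:Z) * y2%:Z + 2 * y2%:Z ^+ 2).
      by ring.
    by rewrite abszM dvdn_mulr.
  rewrite -Zp_int_eq0 // rmorphB subr_eq0 /= !rmorphD /= !rmorphM /=.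
  rewrite -[x'%:Z%:~R]/(x'%:R) -[y'%:Z%:~R]/(y'%:R) xr yr; apply/eqP.
  by rewrite -!expr2; exact: ng.
pose B' : 'M[int]_2 := x'%:Z%:M + y'%:Z *: A^T.
pose beta : 'Z_(2 * N) * 'Z_(2 * N) := (x'%:R, y'%:R).
have vb1 : (x'%:R : 'Z_(2 * N)) = x' :> nat by rewrite val_Zp_nat // modn_small.
have vb2 : (y'%:R : 'Z_(2 * N)) = y' :> nat by rewrite val_Zp_nat // modn_small.
have normb : normO A beta = 1.
  rewrite -[RHS]nint /normO /= !rmorphD /= !rmorphM /= !expr2.
  by rewrite -[x'%:Z%:~R]/(x'%:R) -[y'%:Z%:~R]/(y'%:R).
have rB : redmx (2 * N) B' = iota_mx A beta.
  apply/matrixP => i j; rewrite !mxE /= rmorphD rmorphM /=.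
  by congr (_ + _); case: (i == j).
have BE (i j : 'I_2) : B' i j = x'%:Z *+ (i == j) + y'%:Z * A j i by rewrite !mxE.
have b00 : B' 0 0 = x'%:Z + y'%:Z * A 0 0 by rewrite BE.
have b01 : B' 0 1 = y'%:Z * A 1 0 by rewrite BE /= mulr0n add0r.
have b10 : B' 1 0 = y'%:Z * A 0 1 by rewrite BE /= mulr0n add0r.
have b11 : B' 1 1 = x'%:Z + y'%:Z * A 1 1 by rewrite BE.
exists beta, B'; split => //.
- by split => //=; rewrite ?vb1 ?vb2.
- split.
    rewrite -rB det_mx22 /redmx !mxE -!/(B' _ _) -!rmorphM -rmorphB /= -[RHS]nint; congr (_%:~R).
    have := det_mx22 _ A; rewrite detA => dA.
    rewrite /T tr_mx22 !mulr1n !mulr0n !add0r.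
    apply: (lincomb1 _ _ _ (- (y'%:Z * y'%:Z)) _ _ dA); ring.
  move=> i j; rewrite -rB [redmx _ _ _ _]mxE odd_Zp2N_int BE.
  have -> : y'%:Z * A j i = 2 * (y2%:Z * A j i) by rewrite yE PoszM; ring.
  by rewrite xE; case: (i == j); rewrite ?mulr1n ?mulr0n; lia.
- move=> n; rewrite b00 b01 b10 b11 /red /actO /=.
  rewrite !rmorphD !rmorphM !rmorphD !rmorphM /=.
  by rewrite -[x'%:Z%:~R]/(x'%:R) -[y'%:Z%:~R]/(y'%:R) xr yr /a /b /c /d; congr pair; ring.
- move=> n; apply: sign_parity; rewrite b00 b01 b10 b11 xE yE !PoszD !PoszM.
  set X := x2%:Z; set Y := y2%:Z; set n1 := n.1; set n2 := n.2.
  (* The image of (n1, n2) is (n1 + 2 U, n2 + 2 V). *)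
  pose U := n1 * X + n1 * (Y * A 0 0) + n2 * (Y * A 0 1).
  pose V := n2 * X + n2 * (Y * A 1 1) + n1 * (Y * A 1 0).
  have -> : (n1 * (X * 2%:Z + 1%:Z + Y * 2%:Z * A 0 0) + n2 * (Y * 2%:Z * A 0 1)) *
    (n1 * (Y * 2%:Z * A 1 0) + n2 * (X * 2%:Z + 1%:Z + Y * 2%:Z * A 1 1)) =
    n1 * n2 + 2 * (n1 * V + n2 * U + 2 * U * V) by rewrite /U /V; ring.
  by set q := n1 * V + _; set p := n1 * n2; lia.
Qed.

Variable U : 'M['Z_(2 * N)%N]_2 -> state R N -> state R N.
Hypothesis hU : quantization U.
Variable psi : 'I_N -> state R N.
Hypothesis hpsi : hecke_basis A U psi.

Lemma Op_echar n (phi : state R N) : Op (echar n) phi = T_op n phi.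
Proof.
apply/ffunP => x; rewrite !ffunE (csum_single _ n).
  by rewrite fourier_echar eqxx mul1r ffunE.
by move=> m mn; rewrite fourier_echar eq_sym (negPf mn) mul0r.
Qed.

Lemma echar_comp n (B : 'M[int]_2) : comp_mx (echar n) B =
  echar (n.1 * B 0 0 + n.2 * B 1 0, n.1 * B 0 1 + n.2 * B 1 1) :> (R * R -> C).
Proof.
apply/funext => z; rewrite /comp_mx /echar /=; congr e1.
by rewrite !rmorphD !rmorphM /=; ring.
Qed.

Lemma Tmod_intertwine g : g \in normG Z t -> exists beta : 'Z_(2 * N) * 'Z_(2 * N),
  [/\ C2N A beta, SL2_2N (iota_mx A beta) & forall v phi,
    Tmod v (U (iota_mx A beta) phi) = U (iota_mx A beta) (Tmod (actO Z a b c d g v) phi)].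
Proof.
move=> /hecke_lift[beta [B' [Cb Sb rB acts sgn]]]; exists beta; split => // v phi.
(* An integer frequency representing [v]; its exponential is the observable to be conjugated. *)
pose n : int * int := ((v.1 : nat)%:Z, (v.2 : nat)%:Z).
have nv : red n = v.
  by rewrite [RHS]surjective_pairing /red; congr pair; exact: natr_Zp.
have [hunit hint _] := hU.
have := hint _ B' (echar n) phi Sb rB (smooth_torus_echar n).
rewrite echar_comp !Op_echar !T_opE // acts sgn nv.
have [lU _ _] := hunit _ Sb.
have UZ (k : C) (ch : state R N) : U (iota_mx A beta) (k *: ch) = k *: U (iota_mx A beta) ch.
  have U0 : U (iota_mx A beta) 0 = 0.
    have := lU 1 0 0; rewrite scale1r addr0 scale1r => /eqP.
    by rewrite -subr_eq subrr eq_sym => /eqP.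
  by have := lU k ch 0; rewrite !addr0 U0 addr0.
rewrite UZ; apply: scalerI; apply: expfz_neq0.
by rewrite oppr_eq0 oner_eq0.
Qed.

Let psi_orth : forall j k, inner (psi j) (psi k) = (j == k)%:R.
Proof. by case: hpsi. Qed.

(** Conjugation by the Hecke operator multiplies an entry by the eigenvalue at [k] and the conjugate
    of the one at [j], both of modulus 1 by unitarity. Eigenvalues are chosen for each [g]
    separately; multiplicativity in [g] is recovered by [chiM]. *)
Lemma wM_act : exists chi : Z * Z -> 'I_N -> 'I_N -> C,
  [/\ forall g v j k, g \in normG Z t ->
        wM psi (actO Z a b c d g v) j k = chi g j k * wM psi v j k &
      forall g j, g \in normG Z t -> chi g j j = 1].
Proof.
have hlam (g : Z * Z) : exists lam : 'I_N -> C, g \in normG Z t ->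
    (forall j, `|lam j| = 1) /\ forall v j k,
    wM psi (actO Z a b c d g v) j k = lam k * ((lam j)^*)%R * wM psi v j k.
  case: (boolP (g \in normG Z t)) => [gG|_]; last by exists (fun=> 0).
  have [beta [Cb Sb hT]] := Tmod_intertwine _ gG.
  have [_ _ heig] := hpsi.
  have [lam hl] := choice (fun j => (heig j).2 beta Cb).
  have [hunit _ _] := hU; have [_ _ iU] := hunit _ Sb.
  exists lam => _; split => [j|v j k].
    have := iU (psi j) (psi j); rewrite hl innerZl innerZr psi_orth eqxx mulr1.
    rewrite -normCK => /eqP; rewrite sqrp_eq1 // => /eqP //.
  by rewrite !mxE -iU -hT !hl TmodZ innerZl innerZr mulrA.
have [lam hl] := choice hlam.
exists (fun g j k => lam g k * ((lam g j)^*)%R); split => [g v j k gG|g j gG].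
- by have [_ ->] := hl g gG.
- by have [h _] := hl g gG; rewrite -normCK h expr1n.
Qed.

Hypothesis disc_neq0 : t ^+ 2 - 4 != 0.

Lemma hecke_card : (N <= #|normG Z t|.+1)%N /\ (#|normG Z t| <= N.+1)%N.
Proof.
have cZ : #|Z| = N by rewrite card_ord Zp_cast.
have [chi [h1 h3]] := wM_act.
split; first by rewrite -{1}cZ; apply: card_normG_ge; [exact: Zp_neq0_unit|exact: Zp_two_neq0].
apply: (card_normG_le C Z Zp_neq0_unit a b c d t Zp_two_neq0 disc_neq0 t_ad bc_det N cZ
  (wM psi) wcc chi) => //.
- by move=> *; exact: wccN.
- by move=> *; exact: wM_mul.
- by move=> *; exact: wM_adj.
- by move=> *; exact: wM_tr.
Qed.

Lemma hecke_diag_sq v : v != 0 ->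
  \sum_j `|wM psi v j j| ^+ 2 <= N%:R / #|normG Z t|%:R.
Proof.
have cZ : #|Z| = N by rewrite card_ord Zp_cast.
have [chi [h1 h3]] := wM_act.
apply: (diag_sq_le C Z Zp_neq0_unit a b c d t Zp_two_neq0 disc_neq0 t_ad bc_det N cZ
  (wM psi) wcc chi) => //.
- by move=> *; exact: wccN.
- by move=> *; exact: wM_mul.
- by move=> *; exact: wM_adj.
- by move=> *; exact: wM_tr.
Qed.

Lemma hecke_diag_corr v w (e : C) : Qz Z a b c d v != 0 -> Qz Z a b c d w != 0 -> 0 < e ->
  `|\sum_j wM psi v j j * ((wM psi w j j)^*)%R -
     N%:R / #|normG Z t|%:R * (Qz Z a b c d v == Qz Z a b c d w)%:R|
  <= 2 * e + 3 * N%:R / #|normG Z t|%:R ^+ 2 / e.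
Proof.
have cZ : #|Z| = N by rewrite card_ord Zp_cast.
have [chi [h1 h3]] := wM_act.
apply: (diag_corr_le C Z Zp_neq0_unit a b c d t Zp_two_neq0 disc_neq0 t_ad bc_det N cZ
  (wM psi) wcc chi) => //.
- by move=> *; exact: wcc_norm.
- by move=> *; exact: wccN.
- by move=> *; exact: wM_mul.
- by move=> *; exact: wM_adj.
- by move=> *; exact: wM_tr.
Qed.

End HeckeAction.

(** * Haar measure on SU(2) *)

Section MatrixBorel.
Context {R : realType}.

Definition mxborel : measurableType _ := g_sigma_algebraType (@open 'M[R[i]^o]_2).

Lemma measurable_continuous_mx (f : mxborel -> R) :
  continuous (f : 'M[R[i]^o]_2 -> R) -> measurable_fun setT f.
Proof.
move=> cf; apply: (measurability _ (measurable_realfun.RGenOInfty.measurableE R)) => //.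
move=> _ [_ [x ->] <-]; rewrite setTI; apply: sub_sigma_algebra.
by apply: open_comp => // z _; exact: cf.
Qed.

Lemma contractive_continuous (h : R[i]^o -> R) :
  (forall z w, `|h z - h w| <= Normc.normc (z - w)) -> continuous h.
Proof.
move=> hl z B /nbhs_ballP[e /= e0 be]; apply/nbhs_ballP.
(* Balls of [R[i]^o] have their radii in [R[i]]. *)
exists (e%:C) => /=; first by rewrite ltcR.
move=> w zw; apply: be; rewrite /ball /=.
by rewrite (le_lt_trans (hl z w)) // -ltcR.
Qed.

Lemma measurable_Re_entry i j : measurable_fun setT (fun M : mxborel => complex.Re (M i j)).
Proof.
apply: measurable_continuous_mx => M.
apply: (@continuous_comp _ _ _ (fun M : 'M[R[i]^o]_2 => M i j) (@complex.Re R : R[i]^o -> R)).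
  exact: coord_continuous.
by apply: contractive_continuous => z w; rewrite -raddfB; exact: normc_Re.
Qed.

Lemma measurable_Im_entry i j : measurable_fun setT (fun M : mxborel => complex.Im (M i j)).
Proof.
apply: measurable_continuous_mx => M.
apply: (@continuous_comp _ _ _ (fun M : 'M[R[i]^o]_2 => M i j) (@complex.Im R : R[i]^o -> R)).
  exact: coord_continuous.
by apply: contractive_continuous => z w; rewrite -raddfB; exact: normc_Im.
Qed.

Definition retr (M : mxborel) : R := complex.Re (\tr M).

Lemma retrE M : retr M = complex.Re (M 0 0) + complex.Re (M 1 1).
Proof. by rewrite /retr tr_mx22 raddfD. Qed.

Lemma measurable_retr : measurable_fun setT retr.
Proof.
rewrite (_ : retr = (fun M => complex.Re (M 0 0) + complex.Re (M 1 1))); last first.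
  by apply/funext => M; rewrite retrE.
by apply: measurable_funD; exact: measurable_Re_entry.
Qed.

(** Orthogonality to the first row and determinant 1 are two linear equations for the second row;
    the first row has norm 1, which solves them. *)
Lemma SU2P (M : 'M[R[i]]_2) : SU2 M ->
  [/\ M 1 1 = ((M 0 0)^*)%R, M 1 0 = - ((M 0 1)^*)%R &
      complex.Re (M 0 0) ^+ 2 + complex.Im (M 0 0) ^+ 2
      + complex.Re (M 0 1) ^+ 2 + complex.Im (M 0 1) ^+ 2 = 1].
Proof.
move=> [/unitarymxP MU]; rewrite det_mx22 => dM.
have l0 : lift ord0 ord0 = 1 :> 'I_2 by apply: val_inj.
have ent (i j : 'I_2) : M i 0 * ((M j 0)^*)%R + M i 1 * ((M j 1)^*)%R = (i == j)%:R.
  have /matrixP /(_ i j) := MU.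
  by rewrite !mxE !big_ord_recl big_ord0 addr0 !mxE l0.
have := ent 0 0; have := ent 1 0; rewrite /= mulr1n mulr0n => e10 e00.
have d1 : M 1 1 = ((M 0 0)^*)%R.
  transitivity (M 1 1 * (M 0 0 * ((M 0 0)^*)%R + M 0 1 * ((M 0 1)^*)%R)).
    by rewrite e00 mulr1.
  apply: (lincomb2 _ _ _ ((M 0 0)^*)%R (M 0 1) _ _ _ _ dM e10); ring.
have d2 : M 1 0 = - ((M 0 1)^*)%R.
  transitivity (M 1 0 * (M 0 0 * ((M 0 0)^*)%R + M 0 1 * ((M 0 1)^*)%R)).
    by rewrite e00 mulr1.
  apply: (lincomb2 _ _ _ (- ((M 0 1)^*)%R) (M 0 0) _ _ _ _ dM e10); ring.
split => //; move: e00; case: (M 0 0) (M 0 1) => [p q] [r s] /=.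
by move=> /(congr1 (@complex.Re R)) /= <-; ring.
Qed.

Lemma SU2_tr (M : 'M[R[i]]_2) : SU2 M ->
  \tr M = ((retr M)%:C : R[i]) /\ retr M = 2 * complex.Re (M 0 0).
Proof.
move=> /SU2P[h1 _ _]; rewrite /retr tr_mx22 h1; case: (M 0 0) => p q /=.
by split; [apply/eqP; rewrite eq_complex /= subrr !eqxx|ring].
Qed.

Lemma SU2_retr_le (M : 'M[R[i]]_2) : SU2 M -> `|retr M| <= 2.
Proof.
move=> sM; have [_ ->] := SU2_tr _ sM; have [_ _ h] := SU2P _ sM.
rewrite normrM ger0_norm // ler_piMr // -(@ler_sqr _ _ 1) ?nnegrE //.
rewrite real_normK ?num_real // expr1n -h -!addrA lerDl !addr_ge0 // sqr_ge0 //.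
Qed.

Definition mx22 (p q r s : R[i]) : 'M[R[i]]_2 :=
  \matrix_(i, j) (if i == 0 then (if j == 0 then p else q) else (if j == 0 then r else s)).

Lemma SU2_mx22 (p q : R[i]) : p * (p^*)%R + q * (q^*)%R = 1 ->
  SU2 (mx22 p q (- (q^*)%R) (p^*)%R).
Proof.
have l0 : lift ord0 ord0 = 1 :> 'I_2 by apply: val_inj.
move=> h; split; last first.
  by rewrite det_mx22 !mxE /= mulrN opprK.
apply/unitarymxP/matrixP => i j; rewrite !mxE !big_ord_recl big_ord0 addr0 !mxE l0.
have i01 : (i == 0) || (i == 1) by case: i => -[|[|]].
have j01 : (j == 0) || (j == 1) by case: j => -[|[|]].
case/orP: i01 => /eqP ->; case/orP: j01 => /eqP -> //=; rewrite ?conjCK ?rmorphN /= ?conjCK.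
- by rewrite mulrN mulrC addrC subrr.
- by rewrite mulNr mulrC addrC subrr.
- by rewrite mulrNN -h addrC mulrC [X in _ + X]mulrC.
Qed.

End MatrixBorel.

(** * Means of functions of Haar-random matrices *)

Section Haar.
Context {R : realType} {d : measure_display} {Omega : measurableType d}.
Variable P : probability Omega R.
Local Notation mxb := (@mxborel R).

Definition bmeas (f : Omega -> R) := measurable_fun setT f /\ exists c, forall w, `|f w| <= c.

Lemma bmeas_integrable f : bmeas f -> P.-integrable setT (EFin \o f).
Proof.
move=> [mf [c hc]]; apply: measurable_bounded_integrable => //.
  by rewrite [X in (X < _)%E]probability_setT ltry.
exists `|c|; split; first exact: normr_real.
by move=> x /ltW cx w _ /=; rewrite (le_trans (hc w)) // (le_trans (ler_norm _)).
Qed.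

Lemma bmeasD f g : bmeas f -> bmeas g -> bmeas (fun w => f w + g w).
Proof.
move=> [mf [c hc]] [mg [e he]]; split; first exact: measurable_funD.
by exists (c + e) => w; rewrite (le_trans (ler_normD _ _)) // lerD.
Qed.

Lemma bmeasM f g : bmeas f -> bmeas g -> bmeas (fun w => f w * g w).
Proof.
move=> [mf [c hc]] [mg [e he]]; split; first exact: measurable_funM.
by exists (c * e) => w; rewrite normrM ler_pM.
Qed.

Lemma bmeas_cst k : bmeas (fun=> k).
Proof. by split; [exact: measurable_cst|exists `|k|]. Qed.

Lemma bmeas_sum (I : Type) (s : seq I) (f : I -> Omega -> R) :
  (forall i, bmeas (f i)) -> bmeas (fun w => \sum_(i <- s) f i w).
Proof.
move=> hf; elim: s => [|i s IH].
  rewrite (_ : (fun w => _) = fun=> 0); first exact: bmeas_cst.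
  by apply/funext => w; rewrite big_nil.
rewrite (_ : (fun w => _) = fun w => f i w + \sum_(j <- s) f j w); first exact: bmeasD.
by apply/funext => w; rewrite big_cons.
Qed.

Definition mean (f : Omega -> R) : R := \int[P]_w f w.

Lemma meanE f : bmeas f -> (\int[P]_w (f w)%:E = (mean f)%:E)%E.
Proof.
move=> bf; rewrite /mean /Rintegral fineK //.
exact: integrable_fin_num (bmeas_integrable _ bf).
Qed.

Lemma meanD f g : bmeas f -> bmeas g -> mean (fun w => f w + g w) = mean f + mean g.
Proof. by move=> bf bg; rewrite /mean RintegralD //; exact: bmeas_integrable. Qed.

Lemma meanZ k f : bmeas f -> mean (fun w => k * f w) = k * mean f.
Proof. by move=> bf; rewrite /mean RintegralZl //; exact: bmeas_integrable. Qed.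

Lemma mean_cst k : mean (fun=> k) = k.
Proof. by rewrite /mean Rintegral_cst // [X in fine X]probability_setT mulr1. Qed.

Lemma mean_le f e : bmeas f -> (forall w, `|f w| <= e) -> `|mean f| <= e.
Proof.
move=> bf fe; rewrite -[leRHS](mean_cst e); apply: (le_trans (le_normr_Rintegral _ _)) => //.
  exact: bmeas_integrable.
apply: le_Rintegral => //; last exact/bmeas_integrable/bmeas_cst.
apply: (bmeas_integrable (fun w => `|f w|)); case: bf => [mf [c hc]]; split.
  exact: measurableT_comp.
by exists c => w; rewrite normr_id.
Qed.

Lemma mean_sum (I : Type) (s : seq I) (f : I -> Omega -> R) :
  (forall i, bmeas (f i)) -> mean (fun w => \sum_(i <- s) f i w) = \sum_(i <- s) mean (f i).
Proof.
move=> hf; elim: s => [|i s IH].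
  rewrite big_nil -[RHS](mean_cst 0); congr mean; apply/funext => w; rewrite big_nil //.
rewrite big_cons -IH -meanD //; last exact: bmeas_sum.
by congr mean; apply/funext => w; rewrite big_cons.
Qed.

Lemma mean_eq_law (X Y : {RV P >-> R}) (h : R -> R) :
  (forall B, measurable B -> P (X @^-1` B) = P (Y @^-1` B)) ->
  measurable_fun setT h -> bmeas (h \o X) -> bmeas (h \o Y) ->
  mean (h \o X) = mean (h \o Y).
Proof.
move=> XY mh bX bY; apply: EFin_inj; rewrite -!meanE //.
have tr (Z : {RV P >-> R}) : bmeas (h \o Z) ->
    (\int[P]_w ((h \o Z) w)%:E = \int[distribution P Z]_y (h y)%:E)%E.
  move=> bZ; rewrite integral_distribution //; first exact/measurable_EFinP.
  exact: bmeas_integrable.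
by rewrite (tr X bX) (tr Y bY); apply: eq_measure_integral => B mB _; exact: XY.
Qed.

Definition mkRV (f : Omega -> R) (mf : measurable_fun setT f) : {RV P >-> R} :=
  mfun_Sub (mem_set mf).

(** Independence makes the joint law a product measure, and Fubini integrates [Y] out first. [clip]
    fixes all values taken by [X] and [Y] and makes the integrand bounded on the whole plane. *)
Lemma mean_mul_indep (X Y : {RV P >-> R}) (c : R) :
  (forall w, `|X w| <= c) -> (forall w, `|Y w| <= c) ->
  (forall B D, measurable B -> measurable D ->
     P (X @^-1` B `&` Y @^-1` D) = (P (X @^-1` B) * P (Y @^-1` D))%E) ->
  mean Y = 0 -> mean (fun w => X w * Y w) = 0.
Proof.
move=> Xc Yc ind EY.
pose clip (x : R) := Num.max (- c) (Num.min c x).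
have c0 : 0 <= c := le_trans (normr_ge0 _) (Xc point).
have clipE x : `|x| <= c -> clip x = x.
  by rewrite ler_norml /clip => /andP[h1 h2]; rewrite (min_r h2) max_r.
have clip_le x : `|clip x| <= c.
  rewrite /clip ler_norml le_max lexx /= ge_max ge_min lexx /= andbT.
  by rewrite (le_trans _ c0) // oppr_le0.
have mclip : measurable_fun setT clip.
  apply: measurable_maxr; first exact: measurable_cst.
  by apply: measurable_minr; [exact: measurable_cst|exact: measurable_id].
have mZ : measurable_fun setT (fun w => (X w, Y w)).
  by apply: measurable_fun_pair; exact: measurable_funP.
pose Z : {mfun Omega >-> (R * R)%type} := mfun_Sub (mem_set mZ).
pose m1 := distribution P X; pose m2 := distribution P Y.
pose g (z : R * R) : R := clip z.1 * clip z.2.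
have mg : measurable_fun setT g.
  by apply: measurable_funM; apply: measurableT_comp.
have g_le z : `|g z| <= c * c by rewrite normrM ler_pM.
have bXY : bmeas (fun w => X w * Y w).
  by apply: bmeasM; split; [exact: measurable_funP|exists c|exact: measurable_funP|exists c].
apply: EFin_inj; rewrite -meanE //.
transitivity (\int[distribution P Z]_z (g z)%:E)%E.
  rewrite integral_distribution //; last 2 first.
  - exact/measurable_EFinP.
  - apply: (bmeas_integrable (fun w => g (X w, Y w))); split; last by exists (c * c).
    exact: (measurableT_comp mg).
  by apply: eq_integral => w _; rewrite /= /g /= !clipE.
transitivity (\int[(m1 \x m2)%E]_z (g z)%:E)%E.
  apply/esym/eq_measure_integral => S mS _.
  by apply: (product_measure_unique (m' := distribution P Z)) => // B D mB mD; exact: ind.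
rewrite -integral12_prod_meas1; last first.
  apply: measurable_bounded_integrable => //.
    suff : ((m1 \x m2)%E ([set: R] `*` [set: R]) < +oo)%E by rewrite setXTT.
    rewrite product_measure1E //.
    rewrite [X in (X * _)%E](probability_setT (distribution P X)).
    by rewrite [X in (_ * X)%E](probability_setT (distribution P Y)) mule1 ltry.
  exists (c * c); split; first by rewrite ger0_real // mulr_ge0.
  by move=> x /ltW cx z _ /=; rewrite (le_trans (g_le z)).
rewrite integral0_eq // => x _; rewrite /fubini_F /g /=.
under eq_integral do rewrite EFinM.
rewrite integralZl //; last first.
  apply: measurable_bounded_integrable => //.
    by rewrite [X in (X < _)%E]probability_setT ltry.
  exists c; split; first exact: ger0_real.
  by move=> y /ltW cy z _ /=; rewrite (le_trans (clip_le z)).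
rewrite integral_distribution; last 2 first.
- exact/measurable_EFinP.
- apply: (bmeas_integrable (clip \o Y)); split; last by exists c => w /=.
  exact: measurableT_comp.
rewrite (_ : (\int[P]_x0 _)%E = 0%E) ?mule0 //.
transitivity (\int[P]_w (Y w)%:E)%E.
  by apply: eq_integral => w _ /=; rewrite clipE.
rewrite meanE ?EY //; split; [exact: measurable_funP|by exists c].
Qed.

Lemma random_measurable V : random_SU2 V -> measurable_fun setT (V : Omega -> mxb).
Proof. by move=> [_ mV] _ S mS; rewrite setTI; exact: mV. Qed.

Section OneMatrix.
Variable V : Omega -> 'M[R[i]]_2.
Hypothesis hV : haar_SU2 P V.

Let VSU w : SU2 (V w).
Proof. by case: hV => -[]. Qed.

Lemma measurable_comp_V (f : mxb -> R) : measurable_fun setT f ->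
  measurable_fun setT (fun w => f (V w)).
Proof.
move=> mf; apply: (measurableT_comp mf); exact: random_measurable (proj1 hV).
Qed.

(** Left translation by [g] carries [f] to [k], so both have the same law along [V]. All invariance
    arguments below are instances of this. *)
Lemma haar_mean (g : 'M[R[i]]_2) (f k : mxb -> R) (h : R -> R) (c : R) : SU2 g ->
  measurable_fun setT f -> measurable_fun setT k -> measurable_fun setT h ->
  (forall M, SU2 M -> f (g *m M) = k M) ->
  (forall M, SU2 M -> `|h (f M)| <= c) -> (forall M, SU2 M -> `|h (k M)| <= c) ->
  mean (fun w => h (k (V w))) = mean (fun w => h (f (V w))).
Proof.
move=> gS mf mk mh fk bf bk.
pose X : {RV P >-> R} := mkRV _ (measurable_comp_V _ mk).
pose Y : {RV P >-> R} := mkRV _ (measurable_comp_V _ mf).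
apply: (mean_eq_law X Y h) => //.
- move=> B mB.
  have mS : borel_mx (f @^-1` B) by have := mf measurableT B mB; rewrite setTI.
  have := (proj2 hV) g _ gS mS; rewrite -[RHS]/(P (Y @^-1` B)) => <-.
  congr (P _); apply/funext => w /=; rewrite /preimage /= fk //.
- split; first by apply: (measurableT_comp mh); exact: measurable_comp_V.
  by exists c => w; exact: bk.
- split; first by apply: (measurableT_comp mh); exact: measurable_comp_V.
  by exists c => w; exact: bf.
Qed.

Lemma bmeas_V (f : mxb -> R) (c : R) : measurable_fun setT f -> (forall M, SU2 M -> `|f M| <= c) ->
  bmeas (fun w => f (V w)).
Proof. by move=> mf fc; split; [exact: measurable_comp_V|exists c => w; exact: fc]. Qed.

Lemma bmeas_retr : bmeas (fun w => retr (V w)).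
Proof. by apply: (bmeas_V _ 2); [exact: measurable_retr|exact: SU2_retr_le]. Qed.

Lemma mean_retr : mean (fun w => retr (V w)) = 0.
Proof.
have gS := SU2_mx22 (-1 : R[i]) 0.
have /gS {}gS : -1 * ((-1)^*)%R + 0 * (0^*)%R = 1 :> R[i].
  by rewrite rmorphN rmorph1 mulrNN mulr1 mul0r addr0.
have eg (M : 'M[R[i]]_2) :
    retr (mx22 (-1 : R[i]) 0 (- (0^*)%R) ((-1)^*)%R *m M) = - retr M.
  have l0 : lift ord0 ord0 = 1 :> 'I_2 by apply: val_inj.
  rewrite !retrE !mxE !big_ord_recl !big_ord0 !mxE /= l0 conjC0 oppr0 !mul0r !addr0 add0r.
  by rewrite rmorphN rmorph1 !mulN1r !raddfN -opprD.
have := haar_mean _ retr (fun M => - retr M) id 2 gS measurable_retr _ _ (fun M _ => eg M).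
have -> : mean (fun w => id (- retr (V w))) = - mean (fun w => retr (V w)).
  rewrite -mulN1r -meanZ; last exact: bmeas_retr.
  by congr mean; apply/funext => w; rewrite mulN1r.
move=> h; have {}h : - mean (fun w => retr (V w)) = mean (fun w => retr (V w)).
  apply: h; [exact: measurableT_comp measurable_retr|exact: measurable_id
    |exact: SU2_retr_le|by move=> M sM; rewrite normrN; exact: SU2_retr_le].
by lra.
Qed.

Lemma SU2_entry_le (M : 'M[R[i]]_2) i j : SU2 M ->
  `|complex.Re (M i j) ^+ 2| <= 1 /\ `|complex.Im (M i j) ^+ 2| <= 1.
Proof.
move=> /SU2P[h1 h2 h].
have i01 : (i == 0) || (i == 1) by case: i => -[|[|]].
have j01 : (j == 0) || (j == 1) by case: j => -[|[|]].
move: h; set a := M 0 0; set b := M 0 1 => h.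
have sq (x : R) : 0 <= x ^+ 2 := sqr_ge0 x.
have := sq (complex.Re a); have := sq (complex.Im a).
have := sq (complex.Re b); have := sq (complex.Im b) => q1 q2 q3 q4.
rewrite !ger0_norm ?sqr_ge0 //.
case/orP: i01 => /eqP ->; case/orP: j01 => /eqP ->; rewrite ?h1 ?h2 -/a -/b.
- by split; lra.
- by split; lra.
- by case: (b) q1 q2 h => p q /= *; rewrite ?opprK ?sqrrN; split; lra.
- by case: (a) q3 q4 h => p q /= *; rewrite ?sqrrN; split; lra.
Qed.

(** SU(2) is the unit sphere of dimension 3. The four coordinates have equal second moments, hence
    1/4 each, and the trace is twice one coordinate. *)
Lemma mean_retr_sq : mean (fun w => retr (V w) ^+ 2) = 1.
Proof.
have l0 : lift ord0 ord0 = 1 :> 'I_2 by apply: val_inj.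
have msq : measurable_fun setT (fun x : R => x ^+ 2).
  by apply: measurable_funX; exact: measurable_id.
have row (p q r s : R[i]) (M : 'M[R[i]]_2) j :
    (mx22 p q r s *m M) 0 j = p * M 0 j + q * M 1 j.
  by rewrite !mxE !big_ord_recl !big_ord0 !mxE /= l0 addr0.
have ii : 'i * ('i^*)%R + 0 * (0^*)%R = 1 :> R[i].
  by rewrite mul0r addr0; apply/eqP; rewrite eq_complex /=; apply/andP; split; apply/eqP; ring.
(* Left multiplication by diag(i, -i) replaces the real part of an entry of the first row by minus
   its imaginary part. *)
have rot j : mean (fun w => complex.Im (V w 0 j) ^+ 2) = mean (fun w => complex.Re (V w 0 j) ^+ 2).
  rewrite -(haar_mean _ (fun M => complex.Re (M 0 j)) (fun M => - complex.Im (M 0 j))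
     (fun x => x ^+ 2) 1 (SU2_mx22 'i 0 ii)) //.
  - by congr mean; apply/funext => w; rewrite sqrrN.
  - exact: measurable_Re_entry.
  - by apply: measurableT_comp => //; exact: measurable_Im_entry.
  - by move=> M _; rewrite row mul0r addr0; case: (M 0 j) => p q /=; ring.
  - by move=> M sM; have [] := SU2_entry_le M 0 j sM.
  - by move=> M sM; rewrite sqrrN; have [] := SU2_entry_le M 0 j sM.
have oo : 0 * (0^*)%R + 1 * (1^*)%R = 1 :> R[i] by rewrite mul0r add0r mul1r rmorph1.
(* The rotation brings the second row to the top, and Re M10 = - Re M01. *)
have swap : mean (fun w => complex.Re (V w 0 1) ^+ 2) = mean (fun w => complex.Re (V w 0 0) ^+ 2).
  rewrite -(haar_mean _ (fun M => complex.Re (M 0 0)) (fun M => complex.Re (M 1 0))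
     (fun x => x ^+ 2) 1 (SU2_mx22 0 1 oo)) //.
  - congr mean; apply/funext => w; have [_ -> _] := SU2P _ (VSU w).
    by case: (V w 0 1) => p q /=; rewrite sqrrN.
  - exact: measurable_Re_entry.
  - exact: measurable_Re_entry.
  - by move=> M _; rewrite row mul0r add0r mul1r.
  - by move=> M sM; have [] := SU2_entry_le M 0 0 sM.
  - by move=> M sM; have [] := SU2_entry_le M 1 0 sM.
have bR i j : bmeas (fun w => complex.Re (V w i j) ^+ 2).
  apply: (bmeas_V (fun M => complex.Re (M i j) ^+ 2) 1) => [|M sM].
    by apply: (measurableT_comp msq); exact: measurable_Re_entry.
  by have [] := SU2_entry_le M i j sM.
have bI i j : bmeas (fun w => complex.Im (V w i j) ^+ 2).
  apply: (bmeas_V (fun M => complex.Im (M i j) ^+ 2) 1) => [|M sM].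
    by apply: (measurableT_comp msq); exact: measurable_Im_entry.
  by have [] := SU2_entry_le M i j sM.
have tot : mean (fun w => complex.Re (V w 0 0) ^+ 2 + complex.Im (V w 0 0) ^+ 2
   + complex.Re (V w 0 1) ^+ 2 + complex.Im (V w 0 1) ^+ 2) = 1.
  by rewrite -[RHS](mean_cst 1); congr mean; apply/funext => w; have [_ _ ->] := SU2P _ (VSU w).
rewrite meanD // in tot; last by do 2 apply: bmeasD => //.
rewrite meanD // in tot; last exact: bmeasD.
rewrite meanD // !rot swap in tot.
transitivity (4 * mean (fun w => complex.Re (V w 0 0) ^+ 2)); last by lra.
rewrite -meanZ //; congr mean; apply/funext => w; have [_ ->] := SU2_tr _ (VSU w).
by ring.
Qed.

End OneMatrix.

(** * The random series of traces *)

Section RandomSeries.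
Variable V : int -> Omega -> 'M[R[i]]_2.
Let D : set int := [set nu : int | nu != 0].
Hypothesis hV : forall nu : int, nu != 0 -> haar_SU2 P (V nu).
Hypothesis indV : mutually_independent P D V.

(** The value 0 at [nu = 0] makes [tau] bounded and measurable for every index, [V 0] being
    arbitrary. *)
Let tau (nu : int) (w : Omega) : R := if nu == 0 then 0 else retr (V nu w).

Lemma bmeas_tau nu : bmeas (tau nu).
Proof.
rewrite /tau; case: eqVneq => [_|n0]; first exact: bmeas_cst.
by apply: bmeas_retr; exact: hV.
Qed.

Lemma tau_le nu w : `|tau nu w| <= 2.
Proof.
rewrite /tau; case: eqVneq => [_|n0]; first by rewrite normr0.
by apply: SU2_retr_le; case: (hV nu n0) => -[].
Qed.

Lemma mean_tau nu mu : nu != 0 -> mu != 0 ->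
  mean (fun w => tau nu w * tau mu w) = (nu == mu)%:R.
Proof.
move=> n0 m0; case: eqVneq => [<-|nm].
  rewrite -[RHS](mean_retr_sq _ (hV nu n0)); congr mean; apply/funext => w.
  by rewrite /tau (negPf n0) expr2.
pose X : {RV P >-> R} := mkRV _ (proj1 (bmeas_tau nu)).
pose Y : {RV P >-> R} := mkRV _ (proj1 (bmeas_tau mu)).
apply: (mean_mul_indep X Y 2).
- by move=> w; exact: tau_le.
- by move=> w; exact: tau_le.
- move=> B E mB mE.
  have bor (B' : set R) : measurable B' -> borel_mx (retr @^-1` B').
    by move=> mB'; have := measurable_retr measurableT B' mB'; rewrite setTI.
  pose S (k : int) : set 'M[R[i]]_2 := if k == nu then retr @^-1` B else retr @^-1` E.
  have := indV [:: nu; mu] S.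
  rewrite /= inE nm big_cons big_seq1 /S eqxx eq_sym (negPf nm) => /(_ isT).
  have XE (A' : set R) : X @^-1` A' = V nu @^-1` (retr @^-1` A').
    by apply/funext => w; rewrite /preimage /= /tau (negPf n0).
  have YE (A' : set R) : Y @^-1` A' = V mu @^-1` (retr @^-1` A').
    by apply/funext => w; rewrite /preimage /= /tau (negPf m0).
  rewrite !XE !YE => <-.
  + congr (P _); apply/seteqP; split => w /=.
      move=> [h1 h2] k /=; rewrite !inE => /orP[/eqP ->|/eqP ->]; first by rewrite eqxx.
      by rewrite eq_sym (negPf nm).
    move=> h; split; first by have := h nu; rewrite /= !inE eqxx; apply.
    by have := h mu; rewrite /= !inE eqxx orbT eq_sym (negPf nm); apply.
  + by move=> k; rewrite !inE => /orP[/eqP ->|/eqP ->].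
  + by move=> k _; case: ifP => _; exact: bor.
- rewrite -[RHS](mean_retr _ (hV mu m0)); congr mean; apply/funext => w.
  by rewrite /= /tau (negPf m0).
Qed.

(** Traces are bounded by 2 and the coefficients are absolutely summable, so finite sums converge
    uniformly in [w]; second moments pass to the limit, and for finite sums they follow from
    [mean_tau]. *)
Lemma random_series (fs : int -> R) (M : R) : sums_le D (fun nu => `|fs nu|) M ->
  exists X : {RV P >-> R},
    (forall w, (X w)%:C = csum D (fun nu => (fs nu)%:C * \tr (V nu w))) /\
    ('E_P[fun w => (X w ^+ 2)%R] = \esum_(nu in D) (fs nu ^+ 2)%:E)%E.
Proof.
move=> hM.
have M0 : 0 <= M by have := hM [::]; rewrite big_nil; apply.
pose X w := rsum D (fun nu => fs nu * tau nu w).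
pose Xs (s : seq int) w := \sum_(nu <- s) fs nu * tau nu w.
have le2 nu w : `|fs nu * tau nu w| <= 2 * `|fs nu|.
  by rewrite normrM mulrC ler_wpM2r // tau_le.
have approx s e : uniq s -> (forall nu, nu \in s -> D nu) ->
    sums_le (D `\` [set` s]) (fun nu => `|fs nu|) e -> forall w, `|X w - Xs s w| <= 2 * e.
  move=> us sD he w; apply: rsum_approx => //.
    exists (2 * M); apply: sums_leW (sums_leZ _ _ _ _ (ler0n R 2) hM) => // nu _.
  by apply: sums_leW (sums_leZ _ _ _ _ (ler0n R 2) he) => // nu _.
have Xs_le s w : uniq s -> (forall nu, nu \in s -> D nu) -> `|Xs s w| <= 2 * M.
  move=> us sD; rewrite (le_trans (ler_norm_sum _ _ _)) //.
  apply: (le_trans _ (sums_leZ _ _ _ _ (ler0n R 2) hM s us sD)).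
  by apply: ler_sum => nu _.
have bXs s : bmeas (Xs s).
  by apply: bmeas_sum => nu; apply: bmeasM; [exact: bmeas_cst|exact: bmeas_tau].
have fs0 nu : D nu -> 0 <= `|fs nu| by [].
have tails e : 0 < e -> exists s, [/\ uniq s, forall nu, nu \in s -> D nu &
    sums_le (D `\` [set` s]) (fun nu => `|fs nu|) e].
  by move=> e0; exact: tail_exists hM e0.
(* Partial sums whose coefficient tails are at most 1/(k + 1) converge to [X], which is therefore
   measurable. *)
have [S hS] := choice (fun k : nat => tails (harmonic k) (harmonic_gt0 k)).
have mX : measurable_fun setT X.
  apply: (measurable_fun_cvg (h := fun k => Xs (S k))) => [k|w _]; first exact: (bXs _).1.
  have h0 : (fun k => 2 * @harmonic R k) @ \oo --> 2 * (0 : R).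
    by apply: cvgM; [exact: cvg_cst|exact: cvg_harmonic].
  rewrite mulr0 in h0; apply/cvgrPdist_le => e e0.
  have /cvgrPdist_le/(_ e e0) := h0; apply: filterS => k; rewrite sub0r normrN.
  move=> hk; apply: le_trans (le_trans (ler_norm _) hk).
  by have [us sD he] := hS k; exact: approx.
have X_le w : `|X w| <= 2 * M + 2.
  (* [X] is within 2 of a partial sum, itself at most 2 M in modulus. *)
  have [s [us sD he]] := tails 1 ltr01.
  rewrite -[X w](subrK (Xs s w)) (le_trans (ler_normD _ _)) // addrC lerD ?Xs_le //.
  by have := approx s 1 us sD he w; rewrite mulr1.
have bX : bmeas X by split => //; exists (2 * M + 2).
have ExXs s : uniq s -> (forall nu, nu \in s -> D nu) ->
    mean (fun w => Xs s w ^+ 2) = \sum_(nu <- s) fs nu ^+ 2.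
  move=> us sD.
  transitivity (\sum_(nu <- s) \sum_(mu <- s) (fs nu * fs mu) *
      mean (fun w => tau nu w * tau mu w)).
    have bb nu mu : bmeas (fun w => (fs nu * fs mu) * (tau nu w * tau mu w)).
      by apply: bmeasM; [exact: bmeas_cst|apply: bmeasM; exact: bmeas_tau].
    have ez nu mu : (fs nu * fs mu) * mean (fun w => tau nu w * tau mu w) =
        mean (fun w => (fs nu * fs mu) * (tau nu w * tau mu w)).
      by rewrite meanZ //; apply: bmeasM; exact: bmeas_tau.
    under eq_bigr do under eq_bigr do rewrite ez.
    under eq_bigr do rewrite -mean_sum //.
    rewrite -mean_sum; last by move=> nu; exact: bmeas_sum.
    congr mean; apply/funext => w; rewrite /Xs expr2 mulr_suml; apply: eq_bigr => nu _.
    by rewrite mulr_sumr; apply: eq_bigr => mu _; rewrite mulrACA.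
  rewrite big_seq [RHS]big_seq; apply: eq_bigr => nu nus.
  rewrite (bigD1_seq nu) //= mean_tau ?eqxx ?sD //; try exact: sD.
  rewrite mulr1 -expr2 big_seq_cond big1 ?addr0 // => mu /andP[mus mn].
  by rewrite mean_tau ?(sD _ nus) ?(sD _ mus) // eq_sym (negPf mn) mulr0.
(* From X^2 - Xs^2 = (X + Xs)(X - Xs): the sum is at most 4 M + 2 and the difference at most 2 e. *)
pose K : R := 2 * (4 * M + 2).
have K0 : 0 < K by rewrite /K; lra.
have key s e : uniq s -> (forall nu, nu \in s -> D nu) ->
    sums_le (D `\` [set` s]) (fun nu => `|fs nu|) e ->
    `|mean (fun w => X w ^+ 2) - \sum_(nu <- s) fs nu ^+ 2| <= K * e.
  move=> us sD he; rewrite -ExXs // -[- mean _]mulN1r -meanZ; last first.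
    by rewrite /bmeas; under eq_fun do rewrite expr2; apply: bmeasM; exact: bXs.
  have bX2 : bmeas (fun w => X w ^+ 2) by under eq_fun do rewrite expr2; exact: bmeasM.
  have bXs2 : bmeas (fun w => -1 * Xs s w ^+ 2).
    by under eq_fun do rewrite expr2; apply: bmeasM; [exact: bmeas_cst|apply: bmeasM; exact: bXs].
  rewrite -meanD //; apply: mean_le; first exact: bmeasD.
  move=> w; rewrite mulN1r subr_sqr normrM mulrC [K]mulrC -mulrA.
  have h1 : `|X w + Xs s w| <= 4 * M + 2.
    rewrite (le_trans (ler_normD _ _)) // (le_trans (lerD (X_le w) (Xs_le s w us sD))) //.
    lra.
  by apply: ler_pM => //; exact: approx.
exists (mkRV X mX); split => [w|].
  rewrite /csum -[RHS]/(_ +i* _); congr (_ +i* _).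
    apply: rsum_eq => nu n0; rewrite /tau (negPf n0).
    have [h _] := SU2_tr _ (proj1 (proj1 (hV nu n0)) w).
    by rewrite h /= mul0r subr0.
  apply/esym; rewrite (rsum_eq _ _ (fun=> 0)); first exact: rsum0.
  move=> nu n0; have [h _] := SU2_tr _ (proj1 (proj1 (hV nu n0)) w).
  by rewrite h /= mulr0 mul0r addr0.
rewrite unlock /= meanE; last by rewrite /bmeas; under eq_fun do rewrite expr2; exact: bmeasM.
apply/eqP; rewrite eq_le; apply/andP; split.
  apply/lee_addgt0Pr => e e0.
  have [s [us sD he]] := tails (e / K) (divr_gt0 e0 K0).
  have /ler_normlP[_] := key s _ us sD he; rewrite mulrCA mulfV ?gt_eqF // mulr1.
  rewrite lerBlDr => h; rewrite (le_trans (y := (e + \sum_(nu <- s) fs nu ^+ 2)%:E)) ?lee_fin //.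
  rewrite EFinD addeC leeD2r // sum_le_esum //.
apply: esum_le => s us sD; apply/ler_addgt0Pr => e e0.
have [s' [us' sD' he]] := tails (e / K) (divr_gt0 e0 K0).
(* Enlarging [s] makes the tail small and can only increase the sum of squares. *)
pose s2 := undup (s ++ s').
have s2D nu : nu \in s2 -> D nu.
  by rewrite mem_undup mem_cat => /orP[/sD|/sD'].
have he2 : sums_le (D `\` [set` s2]) (fun nu => `|fs nu|) (e / K).
  apply: sums_leW he => // nu [Dn /= ns]; split => //= ns'; apply: ns.
  by rewrite mem_undup mem_cat ns' orbT.
have /ler_normlP[+ _] := key s2 _ (undup_uniq _) s2D he2.
rewrite mulrCA mulfV ?gt_eqF // mulr1 opprB lerBlDr addrC => h.
apply: le_trans h; apply: sum_subset_le => // [nu ns|nu]; last exact: sqr_ge0.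
by rewrite mem_undup mem_cat ns.
Qed.

End RandomSeries.

End Haar.

(** * Quadratic sums and the form Q *)

Section QuadraticSums.
Context {R : realType}.
Local Notation C := R[i].
Local Notation nc := (@Normc.normc R).

Lemma normc_conj (z : C) : nc (z^*)%R = nc z.
Proof. by apply: complexI; rewrite -!normcC norm_conjC. Qed.

Lemma normcN (z : C) : nc (- z) = nc z.
Proof. by apply: complexI; rewrite -!normcC normrN. Qed.

Lemma normc0 : nc 0 = 0.
Proof. by apply: complexI; rewrite -normcC normr0. Qed.

Lemma normcB (z w : C) : nc (z - w) <= nc z + nc w.
Proof. by rewrite -(normcN w); exact: normcD. Qed.

(** Both sides of the limit are such forms in [scoef], with kernel [corr] for the operators and
    [hitk] for the level sets of Q. *)
Definition quad (I : Type) (c : I -> C) (kappa : I -> I -> C) (s : seq I) : C :=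
  \sum_(m <- s) \sum_(n <- s) c m * ((c n)^*)%R * kappa m n.

(** Each new pair of indices has an entry in [r]; the pairs in s x r and in r x (s ++ r) contribute
    at most M tau each. *)
Lemma quad_cat (I : eqType) (c : I -> C) kappa (h : I -> R) (M tau : R) (s r : seq I) :
  (forall m n, m \in s ++ r -> n \in s ++ r ->
     nc (c m * ((c n)^*)%R * kappa m n) <= h m * h n) ->
  (forall n, 0 <= h n) -> \sum_(n <- s ++ r) h n <= M -> \sum_(n <- r) h n <= tau ->
  nc (quad _ c kappa (s ++ r) - quad _ c kappa s) <= 2 * M * tau.
Proof.
move=> ch h0 hM ht; pose F m n := c m * ((c n)^*)%R * kappa m n.
have -> : quad _ c kappa (s ++ r) - quad _ c kappa s =
  (\sum_(m <- s) \sum_(n <- r) F m n) + (\sum_(m <- r) \sum_(n <- s ++ r) F m n).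
  rewrite /quad big_cat /= -/F.
  under eq_bigr do rewrite big_cat /=.
  by rewrite big_split /= addrAC [X in X - _]addrC addrK.
have bnd s1 s2 : {subset s1 <= s ++ r} -> {subset s2 <= s ++ r} ->
    nc (\sum_(m <- s1) \sum_(n <- s2) F m n) <= (\sum_(m <- s1) h m) * (\sum_(n <- s2) h n).
  move=> h1 h2; rewrite mulr_suml (le_trans (normc_sum _ _ _ _)) //.
  rewrite big_seq [leRHS]big_seq; apply: ler_sum => m /h1 ms.
  rewrite mulr_sumr (le_trans (normc_sum _ _ _ _)) //.
  rewrite big_seq [leRHS]big_seq; apply: ler_sum => n /h2 ns.
  exact: ch.
have hs s1 : 0 <= \sum_(n <- s1) h n by rewrite sumr_ge0.
have sM : \sum_(n <- s) h n <= M.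
  by apply: le_trans hM; rewrite big_cat /= lerDl.
have ss : {subset s <= s ++ r} by move=> n ns; rewrite mem_cat ns.
have rs : {subset r <= s ++ r} by move=> n ns; rewrite mem_cat ns orbT.
rewrite (le_trans (normcD _ _)) // (le_trans (lerD (bnd s r ss rs) (bnd r (s ++ r) rs _))) //.
have -> : 2 * M * tau = M * tau + tau * M by ring.
by apply: lerD; apply: ler_pM.
Qed.

Lemma quad_square (I J : Type) (s : seq I) (r : seq J) (c : I -> C) (a : J -> I -> C) :
  \sum_(j <- r) (\sum_(n <- s) c n * a j n) * ((\sum_(n <- s) c n * a j n)^*)%R
  = quad _ c (fun m n => \sum_(j <- r) a j m * ((a j n)^*)%R) s.
Proof.
rewrite /quad; under [RHS]eq_bigr do under eq_bigr do rewrite mulr_sumr.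
under [RHS]eq_bigr do rewrite exchange_big /=.
rewrite [RHS]exchange_big /=; apply: eq_bigr => j _.
rewrite mulr_suml; apply: eq_bigr => m _.
rewrite rmorph_sum mulr_sumr; apply: eq_bigr => n _ /=.
by rewrite rmorphM /= mulrACA.
Qed.

Lemma square_close (J : eqType) (r : seq J) (x : J -> C) (e : R) : 0 < e ->
  exists2 del, 0 < del & forall y : J -> C,
    (forall j, j \in r -> nc (x j - y j) <= del) ->
    nc (\sum_(j <- r) x j * ((x j)^*)%R - \sum_(j <- r) y j * ((y j)^*)%R) <= e.
Proof.
move=> e0; pose X := \sum_(j <- r) (2 * nc (x j) + 1).
have X0 : 0 <= X by apply: sumr_ge0 => j _; rewrite addr_ge0 // mulr_ge0 // normc_ge0.
(* If |x - y| <= del <= 1 then the squared moduli differ by at most del (2 |x| + 1), which sums to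
   del X. *)
exists (Num.min 1 (e / (X + 1))); first by rewrite lt_min ltr01 divr_gt0 // ltr_wpDl.
move=> y xy; rewrite -sumrB (le_trans (normc_sum _ _ _ _)) //.
set del := Num.min _ _ in xy *.
have d0 : 0 <= del by rewrite le_min ler01 /= divr_ge0 ?addr_ge0 // ltW.
have d1 : del <= 1 by rewrite ge_min lexx.
have dX : del * X <= e.
  apply: (@le_trans _ _ (e / (X + 1) * (X + 1))); last by rewrite divfK // gt_eqF // ltr_wpDl.
  by apply: ler_pM => //; [rewrite ge_min lexx orbT|rewrite lerDl].
apply: le_trans dX; rewrite /X mulr_sumr big_seq [leRHS]big_seq.
apply: ler_sum => j /xy hj.
have -> : x j * ((x j)^*)%R - y j * ((y j)^*)%R =
   (x j - y j) * ((x j)^*)%R + y j * ((x j - y j)^*)%R by rewrite rmorphB; ring.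
rewrite (le_trans (normcD _ _)) // !normcM !normc_conj.
have ny : nc (y j) <= nc (x j) + 1.
  rewrite -[y j](subKr (x j)) (le_trans (normcB _ _)) // lerD2l.
  exact: le_trans hj d1.
rewrite mulrDr mulr1 [nc (y j) * _]mulrC.
apply: (@le_trans _ _ (del * nc (x j) + del * (nc (x j) + 1))); last by lra.
by apply: lerD; apply: ler_pM; rewrite ?normc_ge0.
Qed.

End QuadraticSums.

(** * Anisotropy of Q over the integers *)

Section Anisotropy.
Variable A : 'M[int]_2.
Hypothesis detA : \det A = 1.
Hypothesis hypA : 2 < `|\tr A|.

(** [Y] divides [X], so T^2 - 4 would be a square, where T = |tr A| > 2; but the only squares
    differing by 4 are 0 and 4. *)
Lemma disc_not_square (X Y : int) : Y != 0 -> X ^+ 2 = ((\tr A) ^+ 2 - 4) * Y ^+ 2 -> False.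
Proof.
move=> Y0 e.
have dv : (`|Y| ^ 2 %| `|X| ^ 2)%N.
  by rewrite -!abszX e abszM dvdn_mull.
rewrite dvdn_pexp2r // in dv; case/dvdnP: dv => q eX.
have e2 : (q%:Z) ^+ 2 = (\tr A) ^+ 2 - 4.
  apply: (mulIf (x := Y ^+ 2)); first by rewrite expf_neq0.
  rewrite -e -[X ^+ 2]real_normK ?num_real // -[Y ^+ 2]real_normK ?num_real //.
  by rewrite -!abszE eX PoszM exprMn.
move: e2 hypA; rewrite -[\tr A ^+ 2]real_normK ?num_real //.
rewrite -abszE; move: (absz _) => T eT T2.
have qT : (q < T)%N by nia.
have [k Tk] : exists k, T = (q + 1 + k)%N by exists (T - q.+1)%N; lia.
have k1 : (k <= 1)%N by rewrite Tk in eT; nia.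
by case: k k1 Tk => [|[|k]] // _ Tk; rewrite Tk in eT T2; nia.
Qed.

(** Completing the square: 4 c Q(x, y) = (2 c x + (d - a) y)^2 - ((tr A)^2 - 4) y^2. *)
Lemma Qform_eq0 n : Qform A n = 0 -> n = 0.
Proof.
case: n => x y; rewrite /Qform /= => Q0.
have [y0|y0] := eqVneq y 0; last first.
  exfalso; apply: (disc_not_square (2 * A 1 0 * x + (A 1 1 - A 0 0) * y) y) => //.
  move: detA; rewrite det_mx22 tr_mx22 => dA.
  apply: (lincomb2 _ _ _ (4 * A 1 0) (- 4 * y ^+ 2) _ _ _ _ Q0 dA); ring.
move: Q0; rewrite y0 => Q0.
(* If c = 0 then a d = 1, so |tr A| <= 2. *)
have c0 : A 1 0 != 0.
  apply/eqP => c0; move: detA hypA; rewrite det_mx22 tr_mx22 c0 mulr0 subr0.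
  move=> /(congr1 absz); rewrite abszM => /eqP; rewrite muln_eq1 => /andP[/eqP a1 /eqP d1].
  by move/lt_le_trans => /(_ _ (ler_normD _ _)); rewrite -!abszE a1 d1.
have : A 1 0 * x ^+ 2 = 0 by rewrite -[RHS]Q0; ring.
by move=> /eqP; rewrite mulf_eq0 (negPf c0) /= expf_eq0 /= => /eqP ->.
Qed.

End Anisotropy.

(** * Fourier coefficients along the level sets of Q *)

Lemma sign_norm (R : realType) (k : int) : `|(-1) ^ k : R[i]| = 1.
Proof.
have -> : (-1) ^ k = (-1) ^ (odd `|k|)%:Z :> R[i].
  by apply: sign_parity; case: (odd `|k|).
exact: normr_sign.
Qed.

Section Coefficients.
Context {R : realType}.
Variable A : 'M[int]_2.
Variable f0 : R * R -> R.
Hypothesis hf : smooth_torus (fun x => (f0 x)%:C).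
Local Notation f := (fun x => (f0 x)%:C).
Local Notation C := R[i].
Local Notation nc := (@Normc.normc R).
Local Notation Q := (Qform A).
Local Notation D0 := [set n : int * int | n != 0].

Lemma f0_smoothp : smoothp f0.
Proof.
case: hf => p1 p2 s1 _; split; first exact: s1.
move=> b z; apply: complexI; case: b.
  by rewrite -[RHS](p2 z); congr (_%:C); congr f0; congr pair; rewrite /= addr0.
by rewrite -[RHS](p1 z); congr (_%:C); congr f0; congr pair; rewrite /= addr0.
Qed.

(* The factors [1 + |n_i|] pay for the frequencies divisible by [N], for which
   the sum over [j] of [|<T_N(n) psi_j, psi_j>|^2] is [N <= max |n_i|]. *)
Definition weight (n : int * int) : R := 2 * (1 + `|n.1|%N%:R) * (1 + `|n.2|%N%:R).
Definition wcoef (n : int * int) : R := nc (fourier f n) * weight n.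
Definition scoef (n : int * int) : C := (-1) ^ (n.1 * n.2) * fourier f n.

Lemma weight_ge1 n : 1 <= weight n.
Proof.
rewrite /weight; have x0 : 0 <= `|n.1|%N%:R :> R by [].
have y0 : 0 <= `|n.2|%N%:R :> R by [].
nra.
Qed.

Lemma wcoef_ge0 n : 0 <= wcoef n.
Proof. by rewrite mulr_ge0 ?normc_ge0 // (le_trans ler01) // weight_ge1. Qed.

Lemma normc_scoef n : nc (scoef n) = nc (fourier f n).
Proof. by apply: complexI; rewrite -!normcC normrM sign_norm mul1r. Qed.

Lemma scoef_le n : nc (scoef n) <= wcoef n.
Proof. by rewrite normc_scoef /wcoef ler_peMr ?normc_ge0 // weight_ge1. Qed.

Lemma wcoef_summable : exists M, sums_le setT wcoef M.
Proof.
have [K K0 hK] := fabs_decay _ f0_smoothp.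
(* 32 is the 2 of [weight] times two factors 4 from (1 + x)^3 <= 4 (1 + x^3); 16 is the bound of
   [sum_invsq2]. *)
exists (32 * K * 16) => s us _.
apply: (@le_trans _ _ (\sum_(n <- s) 32 * K * (invsq n.1 * invsq n.2))); last first.
  rewrite -mulr_sumr; apply: ler_wpM2l; last exact: sum_invsq2.
  by rewrite mulr_ge0 // ltW.
apply: ler_sum => n _.
have nf : nc (fourier f n) <= fabs n f0.
  rewrite fourier_real; last exact/smoothp_continuous/f0_smoothp.
  by rewrite (le_trans (normc_le_ReIm _)) //= normrN.
have := hK n; rewrite -!intr_norm -!abszE.
rewrite /wcoef /weight /invsq; set a : R := `|n.1|%N%:R; set b : R := `|n.2|%N%:R.
have -> : (`|n.1|%N%:Z)%:~R = a by [].
have -> : (`|n.2|%N%:Z)%:~R = b by [].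
have a0 : 0 <= a by []. have b0 : 0 <= b by [].
clearbody a b => hKn; have F0 := normc_ge0 (fourier f n).
set F := nc _ in nf F0 *.
have cub (x : R) : 0 <= x -> (1 + x) ^+ 3 <= 4 * (1 + x ^+ 3).
  move=> x0; have -> : 4 * (1 + x ^+ 3) = (1 + x) ^+ 3 + 3 * ((1 + x) * (1 - x) ^+ 2) by ring.
  by rewrite lerDl mulr_ge0 // mulr_ge0 ?addr_ge0 // sqr_ge0.
have a1 : 0 < 1 + a by rewrite ltr_pwDl.
have b1 : 0 < 1 + b by rewrite ltr_pwDl.
rewrite -invfM ler_pdivlMr; last by rewrite mulr_gt0 // exprn_gt0.
have -> : F * (2 * (1 + a) * (1 + b)) * ((1 + a) ^+ 2 * (1 + b) ^+ 2) =
   2 * (((1 + a) ^+ 3 * (1 + b) ^+ 3) * F) by ring.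
apply: (@le_trans _ _ (2 * ((4 * (1 + a ^+ 3) * (4 * (1 + b ^+ 3))) * fabs n f0))).
  rewrite ler_wpM2l // ler_pM // ?mulr_ge0 ?exprn_ge0 ?addr_ge0 //.
  by rewrite ler_pM ?exprn_ge0 ?addr_ge0 ?cub.
have -> : 2 * ((4 * (1 + a ^+ 3) * (4 * (1 + b ^+ 3))) * fabs n f0) =
  32 * ((1 + a ^+ 3) * (1 + b ^+ 3) * fabs n f0) by ring.
by rewrite ler_wpM2l.
Qed.

Lemma wcoef_tail_ext s e : uniq s -> (forall n, n \in s -> D0 n) -> 0 < e ->
  exists r, [/\ uniq (s ++ r), forall n, n \in s ++ r -> D0 n &
             sums_le (D0 `\` [set` s ++ r]) wcoef e].
Proof.
move=> us sD e0; have [M hM] := wcoef_summable.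
have hM0 : sums_le D0 wcoef M by apply: sums_leW hM.
have [s' [us' sD' he]] := tail_exists _ _ _ _ (fun n _ => wcoef_ge0 n) hM0 e0.
exists [seq n <- s' | n \notin s]; split.
- rewrite cat_uniq us filter_uniq // andbT /=; apply/hasPn => n.
  by rewrite mem_filter => /andP[].
- by move=> n; rewrite mem_cat mem_filter => /orP[/sD //|/andP[_ /sD']].
- apply: sums_leW he => // n [Dn /= ns]; split => //= ns'; apply: ns.
  by rewrite mem_cat mem_filter ns' andbT orbN.
Qed.

(** [v] need only be a limit of forms over lists with small tails, at any speed. The truncation
    error at [s] then depends on M and tau alone, so [s] can be fixed before N. *)
Lemma quad_limit (M : R) (kappa : int * int -> int * int -> C) (v : C) s tau :
  sums_le setT wcoef M ->
  uniq s -> (forall n, n \in s -> D0 n) -> sums_le (D0 `\` [set` s]) wcoef tau ->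
  (forall m n, m != 0 -> n != 0 -> nc (kappa m n) <= weight m * weight n) ->
  (forall e, 0 < e -> exists2 del, 0 < del & forall s', uniq s' ->
     (forall n, n \in s' -> D0 n) -> sums_le (D0 `\` [set` s']) wcoef del ->
     nc (v - quad _ scoef kappa s') <= e) ->
  nc (v - quad _ scoef kappa s) <= 2 * M * tau.
Proof.
move=> hM us sD ht kb lim; apply/ler_addgt0Pr => e e0.
have [del del0 hdel] := lim e e0.
have [r [usr srD hr]] := wcoef_tail_ext s del us sD del0.
have := hdel _ usr srD hr.
have q := quad_cat _ scoef kappa wcoef M tau s r.
have : nc (quad _ scoef kappa (s ++ r) - quad _ scoef kappa s) <= 2 * M * tau.
  apply: q.
  - move=> m n ms ns; rewrite 2!normcM normc_conj !normc_scoef /wcoef [leRHS]mulrACA.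
    apply: ler_wpM2l; first by rewrite mulr_ge0 ?normc_ge0.
    by apply: kb; exact: srD.
  - exact: wcoef_ge0.
  - exact: hM.
  - have := usr; rewrite cat_uniq => /and3P[_ /hasPn nr ur]; apply: ht => // n nr'.
    split; first by apply: srD; rewrite mem_cat nr' orbT.
    by move=> /= ns; move/negP: (nr n nr'); apply.
move=> h1 h2; rewrite -(subrK (quad _ scoef kappa (s ++ r)) v) -addrA.
by rewrite (le_trans (normcD _ _)) // [leRHS]addrC lerD.
Qed.

Definition hit (nu : int) (n : int * int) : C := (Q n == nu)%:R.

Lemma hit_sum_le (S : seq int) n : uniq S -> \sum_(nu <- S) nc (hit nu n) <= 1.
Proof.
have nb (b : bool) : nc (b%:R) = b%:R by apply: complexI; rewrite -normcC normr_nat rmorph_nat.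
move=> uS; have [qS|qS] := boolP (Q n \in S).
  rewrite (bigD1_seq (Q n)) //= /hit eqxx nb big1 ?addr0 // => nu.
  by rewrite eq_sym => /negPf ->; rewrite nb.
rewrite big_seq big1 // => nu nS; rewrite /hit nb; case: eqP => // e.
by rewrite e nS in qS.
Qed.

Lemma fsharp_approx nu s e : nu != 0 -> uniq s -> (forall n, n \in s -> D0 n) ->
  sums_le (D0 `\` [set` s]) wcoef e ->
  nc (fsharp A f nu - \sum_(n <- s) scoef n * hit nu n) <= 2 * e.
Proof.
move=> nu0 us sD he; have [M hM] := wcoef_summable.
have -> : \sum_(n <- s) scoef n * hit nu n = \sum_(n <- [seq n <- s | Q n == nu]) scoef n.
  rewrite big_filter [RHS]big_mkcond; apply: eq_bigr => n _.
  by rewrite /hit; case: ifP => _; rewrite ?mulr1 ?mulr0.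
apply: (csum_approx _ _ wcoef).
- by move=> n _; exact: scoef_le.
- exact: filter_uniq.
- by move=> n; rewrite mem_filter => /andP[/eqP].
- by exists M; apply: sums_leW hM.
- apply: sums_leW he => // n [/= Qn ns]; split.
    by apply: contraNneq nu0 => n0; rewrite -Qn n0 /Qform /=; apply/eqP; ring.
  by move=> /= ns'; apply: ns; rewrite /= mem_filter Qn eqxx.
Qed.

(** The level sets of Q are disjoint, so each frequency is counted at most once. *)
Lemma fsharp_sums M : sums_le setT wcoef M ->
  sums_le [set nu : int | nu != 0] (fun nu => nc (fsharp A f nu)) M.
Proof.
move=> hM S uS S0; apply/ler_addgt0Pr => e e0.
(* Each of the levels in [S] costs an error 2 del; the [+ 1] covers an empty [S]. *)
pose del := e / (2 * (size S)%:R + 1).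
have sz : 0 < 2 * (size S)%:R + 1 :> R by rewrite ltr_wpDl ?mulr_ge0.
have [r [ur rD hr]] := wcoef_tail_ext [::] del isT (fun n => ltac:(by [])) (divr_gt0 e0 sz).
rewrite cat0s in ur rD hr.
apply: (@le_trans _ _ (\sum_(nu <- S) (nc (\sum_(n <- r) scoef n * hit nu n) + 2 * del))).
  rewrite big_seq [leRHS]big_seq; apply: ler_sum => nu /S0 nu0.
  rewrite -{1}(subrK (\sum_(n <- r) scoef n * hit nu n) (fsharp A f nu)) addrC.
  by rewrite (le_trans (normcD _ _)) // lerD2l fsharp_approx.
rewrite big_split /= lerD //.
  apply: (@le_trans _ _ (\sum_(n <- r) wcoef n)); last exact: hM.
  apply: (@le_trans _ _ (\sum_(nu <- S) \sum_(n <- r) nc (scoef n) * nc (hit nu n))).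
    apply: ler_sum => nu _; rewrite (le_trans (normc_sum _ _ _ _)) //.
    by apply: ler_sum => n _; rewrite normcM.
  rewrite exchange_big /=; apply: ler_sum => n _; rewrite -mulr_sumr.
  rewrite -[leRHS]mulr1 ler_pM ?normc_ge0 ?scoef_le ?hit_sum_le //.
  by apply: sumr_ge0 => nu _; exact: normc_ge0.
rewrite big_const_seq count_predT iter_addr addr0 -mulr_natr /del.
rewrite [leRHS](_ : e = e / (2 * (size S)%:R + 1) * (2 * (size S)%:R + 1)); last first.
  by rewrite divfK // gt_eqF.
rewrite [leLHS](_ : _ = e / (2 * (size S)%:R + 1) * (2 * (size S)%:R)); last by ring.
apply: ler_wpM2l; first by rewrite divr_ge0 // ltW.
by rewrite lerDl.
Qed.

(** The indicator that Q m and Q n are equal and lie in [S] (without repetitions), in the Gram form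
    to which [quad_square] applies. *)
Definition hitk (S : seq int) (m n : int * int) : C :=
  \sum_(nu <- S) hit nu m * ((hit nu n)^*)%R.

Lemma hitk_le S m n : uniq S -> nc (hitk S m n) <= 1.
Proof.
move=> uS; apply: (le_trans (normc_sum _ _ _ _)); apply: le_trans (hit_sum_le S m uS).
apply: ler_sum => nu _; rewrite normcM normc_conj ler_piMr ?normc_ge0 //.
rewrite /hit -lecR -normcC normr_nat; by case: (_ == _); rewrite ?ler01.
Qed.

Lemma fsharp_quad M S s tau : sums_le setT wcoef M -> uniq S -> (forall nu, nu \in S -> nu != 0) ->
  uniq s -> (forall n, n \in s -> D0 n) -> sums_le (D0 `\` [set` s]) wcoef tau ->
  nc (\sum_(nu <- S) fsharp A f nu * ((fsharp A f nu)^*)%R - quad _ scoef (hitk S) s)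
    <= 2 * M * tau.
Proof.
move=> hM uS S0 us sD ht; apply: quad_limit => //.
  move=> m n _ _; apply: le_trans (hitk_le S m n uS) _.
  by rewrite -[leLHS]mulr1 ler_pM ?weight_ge1.
move=> e e0; have [del d0 hd] := square_close _ S (fsharp A f) e e0.
exists (del / 2); first by rewrite divr_gt0.
move=> s' us' sD' ht'; rewrite -quad_square; apply: hd => nu nS.
rewrite [del](_ : _ = 2 * (del / 2)); last by rewrite mulrC divfK.
by apply: fsharp_approx => //; exact: S0.
Qed.

Lemma fourier_opp n : fourier f (- n) = ((fourier f n)^*)%R.
Proof.
have cf := smoothp_continuous _ f0_smoothp.
have php z : ph (- n) z = - ph n z :> R by rewrite /ph /= !rmorphN /=; ring.
rewrite !fourier_real //; apply/eqP; rewrite eq_complex /=; apply/andP; split; apply/eqP.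
  by apply: I2_eq => z; rewrite php cosN.
rewrite opprK /csin -mulN1r -I2Z.
  by apply: I2_eq => z; rewrite php sinN; ring.
move=> z; apply: cvgM; first exact: cf.
by apply: continuous_comp; [exact: ph_continuous|exact: continuous_sin].
Qed.

(** Q and the sign are even, so [n] and [- n] contribute conjugate terms. This makes the random
    variable real, and the square of the coefficient its squared modulus. *)
Lemma fsharp_real nu : nu != 0 -> fsharp A f nu = (complex.Re (fsharp A f nu))%:C.
Proof.
move=> nu0; apply/eqP; rewrite eq_complex /= eqxx /=; apply/eqP.
set g := fun n : int * int => (-1) ^ (n.1 * n.2) * fourier f n.
have Qopp n : Q (- n) = Q n by rewrite /Qform /=; ring.
have gopp n : g (- n) = ((g n)^*)%R.
  rewrite /g fourier_opp rmorphM /= mulrNN; congr (_ * _).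
  rewrite [in RHS](@sign_parity _ _ (odd `|n.1 * n.2|)%:Z); last by case: (odd _).
  rewrite [in LHS](@sign_parity _ _ (odd `|n.1 * n.2|)%:Z); last by case: (odd _).
  by rewrite /exprz rmorphXn rmorphN rmorph1.
apply/eqP; rewrite -normr_eq0 eq_le normr_ge0 andbT; apply/ler_addgt0Pr => e e0.
rewrite add0r.
have [M hM] := wcoef_summable.
have [r [ur rD hr]] := wcoef_tail_ext [::] e isT (fun n => ltac:(by [])) e0.
rewrite cat0s in ur rD hr.
(* A list stable under negation, over which the imaginary parts cancel exactly. *)
pose s := undup ([seq n <- r | Q n == nu] ++ [seq - n | n <- r & Q n == nu]).
have sopp n : (- n \in s) = (n \in s).
  have mo (E : seq (int * int)) k : (k \in [seq - m | m <- E]) = (- k \in E).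
    by rewrite -{1}[k]opprK (mem_map oppr_inj).
  by rewrite !mem_undup !mem_cat !mo opprK orbC.
have sum0 : \sum_(n <- s) complex.Im (g n) = 0.
  have : \sum_(n <- s) complex.Im (g n) = - \sum_(n <- s) complex.Im (g n).
    transitivity (\sum_(n <- [seq - n | n <- s]) complex.Im (g n)).
      apply: perm_big; apply: uniq_perm; rewrite ?undup_uniq ?(map_inj_uniq oppr_inj) ?undup_uniq // => n.
      by rewrite -[n]opprK (mem_map oppr_inj) opprK sopp.
    rewrite big_map -sumrN; apply: eq_bigr => n _; rewrite gopp.
    by case: (g n).
  by move=> /eqP; rewrite -addr_eq0 -mulr2n mulrn_eq0 /= => /eqP.
have := @rsum_approx R _ [set n | Q n = nu] (fun n => complex.Im (g n)) s e.
rewrite sum0 subr0; apply.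
- exact: undup_uniq.
- move=> n; rewrite mem_undup mem_cat mem_filter => /orP[/andP[/eqP //]|/mapP[m]].
  by rewrite mem_filter => /andP[/eqP Qm _] ->; rewrite /= Qopp.
- exists M; apply: sums_leW hM => // n _; rewrite (le_trans (normc_Im _)) //.
  exact: scoef_le.
- apply: sums_leW hr => [n [/= Qn ns]|n _]; last first.
    by rewrite (le_trans (normc_Im _)) //; exact: scoef_le.
  split; first by apply: contraNneq nu0 => n0; rewrite -Qn n0 /Qform /=; apply/eqP; ring.
  by move=> /= ns'; apply: ns; rewrite mem_undup mem_cat mem_filter Qn eqxx ns'.
Qed.

End Coefficients.

(** * Matrix elements at a fixed prime *)

Section FixedPrime.
Context {R : realType} {N : nat}.
Hypothesis pN : prime N.
Hypothesis oN : odd N.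
Variable A : 'M[int]_2.
Hypothesis detA : \det A = 1.
Variable U : 'M['Z_(2 * N)%N]_2 -> state R N -> state R N.
Hypothesis hU : quantization U.
Variable psi : 'I_N -> state R N.
Hypothesis hpsi : hecke_basis A U psi.
Variable f0 : R * R -> R.
Hypothesis hf : smooth_torus (fun x => (f0 x)%:C).
Local Notation f := (fun x => (f0 x)%:C).
Local Notation C := R[i].
Local Notation nc := (@Normc.normc R).
Local Notation Q := (Qform A).
Local Notation D0 := [set n : int * int | n != 0].
Local Notation Z := 'Z_N.
Local Notation t := ((\tr A)%:~R : Z).
Local Notation wcoef := (wcoef f0).
Local Notation scoef := (scoef f0).

Let N_gt1 : (1 < N)%N := prime_gt1 pN.

Definition diagc (j : 'I_N) (n : int * int) : C := wM psi (red n) j j.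
Definition corr (m n : int * int) : C := \sum_j diagc j m * ((diagc j n)^*)%R.
(** [Fcoef] stripped of sqrt N, whose square cancels the factor 1/N of the average. *)
Definition xval (j : 'I_N) : C := inner (Op f (psi j)) (psi j) - torus_int f.

Let psi_orth : forall j k, inner (psi j) (psi k) = (j == k)%:R.
Proof. by case: hpsi. Qed.

Lemma Fcoef_sum : (N%:R^-1 * \sum_(j < N) sqmod (Fcoef f (psi j)))%:C =
  \sum_j xval j * ((xval j)^*)%R.
Proof.
rewrite rmorphM fmorphV rmorph_nat rmorph_sum mulr_sumr; apply: eq_bigr => j _ /=.
rewrite sqmodE /Fcoef rmorphM /= -/(xval j) mulrACA mulrA.
have -> : ((Num.sqrt N%:R)%:C : C) * (((Num.sqrt N%:R)%:C : C)^*)%R = N%:R.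
  by rewrite -normCK normcC normc_norm ger0_norm ?sqrtr_ge0 // -rmorphXn /= sqr_sqrtr // rmorph_nat.
by rewrite -mulrA mulKf // pnatr_eq0 -lt0n ltnW.
Qed.

Lemma inner_T_op j n : inner (T_op n (psi j)) (psi j) = (-1) ^ (n.1 * n.2) * diagc j n.
Proof. by rewrite T_opE // innerZl /diagc mxE. Qed.

Lemma normc_T_op n phi (x : Z) : nc (T_op n phi x : C) = nc (phi (x + n.1%:~R)).
Proof.
rewrite T_opE // !ffunE -[_ *: _]/(_ * _).
apply: complexI; rewrite -!normcC !normrM sign_norm mul1r eN_norm // mul1r.
by [].
Qed.

(** Here [e] depends on N and the basis through the size [B] of the eigenfunctions. This is
    harmless: the lemma only feeds [quad_limit], whose conclusion does not see [e]. *)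
Lemma xval_approx (del : R) : 0 < del -> exists2 e, 0 < e & forall s, uniq s ->
  (forall n, n \in s -> D0 n) -> sums_le (D0 `\` [set` s]) wcoef e ->
  forall j, nc (xval j - \sum_(n <- s) scoef n * diagc j n) <= del.
Proof.
move=> d0.
pose Bj (j : 'I_N) := \sum_(x : Z) nc (psi j x).
have Bj0 j : 0 <= Bj j by apply: sumr_ge0 => x _; exact: normc_ge0.
pose B := \sum_j Bj j.
have BjB j : Bj j <= B by rewrite /B (bigD1 j) //= lerDl sumr_ge0.
have B0 : 0 <= B by apply: sumr_ge0.
have [M hM] := wcoef_summable _ hf.
pose K := 2 * B * B + 1.
have K0 : 0 < K by rewrite ltr_wpDl // !mulr_ge0.
exists (del / K); first exact: divr_gt0.
set e := del / K; have e0 : 0 <= e by rewrite divr_ge0 // ltW.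
move=> s us sD he j.
have u0s : uniq (0 :: s).
  by rewrite /= us andbT; apply/negP => /sD.
(* Frequency 0 acts as the identity with coefficient [torus_int f], so it absorbs the subtracted
   mean. *)
have -> : xval j - \sum_(n <- s) scoef n * diagc j n =
   inner (Op f (psi j)) (psi j)
   - \sum_(n <- 0 :: s) fourier f n * inner (T_op n (psi j)) (psi j).
  rewrite big_cons inner_T_op /= mulr0 expr0z mul1r.
  have -> : diagc j 0 = 1.
    by rewrite /diagc mxE (_ : red 0 = 0) // Tmod0 psi_orth eqxx.
  have -> : fourier f 0 = torus_int f.
    rewrite /fourier; congr torus_int; apply/funext => z.
    by rewrite !mul0r addr0 oppr0 e10 mulr1.
  rewrite mulr1 /xval opprD addrA; congr (_ - _); apply: eq_bigr => n _.
  by rewrite inner_T_op [RHS]mulrCA [RHS]mulrA.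
have pt (x : Z) : nc ((Op f (psi j) x : C) -
    \sum_(n <- 0 :: s) fourier f n * (T_op n (psi j) x : C)) <= 2 * (B * e).
  rewrite ffunE; apply: (csum_approx _ _ (fun n => B * wcoef n)) => //.
  - move=> n _; rewrite normcM normc_T_op mulrC; apply: ler_pM; rewrite ?normc_ge0 //.
      apply: le_trans (BjB j); rewrite /Bj (bigD1 (x + n.1%:~R)) //= lerDl.
      by apply: sumr_ge0 => y _; exact: normc_ge0.
    by rewrite -normc_scoef scoef_le.
  - by exists (B * M); apply: sums_leZ.
  - apply: sums_leZ => //; apply: sums_leW he => // n [_ /= ns]; split.
      by apply/eqP => n0; apply: ns; rewrite n0 mem_head.
    by move=> /= ns'; apply: ns; rewrite in_cons ns' orbT.
have -> : inner (Op f (psi j)) (psi j)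
   - \sum_(n <- 0 :: s) fourier f n * inner (T_op n (psi j)) (psi j) =
  N%:R^-1 * \sum_(x : Z) ((Op f (psi j) x : C) -
    \sum_(n <- 0 :: s) fourier f n * (T_op n (psi j) x : C)) * ((psi j x : C)^*)%R.
  rewrite /inner; under [in RHS]eq_bigr do rewrite mulrBl.
  rewrite sumrB mulrBr; congr (_ - _).
  under [in RHS]eq_bigr do rewrite mulr_suml.
  rewrite [in RHS]exchange_big /= mulr_sumr; apply: eq_bigr => n _.
  rewrite mulrCA !mulr_sumr; apply: eq_bigr => x _.
  by rewrite !mulrA.
rewrite normcM.
have -> : nc (N%:R^-1) = N%:R^-1.
  by apply: complexI; rewrite -normcC normfV normr_nat fmorphV rmorph_nat.
apply: (@le_trans _ _ (1 * (2 * (B * e) * B))).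
  apply: ler_pM; rewrite ?normc_ge0 ?invr_ge0 //.
    by rewrite invf_le1 ?ltr0n ?ler1n ltnW.
  rewrite (le_trans (normc_sum _ _ _ _)) //.
  apply: (@le_trans _ _ (\sum_(x : Z) 2 * (B * e) * nc (psi j x))).
    apply: ler_sum => x _; rewrite normcM normc_conj ler_wpM2r ?normc_ge0 //.
  rewrite -mulr_sumr; apply: ler_wpM2l; last exact: BjB.
  by apply: mulr_ge0 => //; exact: mulr_ge0.
have -> : del = K * e by rewrite /e mulrC divfK // gt_eqF.
rewrite mul1r /K; nra.
Qed.

Lemma Qz_red n : Qz Z (A 0 0)%:~R (A 0 1)%:~R (A 1 0)%:~R (A 1 1)%:~R (red n) = (Q n)%:~R.
Proof.
have -> : Q n = A 1 0 * (n.1 * n.1) + (A 1 1 - A 0 0) * n.1 * n.2 - A 0 1 * (n.2 * n.2).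
  by rewrite /Qform; ring.
by rewrite /Qz /red /= !(rmorphB, rmorphD, rmorphM) /=; ring.
Qed.

Hypothesis disc_neq0 : t ^+ 2 - 4 != 0.

Lemma diagc_sq n : n != 0 -> \sum_j nc (diagc j n) ^+ 2 <= weight n.
Proof.
move=> n0.
have [c1 c2] := hecke_card pN oN A detA U hU psi hpsi disc_neq0.
have [r0|r0] := eqVneq (red n : Z * Z) 0.
  rewrite (eq_bigr (fun=> 1)); last first.
    move=> j _; rewrite /diagc r0 mxE Tmod0 psi_orth eqxx.
    by rewrite (_ : nc 1 = 1) ?expr1n //; apply: complexI; rewrite -normcC normr1.
  rewrite sumr_const card_ord.
  have [d1 d2] : (N %| `|n.1|)%N /\ (N %| `|n.2|)%N.
    have := congr1 fst r0; have := congr1 snd r0 => /= /eqP h2 /eqP h1.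
    by rewrite -!Zp_int_eq0.
  have : (N <= `|n.1|)%N \/ (N <= `|n.2|)%N.
    have [n10|n10] := eqVneq n.1 0; last by left; apply: dvdn_leq => //; rewrite absz_gt0.
    right; apply: dvdn_leq => //; rewrite absz_gt0; apply: contraNneq n0 => n20.
    by rewrite [n]surjective_pairing n10 n20.
  have a0 : 0 <= `|n.1|%N%:R :> R by [].
  have b0 : 0 <= `|n.2|%N%:R :> R by [].
  by rewrite /weight; case; rewrite -(ler_nat R) => h; nra.
(* For [n] not divisible by N the bound is N / |G| <= 2, the origin of the factor 2 in [weight]. *)
apply: (@le_trans _ _ 2); last first.
  have a0 : 0 <= `|n.1|%N%:R :> R by [].
  have b0 : 0 <= `|n.2|%N%:R :> R by [].
  by rewrite /weight; nra.
have h := hecke_diag_sq pN oN A detA U hU psi hpsi disc_neq0 _ r0.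
rewrite -lecR rmorph_sum /=.
rewrite (eq_bigr (fun j => `|wM psi (red n) j j| ^+ 2)); last first.
  by move=> j _; rewrite rmorphXn.
apply: (le_trans h); rewrite rmorph_nat ler_pdivrMr; last first.
  by rewrite ltr0n; lia.
by rewrite -natrM ler_nat; lia.
Qed.

Lemma corr_le m n : m != 0 -> n != 0 -> nc (corr m n) <= weight m * weight n.
Proof.
move=> m0 n0; apply: (@le_trans _ _ ((weight m + weight n) / 2)).
  rewrite ler_pdivlMr //; apply: le_trans (lerD (diagc_sq _ m0) (diagc_sq _ n0)).
  rewrite -big_split /=; apply: (le_trans (ler_wpM2r _ (normc_sum _ _ _ _))) => //.
  rewrite mulr_suml; apply: ler_sum => j _; rewrite normcM normc_conj.
  have := sqr_ge0 (nc (diagc j m) - nc (diagc j n)); nra.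
have := @weight_ge1 R m; have := @weight_ge1 R n; nra.
Qed.

Lemma xval_quad M s tau : sums_le setT wcoef M -> uniq s -> (forall n, n \in s -> D0 n) ->
  sums_le (D0 `\` [set` s]) wcoef tau ->
  nc (\sum_j xval j * ((xval j)^*)%R - quad _ scoef corr s) <= 2 * M * tau.
Proof.
move=> hM us sD ht; apply: quad_limit => //; first exact: corr_le.
move=> e e0; have [del d0 hd] := square_close _ (index_enum 'I_N) xval e e0.
have [e' e'0 he'] := xval_approx del d0.
exists e' => // s' us' sD' hs'; rewrite -quad_square; apply: hd => j _.
exact: he'.
Qed.

(** From N <= 2 |G| come 3 N / |G|^2 <= 12 / N and |N / |G| - 1| <= 1 / |G| <= 2 / N. *)
Lemma corr_close (e : R) m n : 0 < e -> (3 <= N)%N ->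
  (Q m)%:~R != 0 :> Z -> (Q n)%:~R != 0 :> Z ->
  nc (corr m n - ((Q m)%:~R == (Q n)%:~R :> Z)%:R) <= 2 * e + 12 / (N%:R * e) + 2 / N%:R.
Proof.
move=> e0 N3 Qm Qn.
have [c1 c2] := hecke_card pN oN A detA U hU psi hpsi disc_neq0.
have Qm' := Qz_red m; have Qn' := Qz_red n.
have := hecke_diag_corr pN oN A detA U hU psi hpsi disc_neq0 (red m) (red n) (e%:C).
rewrite Qm' Qn' => /(_ Qm Qn); rewrite ltcR => /(_ e0).
set G := #|_| in c1 c2 *; set b := (_ == _).
have G0 : 0 < G%:R :> R by rewrite ltr0n; lia.
have N0 : 0 < N%:R :> R by rewrite ltr0n; lia.
have NG : N%:R <= 2 * G%:R :> R by rewrite -natrM ler_nat; lia.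
have -> : 2 * e%:C + 3 * N%:R / G%:R ^+ 2 / e%:C =
    (2 * e + 3 * N%:R / G%:R ^+ 2 / e)%:C.
  by rewrite !rmorphD !rmorphM !fmorphV !rmorphXn !rmorph_nat.
rewrite -/(corr m n) normcC lecR => h.
have -> : corr m n - b%:R = (corr m n - N%:R / G%:R * b%:R) + ((N%:R / G%:R - 1) * b%:R).
  by ring.
rewrite (le_trans (normcD _ _)) //.
have h1 : 3 * N%:R / G%:R ^+ 2 / e <= 12 / (N%:R * e).
  rewrite ler_pdivrMr // ler_pdivrMr ?exprn_gt0 //.
  have -> : 12 / (N%:R * e) * e = 12 / N%:R by field; rewrite !gt_eqF.
  rewrite mulrAC ler_pdivlMr //; nra.
have h2 : nc ((N%:R / G%:R - 1) * b%:R) <= 2 / N%:R.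
  rewrite normcM.
  have -> : nc (N%:R / G%:R - 1) = `|N%:R / G%:R - 1|.
    have -> : N%:R / G%:R - 1 = (N%:R / G%:R - 1 : R)%:C.
      by rewrite rmorphB rmorphM fmorphV !rmorph_nat rmorph1.
    exact: normc_norm.
  apply: (@le_trans _ _ (`|N%:R / G%:R - 1| * 1)).
    rewrite ler_wpM2l // -lecR -normcC normr_nat.
    by case: (b); rewrite ?ler01.
  rewrite mulr1.
  have -> : N%:R / G%:R - 1 = (N%:R - G%:R) / G%:R :> R by field; rewrite gt_eqF.
  rewrite normrM normfV [`|G%:R|]gtr0_norm // ler_pdivrMr //.
  apply: (@le_trans _ _ 1).
    have g1 : G%:R <= N%:R + 1 :> R by rewrite natr1 ler_nat.
    have g2 : N%:R <= G%:R + 1 :> R by rewrite natr1 ler_nat.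
    by rewrite ler_norml; apply/andP; split; lra.
  by rewrite mulrAC ler_pdivlMr // mul1r.
by rewrite (le_trans (lerD h h2)) // lerD2r lerD2l.
Qed.

End FixedPrime.

(** * The limit *)

Section Limit.
Context {R : realType}.
Variable A : 'M[int]_2.
Hypothesis detA : \det A = 1.
Hypothesis hypA : 2 < `|\tr A|.
Variable f0 : R * R -> R.
Hypothesis hf : smooth_torus (fun x => (f0 x)%:C).
Local Notation f := (fun x => (f0 x)%:C).
Local Notation C := R[i].
Local Notation nc := (@Normc.normc R).
Local Notation Q := (Qform A).
Local Notation D0 := [set n : int * int | n != 0].
Local Notation D := [set nu : int | nu != 0].
Local Notation wcoef := (wcoef f0).
Local Notation scoef := (scoef f0).
Local Notation L := (\esum_(nu in D) (sqmod (fsharp A f nu))%:E)%E.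

Variable M : R.
Hypothesis hM : sums_le setT wcoef M.

Let M0 : 0 <= M.
Proof. by have := hM [::]; rewrite big_nil; apply. Qed.

Lemma sqmod_fsharp_sums : sums_le D (fun nu => sqmod (fsharp A f nu)) (M * M).
Proof.
have hs := fsharp_sums A f0 hf M hM.
move=> S uS S0; apply: (@le_trans _ _ (\sum_(nu <- S) M * nc (fsharp A f nu))).
  rewrite big_seq [leRHS]big_seq; apply: ler_sum => nu nS.
  rewrite /sqmod expr2 ler_wpM2r ?normc_ge0 //.
  by have := hs [:: nu] isT; rewrite big_seq1; apply => k; rewrite inE => /eqP ->; exact: S0.
by rewrite -mulr_sumr ler_wpM2l // hs.
Qed.

Lemma L_ge0 : (0 <= L)%E.
Proof. by apply: esum_ge0 => nu _; rewrite lee_fin sqmod_ge0. Qed.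

Lemma L_fin : L \is a fin_num.
Proof.
rewrite ge0_fin_numE ?L_ge0 //.
by rewrite (le_lt_trans (esum_le _ _ _ sqmod_fsharp_sums)) // ltry.
Qed.

Definition levels (s : seq (int * int)) : seq int := undup [seq Q n | n <- s].

(** For each finite set [S] of nonzero levels, [fsharp_quad] compares the sum of the squares over
    [S] with [g S]. Truncated sums vanish off the levels met by [s], so [g S <= g (levels s)], and
    the supremum over [S] is controlled from both sides. *)
Lemma levels_close s tau : uniq s -> (forall n, n \in s -> D0 n) ->
  sums_le (D0 `\` [set` s]) wcoef tau ->
  nc ((fine L)%:C - quad _ scoef (hitk A (levels s)) s) <= 2 * M * tau.
Proof.
move=> us sD ht.
pose g S : R := \sum_(nu <- S) sqmod (\sum_(n <- s) scoef n * hit A nu n).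
have gE S : quad _ scoef (hitk A S) s = (g S)%:C.
  rewrite /hitk -quad_square rmorph_sum; apply: eq_bigr => nu _ /=.
  by rewrite sqmodE.
have close S : uniq S -> (forall nu, nu \in S -> nu != 0) ->
    `|\sum_(nu <- S) sqmod (fsharp A f nu) - g S| <= 2 * M * tau.
  move=> uS S0; have := fsharp_quad A f0 hf M S s tau hM uS S0 us sD ht.
  rewrite gE; have -> : \sum_(nu <- S) fsharp A f nu * ((fsharp A f nu)^*)%R =
     (\sum_(nu <- S) sqmod (fsharp A f nu))%:C.
    by rewrite rmorph_sum; apply: eq_bigr => nu _ /=; rewrite sqmodE.
  by rewrite -rmorphB normc_norm.
have uL : uniq (levels s) by exact: undup_uniq.
have lev0 nu : nu \in levels s -> nu != 0.
  rewrite mem_undup => /mapP[n /sD n0 ->]; apply: contraNneq n0.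
  by move=> /(Qform_eq0 A detA hypA) ->.
have gle S : uniq S -> g S <= g (levels s).
  move=> uS; rewrite /g (bigID (mem (levels s))) /= [X in _ + X]big1 ?addr0; last first.
    move=> nu nL; rewrite big_seq big1 /sqmod ?normc0 ?expr0n // => n ns.
    rewrite /hit; case: eqP => [e|]; last by rewrite mulr0.
    by case/negP: nL; rewrite mem_undup -e map_f.
  rewrite -big_filter; apply: sum_subset_le; first exact: filter_uniq.
    by move=> nu; rewrite mem_filter => /andP[].
  by move=> nu; exact: sqmod_ge0.
rewrite gE -rmorphB normc_norm ler_norml; apply/andP; split.
  have := close _ uL lev0; rewrite ler_norml => /andP[h _].
  have : \sum_(nu <- levels s) sqmod (fsharp A f nu) <= fine L.
    by rewrite -lee_fin fineK ?L_fin // sum_le_esum // => nu /lev0.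
  by move: h; set a := \sum_(nu <- _) _; lra.
suff : fine L <= g (levels s) + 2 * M * tau by lra.
rewrite -lee_fin fineK ?L_fin //; apply: esum_le => S uS S0.
have := close S uS S0; rewrite ler_norml => /andP[_ h]; have := gle S uS; lra.
Qed.

Lemma hitk_levels s m n : m \in s ->
  hitk A (levels s) m n = (Q m == Q n)%:R :> C.
Proof.
move=> ms; rewrite /hitk (bigD1_seq (Q m)) ?undup_uniq ?mem_undup ?map_f //=.
rewrite big1 ?addr0 => [|nu nm]; last by rewrite /hit eq_sym (negPf nm) mul0r.
by rewrite /hit eqxx mul1r rmorph_nat eq_sym.
Qed.

Lemma quad_close (k1 k2 : int * int -> int * int -> C) s (eta : R) : uniq s -> 0 <= eta ->
  (forall m n, m \in s -> n \in s -> nc (k1 m n - k2 m n) <= eta) ->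
  nc (quad _ scoef k1 s - quad _ scoef k2 s) <= M * M * eta.
Proof.
move=> us e0 hk; rewrite /quad -sumrB.
have sM : \sum_(n <- s) nc (scoef n) <= M.
  by apply: le_trans (hM s us _) => //; apply: ler_sum => n _; exact: scoef_le.
have s0 : 0 <= \sum_(n <- s) nc (scoef n) by apply: sumr_ge0 => n _; exact: normc_ge0.
apply: (@le_trans _ _ ((\sum_(m <- s) nc (scoef m)) * (\sum_(n <- s) nc (scoef n)) * eta)); last first.
  by rewrite ler_wpM2r // ler_pM.
rewrite (le_trans (normc_sum _ _ _ _)) // -mulrA mulr_suml.
rewrite big_seq [leRHS]big_seq; apply: ler_sum => m ms.
rewrite -sumrB (le_trans (normc_sum _ _ _ _)) // mulr_suml mulr_sumr.
rewrite big_seq [leRHS]big_seq; apply: ler_sum => n ns.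
rewrite -mulrBr 2!normcM normc_conj -mulrA ler_wpM2l ?normc_ge0 //.
by rewrite ler_wpM2l ?normc_ge0 // hk.
Qed.

Variable U : forall N : nat, 'M['Z_(2 * N)%N]_2 -> state R N -> state R N.
Hypothesis hU : forall N : nat, prime N -> odd N -> quantization (U N).
Variable psi : forall N : nat, 'I_N -> state R N.
Hypothesis hpsi : forall N : nat, prime N -> odd N -> hecke_basis A (U N) (psi N).

Lemma disc_int_neq0 : (\tr A) ^+ 2 - 4 != 0.
Proof.
move: hypA; rewrite -[\tr A ^+ 2]real_normK ?num_real //.
by rewrite -abszE; move: (absz _) => T T2; apply/eqP; nia.
Qed.

Lemma corr_limit s (eta : R) : (forall n, n \in s -> D0 n) -> 0 < eta ->
  exists N0, forall N, (N0 <= N)%N -> prime N -> odd N ->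
    ((\tr A)%:~R : 'Z_N) ^+ 2 - 4 != 0 /\
    forall m n, m \in s -> n \in s ->
      nc (corr (psi N) m n - hitk A (levels s) m n) <= eta.
Proof.
move=> sD eta0.
(* For N > Bd the discriminant, the values Q m and the nonzero differences Q m - Q n stay nonzero
   mod N; congruence of values then means equality. *)
pose Bd := (`|((\tr A) ^+ 2 - 4)%R| + \sum_(m <- s) `|Q m|
  + \sum_(m <- s) \sum_(n <- s) `|(Q m - Q n)%R|)%N.
(* The three error terms of [corr_close] receive eta / 3 each: [e] settles the first, [Na] and [Nb]
   the other two. *)
pose e := eta / 6.
have e0 : 0 < e by rewrite divr_gt0.
pose Na := (Num.truncn (12 / e / (eta / 3))).+1.
pose Nb := (Num.truncn (2 / (eta / 3))).+1.
exists (3 + Bd + Na + Nb).+1 => N NN pN oN.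
have N3 : (3 <= N)%N by lia.
have NB : (Bd < N)%N by lia.
have small (z : int) : (`|z| <= Bd)%N -> z != 0 -> z%:~R != 0 :> 'Z_N.
  move=> zB z0; rewrite Zp_int_eq0 ?prime_gt1 //; apply/negP => /dvdn_leq.
  by rewrite absz_gt0 => /(_ z0); lia.
have disc : ((\tr A)%:~R : 'Z_N) ^+ 2 - 4 != 0.
  have -> : ((\tr A)%:~R : 'Z_N) ^+ 2 - 4 = ((\tr A) ^+ 2 - 4)%:~R.
    by rewrite rmorphB rmorphXn.
  by apply: small disc_int_neq0; rewrite /Bd -!addnA leq_addr.
split => // m n ms ns.
have Q0 k : k \in s -> (Q k)%:~R != 0 :> 'Z_N.
  move=> ks; apply: small.
    by rewrite /Bd (big_rem k) //=; lia.
  by apply: contraNneq (sD _ ks) => /(Qform_eq0 A detA hypA) ->.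
rewrite hitk_levels //.
have -> : (Q m == Q n) = ((Q m)%:~R == (Q n)%:~R :> 'Z_N).
  case: eqP => [->|/eqP ne]; first by rewrite eqxx.
  apply/esym/negbTE; rewrite -subr_eq0 -rmorphB; apply: small; last by rewrite subr_eq0.
  rewrite /Bd [X in (_ + X)%N](big_rem m) //= [X in (_ + (X + _))%N](big_rem n) //=; lia.
have := corr_close pN oN A detA (U N) (hU N pN oN) (psi N) (hpsi N pN oN) disc e m n e0 N3
  (Q0 m ms) (Q0 n ns).
move=> h; apply: (le_trans h).
have Npos : 0 < N%:R :> R by rewrite ltr0n; lia.
have ha : 12 / (N%:R * e) <= eta / 3.
  have : 12 / e / (eta / 3) < N%:R.
    by rewrite (lt_le_trans (truncnS_gt _)) // ler_nat -/Na; lia.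
  rewrite ltr_pdivrMr ?divr_gt0 // ltr_pdivrMr // => /ltW.
  by rewrite ler_pdivrMr ?mulr_gt0 // [eta / 3 * _]mulrA [eta / 3 * N%:R]mulrC.
have hb : 2 / N%:R <= eta / 3.
  have : 2 / (eta / 3) < N%:R.
    by rewrite (lt_le_trans (truncnS_gt _)) // ler_nat -/Nb; lia.
  rewrite ltr_pdivrMr ?divr_gt0 // => /ltW.
  by rewrite ler_pdivrMr // mulrC.
rewrite [leRHS](_ : eta = 2 * e + eta / 3 + eta / 3); last by rewrite /e; field.
by rewrite !lerD.
Qed.

Lemma variance_limit :
  (N%:R^-1 * \sum_(j < N) sqmod (Fcoef f (psi N j)))%:E
    @[N --> within [set N : nat | prime N && odd N] \oo] --> L.
Proof.
rewrite -(fineK L_fin); apply/fine_cvgP; split; first exact: nearW.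
apply/cvgrPdist_le => e e0.
(* The truncations cost 2 M tau twice and the kernels M^2 eta. [tau] determines [s], and only then
   does [eta] determine how large N must be. *)
pose tau := e / 2 / (4 * M + 1).
have K0 : 0 < 4 * M + 1 by rewrite ltr_wpDl // mulr_ge0.
have tau0 : 0 < tau by rewrite !divr_gt0.
have [s [us sD hs]] := wcoef_tail_ext f0 hf [::] tau isT (fun n => ltac:(by [])) tau0.
rewrite cat0s in us sD hs.
pose eta := e / 2 / (M * M + 1).
have K1 : 0 < M * M + 1 by rewrite ltr_wpDl // mulr_ge0.
have eta0 : 0 < eta by rewrite !divr_gt0.
have [N0 hN0] := corr_limit s eta sD eta0.
exists N0 => // N /= NN0 /andP[pN oN].
have [disc hc] := hN0 N NN0 pN oN.
have FX := Fcoef_sum pN (psi N) f0.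
rewrite /= -normc_norm; set F := _^-1 * _ in FX *.
rewrite (_ : (_ - F)%:C = (fine L)%:C - F%:C); last exact: rmorphB.
rewrite FX.
set X := \sum_j _; set G := quad _ scoef (hitk A (levels s)) s.
set H := quad _ scoef (corr (psi N)) s.
have h1 : nc ((fine L)%:C - G) <= 2 * M * tau by exact: levels_close.
have h2 : nc (H - G) <= M * M * eta by apply: quad_close => //; exact: ltW.
have h3 : nc (X - H) <= 2 * M * tau.
  by apply: (xval_quad pN oN A detA (U N) (hU N pN oN)); rewrite ?hpsi //; exact: hpsi.
have -> : (fine L)%:C - X = ((fine L)%:C - G) - (H - G) - (X - H) by ring.
rewrite (le_trans (normcB _ _)) //.
apply: (@le_trans _ _ (2 * M * tau + M * M * eta + 2 * M * tau)).
  by rewrite lerD // (le_trans (normcB _ _)) // lerD.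
have t1 : tau * (4 * M + 1) = e / 2 by rewrite divfK // gt_eqF.
have t2 : eta * (M * M + 1) = e / 2 by rewrite divfK // gt_eqF.
have -> : 2 * M * tau + M * M * eta + 2 * M * tau =
   (tau * (4 * M + 1) - tau) + (eta * (M * M + 1) - eta) by ring.
by rewrite t1 t2; lra.
Qed.

End Limit.

Theorem theorem1p2 (R : realType) (A : 'M[int]_2)
    (detA : \det A = 1) (hypA : 2 < `|\tr A|)
    (A2 : forall i j, (A i j = (i == j)%:Z %[mod 2])%Z)
    (U : forall N : nat, 'M['Z_(2 * N)%N]_2 -> state R N -> state R N)
    (hU : forall N : nat, prime N -> odd N -> quantization (U N))
    (f0 : R * R -> R) (hf : smooth_torus (fun x => (f0 x)%:C))
    (psi : forall N : nat, 'I_N -> state R N)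
    (hpsi : forall N : nat, prime N -> odd N -> hecke_basis A (U N) (psi N)) :
  let f := fun x => (f0 x)%:C in
  let L : \bar R := (\esum_(nu in [set nu : int | nu != 0%R])
              (sqmod (fsharp A f nu))%:E)%E in
  [/\ (L < +oo)%E,
      (N%:R^-1 * \sum_(j < N) sqmod (Fcoef f (psi N j)))%:E
        @[N --> within [set N : nat | prime N && odd N] \oo] --> L &
      forall (d : measure_display) (Omega : measurableType d)
        (P : probability Omega R) (V : int -> Omega -> 'M[R[i]]_2),
        (forall nu : int, nu != 0 -> haar_SU2 P (V nu)) ->
        mutually_independent P [set nu : int | nu != 0] V ->
        exists X : {RV P >-> R},
          (forall w, (X w)%:C =
             csum [set nu : int | nu != 0]
               (fun nu => fsharp A f nu * \tr (V nu w))) /\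
          ('E_P[fun w => (X w ^+ 2)%R] = L)%E].
Proof.
move=> f L; have [M hM] := wcoef_summable f0 hf; split.
- by rewrite -ge0_fin_numE ?L_ge0 // (L_fin A f0 hf M hM).
- exact: (variance_limit A detA hypA f0 hf M hM U hU psi hpsi).
move=> d Omega P V hV indV.
(* By [fsharp_real] the real part is the full coefficient on nonzero levels, as [random_series]
   takes real coefficients. *)
pose fs nu := complex.Re (fsharp A f nu).
have sfs : sums_le [set nu : int | nu != 0] (fun nu => `|fs nu|) M.
  by apply: sums_leW (fsharp_sums A f0 hf M hM) => // nu _; exact: normc_Re.
have [X [XE EX]] := random_series P V hV indV fs M sfs.
exists X; split => [w|].
  rewrite XE /csum; congr (_ +i* _); apply: rsum_eq => nu n0.
    by rewrite /fs -fsharp_real.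
  by rewrite /fs -fsharp_real.
rewrite EX; apply: eq_esum => nu n0; congr EFin.
by rewrite [in RHS]fsharp_real // /sqmod normc_norm real_normK ?num_real.
Qed.
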